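(* Let $(x_0,u_0)$ be a Pareto optimal solution of the multiobjective Bolza problem $(\mathcal B)$. Assume: (a) for each $i\in\{1,\dots,l\}$, $f_i^0$ is continuous on $[0,T]\times\Omega\times U$; $D_{G,2}f_i^0(t,\xi,\zeta)$ exists for all $(t,\xi,\zeta)\in[0,T]\times\Omega\times U$; $D_{F,2}f_i^0(t,x_0(t),\zeta)$ exists for all $(t,\zeta)\in[0,T]\times U$; $(t,\zeta)\mapsto D_{F,2}f_i^0(t,x_0(t),\zeta)$ is continuous from $[0,T]\times U$ to $E^*$; and for all non-empty compact $K\subset\Omega$, $M\subset U$, $\sup_{[0,T]\times K\times M}\|D_{G,2}f_i^0(t,\xi,\zeta)\|_{\mathcal L}<+\infty$; (b) $f$ is continuous on $[0,T]\times\Omega\times U$; $D_{G,2}f(t,\xi,\zeta)$ exists for all $(t,\xi,\zeta)\in[0,T]\times\Omega\times U$; $D_{F,2}f(t,x_0(t),\zeta)$ exists for all $(t,\zeta)\in[0,T]\times U$; $(t,\zeta)\mapsto D_{F,2}f(t,x_0(t),\zeta)$ is continuous from $[0,T]\times U$ to $\mathcal L(E,E)$; and for all non-empty compact $K\subset\Omega$, $M\subset U$, $\sup_{[0,T]\times K\times M}\|D_{G,2}f(t,\xi,\zeta)\|_{\mathcal L}<+\infty$; (c) all $g_i^0$ and all $g^\alpha$ are Hadamard differentiable at $x_0(T)$; (d) each $h^\beta$ is continuous on a neighborhood of $x_0(T)$ and Hadamard differentiable at $x_0(T)$. Let $j\in\{1,\dots,l\}$ and assume moreover that $U$ is a subset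 of a real normed vector space $Y$ such that $U$ is a neighborhood of $u_0(T)$ in $Y$, $D_{G,3}f(T,x_0(T),u_0(T))$ exists, $D_{G,3}f_i^0(T,x_0(T),u_0(T))$ exists for all $i\in\{1,\dots,l\}$ with $i\ne j$, and the functionals $D_Hg_i^0(x_0(T))\circ D_{G,3}f(T,x_0(T),u_0(T))+D_{G,3}f_i^0(T,x_0(T),u_0(T))$ ($1\le i\le l$, $i\ne j$), $D_Hg^\alpha(x_0(T))\circ D_{G,3}f(T,x_0(T),u_0(T))$ ($1\le\alpha\le m$), $D_Hh^\beta(x_0(T))\circ D_{G,3}f(T,x_0(T),u_0(T))$ ($1\le\beta\le q$) form a linearly independent family in $Y^*$. Then every tuple $((\theta_i)_{1\le i\le l},(\lambda_\alpha)_{1\le\alpha\le m},(\mu_\beta)_{1\le\beta\le q},p)\in\mathbb R^l\times\mathbb R^m\times\mathbb R^q\times PC^1([0,T],E^* )$ satisfying the Pontryagin conditions (NN), (Si), (S$\ell$), (TC), (AE.B), (MP.B), (CH.B) listed in the context has $\theta_j\ne0$, and there exists such a tuple with $\theta_j=1$. Moreover, if $D_{G,3}f_j^0(T,x_0(T),u_0(T))$ exists, then the tuple satisfying these conditions with $\theta_j=1$ is unique.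
   Context: Function spaces. Fix $T\in(0,+\infty)$. Let $Y$ be a Hausdorff space. A function $u:[0,T]\to Y$ is piecewise continuous if there is a subdivision $0=\tau_0<\tau_1<\dots<\tau_{k+1}=T$ such that $u$ is continuous on each $(\tau_i,\tau_{i+1})$, the right limits $u(\tau_i+)$ exist in $Y$ for $0\le i\le k$ and the left limits $u(\tau_i-)$ exist in $Y$ for $1\le i\le k+1$. $NPC^0([0,T],Y)$ is the set of piecewise continuous $u$ that are right continuous on $[0,T)$ and satisfy $u(T-)=u(T)$. If $Y$ is a real Banach space, $PC^1([0,T],Y)$ is the set of continuous $x:[0,T]\to Y$ for which there is a subdivision as before such that $x$ is continuously differentiable on each $(\tau_i,\tau_{i+1})$ and the one-sided limits $x'(\tau_i+)$ ($0\le i\le k$), $x'(\tau_i-)$ ($1\le i\le k+1$) exist in $Y$; for open $G\subset Y$, $PC^1([0,T],G)=\{x\in PC^1([0,T],Y): x([0,T])\subset G\}$. The extended derivative $\underline{d}x:[0,T]\to Y$ of such $x$ is $\underline{d}x(t)=x'(t)$ if $t\notin\{\tau_0,\dots,\tau_{k+1}\}$, $\underline{d}x(\tau_i)=x'(\tau_i+)$ for $0\le i\le k$, $\underline{d}x(T)=x'(T-)$. Differentials. For real normed spaces $X,Y$, $\mathcal L(X,Y)$ is the space of bounded linear maps with operator norm $\|\cdot\|_{\mathcal L}$ and $X^*=\mathcal L(X,\mathbb R)$. Let $G\subset X$ be non-empty open (or a neighborhood of the point considered), $\mathfrak f:G\to Y$, $x\in G$. $\mathfrak f$ is Gâteaux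 differentiable at $x$ if there is $D_G\mathfrak f(x)\in\mathcal L(X,Y)$ with $\lim_{t\to0+}\frac{\mathfrak f(x+th)-\mathfrak f(x)}{t}=D_G\mathfrak f(x)\cdot h$ for all $h\in X$; it is Hadamard differentiable at $x$ if there is $D_H\mathfrak f(x)\in\mathcal L(X,Y)$ such that for each compact $K\subset X$, $\lim_{t\to0+}\sup_{h\in K}\|\frac{\mathfrak f(x+th)-\mathfrak f(x)}{t}-D_H\mathfrak f(x)\cdot h\|=0$. $D_F\mathfrak f(x)$ is the Fréchet differential. $D_{G,k}$, $D_{F,k}$ denote partial Gâteaux/Fréchet differentials with respect to the $k$-th variable ($D_{G,3}f(t,\xi,\zeta)$ is the Gâteaux differential at $\zeta$ of $f(t,\xi,\cdot)$). Problem. $E$ is a real Banach space, $\Omega\subset E$ a non-empty open subset, $U$ a Hausdorff topological space, $\xi_0\in\Omega$, $l,m,q$ positive integers, $f:[0,T]\times\Omega\times U\to E$, $f_i^0:[0,T]\times\Omega\times U\to\mathbb R$, and $g_i^0,g^\alpha,h^\beta:\Omega\to\mathbb R$ ($1\le i\le l$, $1\le\alpha\le m$, $1\le\beta\le q$). The multiobjective Bolza problem $(\mathcal B)$ is: maximize $(J_1(x,u),\dots,J_l(x,u))$, $J_i(x,u)=g_i^0(x(T))+\int_0^Tf_i^0(t,x(t),u(t))\,dt$, over $x\in PC^1([0,T],\Omega)$, $u\in NPC^0([0,T],U)$ subject to $\underline{d}x(t)=f(t,x(t),u(t))$ for all $t\in[0,T]$, $x(0)=\xi_0$, $g^\alpha(x(T))\ge0$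 for all $\alpha$, $h^\beta(x(T))=0$ for all $\beta$. Pairs $(x,u)$ satisfying these constraints are admissible. An admissible $(\overline x,\overline u)$ is a Pareto optimal solution if there is no admissible $(x,u)$ with $J_i(x,u)\ge J_i(\overline x,\overline u)$ for all $i$ and $J_{i_0}(x,u)>J_{i_0}(\overline x,\overline u)$ for some $i_0$. Hamiltonian: $H_B:[0,T]\times\Omega\times U\times E^*\times\mathbb R^l\to\mathbb R$, $H_B(t,x,u,p,\theta)=\sum_{i=1}^l\theta_if_i^0(t,x,u)+p\cdot f(t,x,u)$. Pontryagin conditions for $(\theta=(\theta_i),(\lambda_\alpha),(\mu_\beta),p)$ at $(x_0,u_0)$: (NN) $((\theta_i)_i,(\lambda_\alpha)_\alpha,(\mu_\beta)_\beta)\ne 0$; (Si) $\theta_i\ge0$ for all $i$ and $\lambda_\alpha\ge 0$ for all $\alpha$; (S$\ell$) $\lambda_\alpha g^\alpha(x_0(T))=0$ for all $\alpha$; (TC) $\sum_{i=1}^l\theta_iD_Hg_i^0(x_0(T))+\sum_{\alpha=1}^m\lambda_\alpha D_Hg^\alpha(x_0(T))+\sum_{\beta=1}^q\mu_\beta D_Hh^\beta(x_0(T))=p(T)$; (AE.B) $\underline{d}p(t)=-D_{F,2}H_B(t,x_0(t),u_0(t),p(t),\theta)$ for all $t\in[0,T]$; (MP.B) $H_B(t,x_0(t),u_0(t),p(t),\theta)\ge H_B(t,x_0(t),\zeta,p(t),\theta)$ for all $t\in[0,T]$, $\zeta\in U$; (CH.B) $t\mapsto H_B(t,x_0(t),u_0(t),p(t),\theta)$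 is continuous on $[0,T]$. *)

(* Defs.v *)
From HB Require Import structures.
From mathcomp Require Import all_boot all_order all_algebra.
From mathcomp Require Import all_classical all_reals all_analysis.

Set Implicit Arguments.
Unset Strict Implicit.
Unset Printing Implicit Defensive.

Import Order.TTheory GRing.Theory Num.Theory.
Import numFieldNormedType.Exports.

Local Open Scope classical_set_scope.
Local Open Scope ring_scope.

Section BoundedLinear.
Context {R : realType}.
Variables X Y : normedModType R.
Implicit Types f g : X -> Y.

Definition is_bounded_linear f :=
  linear f /\ exists M : R, forall x, `|f x| <= M * `|x|.

Definition bounded_linear_pred : {pred X -> Y} := mem [set f | is_bounded_linear f].

Record bounded_linear := BoundedLinear {
  bounded_linear_fun :> X -> Y ;
  bounded_linear_funP : bounded_linear_fun \in bounded_linear_pred }.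

HB.instance Definition _ := [isSub for bounded_linear_fun].
HB.instance Definition _ := [Choice of bounded_linear by <:].

Lemma bounded_linear_submod_closed : submod_closed bounded_linear_pred.
Proof.
split.
  rewrite inE /=; split; first by move=> a x y /=; rewrite scaler0 addr0.
  by exists 0 => x; rewrite normr0 mul0r.
move=> a f g; rewrite !inE => -[lf [Mf bf]] [lg [Mg bg]]; split.
  move=> c x y; rewrite !fctE lf lg !scalerDr !scalerA (mulrC a c) -!addrA.
  by congr (_ + _); rewrite addrCA.
exists (`|a| * Mf + Mg) => x; rewrite !fctE mulrDl.
rewrite (le_trans (ler_normD _ _))// lerD// normrZ -mulrA.
by rewrite ler_wpM2l.
Qed.

HB.instance Definition _ := GRing.isSubmodClosed.Build R (X -> Y)
  bounded_linear_pred bounded_linear_submod_closed.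
HB.instance Definition _ := [SubChoice_isSubLmodule of bounded_linear by <:].

Lemma bounded_linear_linear (A : bounded_linear) : linear A.
Proof. by case: A => A /= /[!inE] -[]. Qed.

HB.instance Definition _ (A : bounded_linear) :=
  GRing.isLinear.Build R X Y *:%R A (bounded_linear_linear A).

Definition opnorm (A : bounded_linear) : R :=
  sup [set `|A x| | x in [set x : X | `|x| <= 1]].

Lemma has_sup_opnorm (A : bounded_linear) :
  has_sup [set `|A x| | x in [set x : X | `|x| <= 1]].
Proof.
split; first by exists `|A 0|, 0 => //=; rewrite normr0.
have : is_bounded_linear A by case: A => A /= /[!inE].
move=> [_ [M bM]]; exists `|M| => _ [x /= x1 <-].
rewrite (le_trans (bM x))// (le_trans (ler_norm _))// normrM normr_id.
by rewrite ler_piMr.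
Qed.

Lemma opnorm_ge0 (A : bounded_linear) : 0 <= opnorm A.
Proof.
apply: (le_trans (normr_ge0 (A 0))); apply: sup_upper_bound.
  exact: has_sup_opnorm.
by exists 0 => //=; rewrite normr0.
Qed.

Lemma le_opnorm (A : bounded_linear) x : `|A x| <= opnorm A * `|x|.
Proof.
have [->|x0] := eqVneq x 0; first by rewrite linear0 !normr0 mulr0.
rewrite -ler_pdivrMr ?normr_gt0//.
have -> : `|A x| / `|x| = `|A (`|x|^-1 *: x)|.
  by rewrite linearZ /= normrZ normfV normr_id mulrC.
apply: sup_upper_bound; first exact: has_sup_opnorm.
by exists (`|x|^-1 *: x) => //=; rewrite normrZ normfV normr_id mulVf ?normr_eq0.
Qed.

Lemma opnorm_le (A : bounded_linear) (c : R) : 0 <= c ->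
  (forall x, `|A x| <= c * `|x|) -> opnorm A <= c.
Proof.
move=> c0 Ac; apply: ge_sup; first exact: (has_sup_opnorm A).1.
by move=> _ [x /= x1 <-]; rewrite (le_trans (Ac x))// ler_piMr.
Qed.

Lemma opnormD (A B : bounded_linear) : opnorm (A + B) <= opnorm A + opnorm B.
Proof.
apply: opnorm_le => [|x]; first by rewrite addr_ge0// opnorm_ge0.
by rewrite (le_trans (ler_normD _ _))// mulrDl lerD// le_opnorm.
Qed.

Lemma opnormZ (a : R) (A : bounded_linear) : opnorm (a *: A) = `|a| * opnorm A.
Proof.
have le_opnormZ c B : opnorm (c *: B) <= `|c| * opnorm B.
  apply: opnorm_le => [|x]; first by rewrite mulr_ge0// opnorm_ge0.
  by rewrite [(c *: B) x]/(c *: B x) normrZ -mulrA ler_wpM2l// le_opnorm.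
apply/eqP; rewrite eq_le le_opnormZ /=.
have [->|a0] := eqVneq a 0; first by rewrite normr0 mul0r opnorm_ge0.
rewrite -ler_pdivlMl ?normr_gt0// -normfV.
by rewrite -[in leLHS](scale1r A) -(mulVf a0) -scalerA le_opnormZ.
Qed.

Lemma opnorm0_eq0 (A : bounded_linear) : opnorm A = 0 -> A = 0.
Proof.
move=> A0; apply/val_inj/funext => x /=; apply/eqP.
by rewrite -normr_le0 (le_trans (le_opnorm A x))// A0 mul0r.
Qed.

HB.instance Definition _ := Lmodule_isNormed.Build R bounded_linear
  opnormD opnormZ opnorm0_eq0.

End BoundedLinear.

Lemma bounded_linear_comp_subproof (R : realType) (X Y Z : normedModType R)
    (B : bounded_linear Y Z) (A : bounded_linear X Y) :
  (B \o A) \in @bounded_linear_pred R X Z.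
Proof.
rewrite inE; split; first by move=> a x y; rewrite /= !linearP.
exists (opnorm B * opnorm A) => x; rewrite (le_trans (le_opnorm _ _))// -mulrA.
by rewrite ler_wpM2l ?opnorm_ge0// le_opnorm.
Qed.

Definition bl_comp (R : realType) (X Y Z : normedModType R)
    (B : bounded_linear Y Z) (A : bounded_linear X Y) : bounded_linear X Z :=
  BoundedLinear (bounded_linear_comp_subproof B A).

(* Functions on [0, T], on Omega and on U are represented by total functions;
   all notions below ignore the values outside of these sets. *)

Section FunctionSpaces.
Context {R : realType}.
Implicit Types (T : R) (k : nat) (tau : nat -> R).

Definition subdivision T k tau : Prop :=
  [/\ tau 0%N = 0, tau k.+1 = T & forall i, (i <= k)%N -> tau i < tau i.+1].

(* Piecewise continuity of u : [0, T] -> U, where U carries the topology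
   induced by Y; in particular the one-sided limits have to lie in U. *)
Definition piecewise_continuous T (Y : topologicalType) (U : set Y)
    (u : R -> Y) : Prop :=
  (forall t : R, t \in `[0, T] -> U (u t)) /\
  exists k tau, subdivision T k tau /\
    forall i, (i <= k)%N ->
      [/\ {in `]tau i, tau i.+1[, continuous u},
          exists2 y, U y & u @ (tau i)^'+ --> y &
          exists2 y, U y & u @ (tau i.+1)^'- --> y].

Definition NPC0 T (Y : topologicalType) (U : set Y) : set (R -> Y) :=
  [set u | [/\ piecewise_continuous T U u,
               forall t : R, t \in `[0, T[ -> u @ t^'+ --> u t &
               u @ T^'- --> u T]].

Section PC1.
Variable Y : normedModType R.
Implicit Type x : R -> Y.

Definition PC1_subdivision T x k tau : Prop :=
  subdivision T k tau /\
  forall i, (i <= k)%N ->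
    [/\ forall t : R, t \in `]tau i, tau i.+1[ -> derivable x t 1,
        {in `]tau i, tau i.+1[, continuous (derive1 x)},
        cvg (derive1 x @ (tau i)^'+) & cvg (derive1 x @ (tau i.+1)^'-)].

Definition PC1 T (G : set Y) : set (R -> Y) :=
  [set x | [/\ forall t : R, t \in `[0, T] -> G (x t),
               {within `[0, T], continuous x} &
               exists k tau, PC1_subdivision T x k tau]].

Definition ext_deriv_on x k tau (t : R) : Y :=
  if t == tau k.+1 then lim (derive1 x @ t^'-)
  else if [exists i : 'I_k.+1, t == tau i] then lim (derive1 x @ t^'+)
  else derive1 x t.

(* The extended derivative; by ext_derivE it does not depend on the choice of
   the subdivision. *)
Definition ext_deriv T x : R -> Y :=
  let: (k, tau) := get [set s : nat * (nat -> R) | PC1_subdivision T x s.1 s.2] in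
  ext_deriv_on x k tau.

Lemma subdivision_locate T k tau t : subdivision T k tau ->
  0 <= t -> t < T -> exists2 i, (i <= k)%N & tau i <= t < tau i.+1.
Proof.
move=> [tau0 tauT _] t0; rewrite -tauT.
elim: k {tauT} => [tk|k IH tk]; first by exists 0%N => //; rewrite tau0 t0.
have [/IH[i ik it]|kt] := ltP t (tau k.+1); first by exists i => //; exact: leqW.
by exists k.+1 => //; rewrite kt.
Qed.

Lemma ext_deriv_onE T x k tau t : PC1_subdivision T x k tau ->
  t \in `[0, T] -> ext_deriv_on x k tau t =
    if t == T then lim (derive1 x @ t^'-) else lim (derive1 x @ t^'+).
Proof.
move=> [st dx]; rewrite in_itv /= => /andP[t0 tT].
have [_ tauT _] := st; rewrite /ext_deriv_on tauT; case: eqVneq => // tNT.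
case: existsP => [//|ntau].
have [|i ik /andP[it ti]] := subdivision_locate st t0; first by rewrite lt_neqAle tNT.
have [_ cx _ _] := dx i ik; apply/esym/cvg_lim => //.
apply/cvg_at_right_filter/cx; rewrite in_itv /= ti andbT lt_neqAle it andbT.
apply/eqP => tit; apply: ntau; have ik1 : (i < k.+1)%N by [].
by exists (Ordinal ik1); rewrite /= tit.
Qed.

Lemma ext_derivE T x k tau t : PC1_subdivision T x k tau ->
  t \in `[0, T] -> ext_deriv T x t = ext_deriv_on x k tau t.
Proof.
move=> stx tT; rewrite (ext_deriv_onE stx tT) /ext_deriv.
have := @getPex _ [set s | PC1_subdivision T x s.1 s.2]
  (ex_intro _ (k, tau) stx).
by case: (get _) => k' tau' /= stx'; rewrite (ext_deriv_onE stx' tT).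
Qed.

End PC1.

End FunctionSpaces.

Section Differentials.
Context {R : realType} {X Y : normedModType R}.
Implicit Types (f : X -> Y) (x : X) (A : bounded_linear X Y).

Definition is_gateaux f x A : Prop :=
  forall h, t^-1 *: (f (x + t *: h) - f x) @[t --> 0^'+] --> A h.

(* The supremum is taken in the extended reals, so that an unbounded difference
   quotient is not assigned a junk value; K is non-empty since the supremum of
   the empty set is -oo. *)
Definition is_hadamard f x A : Prop :=
  forall K : set X, compact K -> K !=set0 ->
    ereal_sup [set `|t^-1 *: (f (x + t *: h) - f x) - A h|%:E | h in K]
      @[t --> 0^'+] --> 0%E.

Definition is_frechet f x A : Prop :=
  differentiable f x /\ 'd f x = A :> (X -> Y).

Definition gateaux_differentiable f x := exists A, is_gateaux f x A.
Definition hadamard_differentiable f x := exists A, is_hadamard f x A.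
Definition frechet_differentiable f x := exists A, is_frechet f x A.

Definition DG f x : bounded_linear X Y := get (is_gateaux f x).
Definition DH f x : bounded_linear X Y := get (is_hadamard f x).
Definition DF f x : bounded_linear X Y := get (is_frechet f x).

End Differentials.

Definition linearly_independent (R : realType) (V : lmodType R) (I : finType)
    (v : I -> V) : Prop :=
  forall c : I -> R, \sum_i c i *: v i = 0 -> forall i, c i = 0.

Section Bolza.
Context {R : realType} {E : completeNormedModType R} {Y : topologicalType}.
Context {l m q : nat}.
Variables (T : R) (Omega : set E) (U : set Y) (xi0 : E).
Variables (f : R -> E -> Y -> E) (f0 : 'I_l -> R -> E -> Y -> R).
Variables (g0 : 'I_l -> E -> R) (g : 'I_m -> E -> R) (h : 'I_q -> E -> R).
Implicit Types (x : R -> E) (u : R -> Y).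

Definition admissible x u : Prop :=
  [/\ PC1 T Omega x, NPC0 T U u,
      forall t : R, t \in `[0, T] -> ext_deriv T x t = f t (x t) (u t) &
      [/\ x 0 = xi0, forall a, 0 <= g a (x T) & forall b, h b (x T) = 0]].

Definition objective (i : 'I_l) x u : R :=
  g0 i (x T) + \int[lebesgue_measure]_(t in `[0, T]) f0 i t (x t) (u t).

Definition pareto_optimal x u : Prop :=
  admissible x u /\
  ~ exists x' u', [/\ admissible x' u',
      forall i, objective i x u <= objective i x' u' &
      exists i, objective i x u < objective i x' u'].

Definition hamiltonian (t : R) (xi : E) (zeta : Y) (p : bounded_linear E R)
    (theta : 'rV[R]_l) : R :=
  \sum_i theta 0 i * f0 i t xi zeta + p (f t xi zeta).

Definition pontryagin_conditions (x0 : R -> E) (u0 : R -> Y)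
    (theta : 'rV[R]_l) (lambda : 'rV[R]_m) (mu : 'rV[R]_q)
    (p : R -> bounded_linear E R) : Prop :=
  [/\ (theta, lambda, mu) <> (0, 0, 0),
      (forall i, 0 <= theta 0 i) /\ (forall a, 0 <= lambda 0 a),
      forall a, lambda 0 a * g a (x0 T) = 0,
      \sum_i theta 0 i *: DH (g0 i) (x0 T)
        + \sum_a lambda 0 a *: DH (g a) (x0 T)
        + \sum_b mu 0 b *: DH (h b) (x0 T) = p T &
  [/\ forall t : R, t \in `[0, T] -> ext_deriv T p t =
        - DF (fun xi => hamiltonian t xi (u0 t) (p t) theta) (x0 t),
      forall (t : R) zeta, t \in `[0, T] -> U zeta ->
        hamiltonian t (x0 t) zeta (p t) theta
          <= hamiltonian t (x0 t) (u0 t) (p t) theta &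
      {within `[0, T], continuous
        (fun t : R => hamiltonian t (x0 t) (u0 t) (p t) theta)}]].

Definition regular_along (F : normedModType R) (x0 : R -> E)
    (phi : R -> E -> Y -> F) : Prop :=
  [/\ {within `[0, T]%classic `*` Omega `*` U,
        continuous (fun w : R * E * Y => phi w.1.1 w.1.2 w.2)},
      forall (t : R) xi zeta, t \in `[0, T] -> Omega xi -> U zeta ->
        gateaux_differentiable (phi t ^~ zeta) xi,
      forall (t : R) zeta, t \in `[0, T] -> U zeta ->
        frechet_differentiable (phi t ^~ zeta) (x0 t),
      {within `[0, T]%classic `*` U,
        continuous (fun w : R * Y => DF (phi w.1 ^~ w.2) (x0 w.1))} &
      forall (K : set E) (M : set Y),
        compact K -> K !=set0 -> K `<=` Omega ->
        compact M -> M !=set0 -> M `<=` U ->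
        (ereal_sup [set `|DG (phi w.1.1 ^~ w.2) w.1.2|%:E
                   | w in `[0, T]%classic `*` K `*` M]%R < +oo)%E].

End Bolza.

(* Main.v *)
(* The dynamics is perturbed by needles: near finitely many times t_k the
   control u0 is replaced by v_k on intervals of length r * b_k.  As r tends to 0
   the endpoint x (T) and the running costs move, to first order in r, by the
   nonnegative combination with weights b_k of the solutions of the linearized
   equations issued from the jumps f (t_k, x0, v_k) - f (t_k, x0, u0).  Composing
   with the Hadamard differentials at x0 (T) gives a convex cone of first-order
   variations of (J, g, h).  If this cone came close to increasing all J_i and
   all active g_a while moving h by +- e_b for each b, one could choose the weights
   depending on a parameter eta in the cube [-1, 1]^q so that h points outwards
   on opposite faces for small r; the Poincare-Miranda theorem would then
   produce an admissible better trajectory, against Pareto optimality.  Hence the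
   cone is separated from some target direction, and the separating functional
   consists of the multipliers (theta, lambda, mu).  The costate p solves the
   adjoint equation backwards from the transversality condition, and its duality
   with the linearized equation turns the separation inequality for one needle
   into the maximum principle.

   Since u0 (T) is interior to U, the derivative at u0 (T) of the Hamiltonian at
   time T vanishes as soon as it exists, which with the transversality condition
   is a linear relation with coefficients (theta, lambda, mu) between the functionals
   assumed independent and the one of index j: this gives theta_j <> 0 and the
   uniqueness of the normalized multipliers; p is then determined by the linear
   adjoint equation. *)
From HB Require Import structures.
Require Import Defs.
From mathcomp Require Import all_boot all_order all_algebra.
From mathcomp Require Import all_classical all_reals all_analysis.
From mathcomp Require Import measurable_realfun.
From mathcomp Require Import zify ring lra.

Set Implicit Arguments.
Unset Strict Implicit.
Unset Printing Implicit Defensive.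

Import Order.TTheory GRing.Theory Num.Theory.
Import numFieldNormedType.Exports.

Local Open Scope classical_set_scope.
Local Open Scope ring_scope.

(** The obstacle is low regularity. In the state, Frechet differentials exist only at [x0 t], with
    no uniformity in [t]; nearby there are only Gateaux differentials, bounded on compact sets, and
    a tube around [x0] is not compact in an infinite-dimensional Banach space. So a Lipschitz tube
    has to be extracted by a sequential argument, and linearization errors vanish only pointwise in
    time, which is why dominated convergence enters Gronwall's estimate. As the endpoint functions
    are only Hadamard differentiable and [h] is merely continuous nearby, no implicit function
    theorem applies: a topological zero theorem takes its place, fed by the continuity of the
    endpoint in the needle weights at fixed [r]. Uniformity in [eta] is never proved directly: a bad
    sequence is extracted, its parameters converge by compactness of the cube, and the first-order
    expansion is needed only along that sequence. Vector-valued calculus is carried out through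
    primitives with finitely many exceptional points; Lebesgue integration serves only the scalar
    costs and dominated convergence. *)

(** * Equalities in abelian groups, by reflection *)

Inductive zexpr := ZVar of nat | ZZero | ZAdd of zexpr & zexpr | ZOpp of zexpr.

Fixpoint zeval (V : zmodType) (env : seq V) (e : zexpr) : V :=
  match e with
  | ZVar n => nth 0 env n
  | ZZero => 0
  | ZAdd e1 e2 => zeval env e1 + zeval env e2
  | ZOpp e1 => - zeval env e1
  end.

Fixpoint zcoef (e : zexpr) (k : nat) : int :=
  match e with
  | ZVar n => (n == k)%:Z
  | ZZero => 0
  | ZAdd e1 e2 => zcoef e1 k + zcoef e2 k
  | ZOpp e1 => - zcoef e1 k
  end.

Lemma zevalE (V : zmodType) (env : seq V) e :
  zeval env e = \sum_(k < size env) env`_k *~ zcoef e k.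
Proof.
elim: e => [n||e1 IH1 e2 IH2|e IH] /=.
- have [nenv|envn] := ltnP n (size env).
    rewrite (bigD1 (Ordinal nenv))//= eqxx mulr1z big1 ?addr0// => i.
    by rewrite -val_eqE/= eq_sym => /negPf ->; rewrite mulr0z.
  rewrite nth_default// big1// => i _; rewrite gtn_eqF ?mulr0z//.
  exact: leq_trans (ltn_ord i) envn.
- by rewrite big1// => i _; rewrite mulr0z.
- by rewrite IH1 IH2 -big_split; apply: eq_bigr => i _; rewrite mulrzDr.
- by rewrite IH -sumrN; apply: eq_bigr => i _; rewrite mulrNz.
Qed.

(** Coefficients are computed in [int], so the premise is decided by evaluation whatever the
    group. *)
Lemma zeval_eq (V : zmodType) (env : seq V) e1 e2 :
  all (fun k => zcoef e1 k == zcoef e2 k) (iota 0 (size env)) ->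
  zeval env e1 = zeval env e2.
Proof.
move=> /allP H; rewrite !zevalE; apply: eq_bigr => i _; congr (_ *~ _).
by apply/eqP/H; rewrite mem_iota add0n ltn_ord.
Qed.

(* Atoms are compared up to conversion, since the same operation may appear
   through different canonical structure paths. *)
Ltac zmem x l :=
  lazymatch l with
  | nil => constr:(false)
  | ?y :: ?l' =>
    match constr:(tt) with
    | _ => let _ := match constr:(tt) with _ => unify x y end in constr:(true)
    | _ => zmem x l'
    end
  end.
Ltac zindex x l :=
  lazymatch l with
  | ?y :: ?l' =>
    match constr:(tt) with
    | _ => let _ := match constr:(tt) with _ => unify x y end in constr:(O)
    | _ => let n := zindex x l' in constr:(S n)
    end
  end.
Ltac zatoms l e :=
  lazymatch e with
  | ?a + ?b => let l1 := zatoms l a in zatoms l1 b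
  | - ?a => zatoms l a
  | 0 => l
  | ?x => lazymatch zmem x l with
          | true => l
          | false => constr:(cons x l)
          end
  end.
Ltac zreify l e :=
  lazymatch e with
  | ?a + ?b => let r1 := zreify l a in let r2 := zreify l b in constr:(ZAdd r1 r2)
  | - ?a => let r := zreify l a in constr:(ZOpp r)
  | 0 => constr:(ZZero)
  | ?x => let n := zindex x l in constr:(ZVar n)
  end.
(* The [ring] tactic for abelian groups. *)
Ltac zmod :=
  lazymatch goal with
  | |- @eq ?V ?a ?b =>
    let l := zatoms (@nil V) a in
    let l := zatoms l b in
    let ra := zreify l a in
    let rb := zreify l b in
    apply: (@zeval_eq _ l ra rb); vm_compute; reflexivity
  end.

(** * Primitives and piecewise continuous functions *)

Section RealInduction.
Context {R : realType}.
Implicit Types (a b c d s t : R) (S : seq R).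

(** The supremum of the points of [[a, b]] satisfying [P] satisfies [P] by the last premise and, by
    the one before, cannot lie below [b]. This replaces compactness of [[a, b]] wherever local
    information is pasted together. *)
Lemma real_induction a b (P : R -> Prop) : a <= b -> P a ->
  (forall c, a <= c < b -> P c -> exists2 d, c < d <= b & P d) ->
  (forall c, a < c <= b ->
    (forall e, e < c -> exists2 s, e < s < c & a <= s /\ P s) -> P c) ->
  P b.
Proof.
move=> ab Pa Pr Pl.
pose A := [set c | a <= c <= b /\ P c].
have A0 : A !=set0 by exists a; split=> //; rewrite lexx.
have Ab : ubound A b by move=> c [/andP[]].
have hsA : has_sup A by split=> //; exists b.
have as_ : a <= sup A by apply: ub_le_sup; [exists b|split=> //; rewrite lexx].
have sb : sup A <= b by apply: ge_sup.
have Ps : P (sup A).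
  have [//|nP] := pselect (P (sup A)).
  have as' : a < sup A.
    rewrite lt_neqAle as_ andbT; apply/eqP => e; apply: nP; by rewrite -e.
  apply: Pl => [|e es]; first by rewrite as' sb.
  have es' : 0 < sup A - e by rewrite subr_gt0.
  have [s As] := sup_adherent es' hsA; rewrite opprB addrCA subrr addr0 => e_s.
  have [/andP[s_a s_b] Ps] := As.
  exists s => //; rewrite e_s /= lt_neqAle; apply/andP; split.
    by apply/eqP => se; apply: nP; rewrite -se.
  by apply: ub_le_sup => //; exists b.
have [sb'|] := ltP (sup A) b; last by move=> bs; rewrite (@le_anti _ _ b (sup A)) ?bs.
have [|d /andP[sd db] Pd] := Pr (sup A) _ Ps; first by rewrite as_ sb'.
have : d <= sup A.
  apply: ub_le_sup; first by exists b.
  by split=> //; rewrite db andbT (le_trans as_)// ltW.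
by rewrite leNgt sd.
Qed.

End RealInduction.

Section Epsilon.
Context {R : realType} {W : normedModType R}.
Implicit Types (a b s t : R) (x : R -> W).

Lemma within_continuous_eps a b x : {within `[a, b], continuous x} <->
  (forall t, a <= t <= b -> forall e, 0 < e -> exists2 d, 0 < d &
    forall s, a <= s <= b -> `|s - t| < d -> `|x s - x t| < e).
Proof.
rewrite subspace_continuousP; split=> H t.
  move=> tab e e0.
  have /cvgrPdist_lt/(_ e e0) : x @ within `[a, b] (nbhs t) --> x t.
    by apply: H; rewrite /= in_itv.
  rewrite near_withinE => /nbhs_ballP[d /= d0 {}H].
  exists d => // s sab sd; rewrite distrC; apply: H; last by rewrite /= in_itv.
  by rewrite /ball/= distrC.
rewrite /= in_itv /= => tab; apply/cvgrPdist_lt => e e0.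
have [d d0 {}H] := H t tab e e0.
rewrite near_withinE; apply/nbhs_ballP; exists d => //= s sd.
by rewrite in_itv /= => sab; rewrite distrC; apply: H => //; rewrite distrC.
Qed.

Lemma is_derive_eps x t (d : W) : is_derive t 1 x d <->
  (forall e, 0 < e -> exists2 r, 0 < r &
    forall s, `|s - t| < r -> `|x s - x t - (s - t) *: d| <= e * `|s - t|).
Proof.
have quotE (h : R) (A B : W) : h != 0 -> `|B - h^-1 *: A| = `|h^-1 *: (A - h *: B)|.
  by move=> h0; rewrite distrC scalerBr scalerA mulVf// scale1r.
split=> [[dx <-] e e0|H].
  have : (fun h => h^-1 *: ((x \o shift t) (h *: (1 : R)) - x t)) @ 0^' --> 'D_1 x t.
    exact: dx.
  move=> /cvgrPdist_le/(_ e e0); rewrite near_withinE => /nbhs_ballP[r /= r0 {}H].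
  exists r => // s sr; have [->|st] := eqVneq s t.
    by rewrite !subrr scale0r normr0 mulr0 subrr normr0.
  have st0 : s - t != 0 by rewrite subr_eq0.
  have := H (s - t); rewrite /ball/= sub0r normrN => /(_ sr st0).
  rewrite [_ *: 1]mulr1 subrK -ler_pdivrMr ?normr_gt0//; apply: le_trans.
  by rewrite quotE// normrZ normfV mulrC.
have cx : (fun h => h^-1 *: ((x \o shift t) (h *: (1 : R)) - x t)) @ 0^' --> d.
  apply/cvgrPdist_le => e e0; have [r r0 {}H] := H e e0.
  rewrite near_withinE; apply/nbhs_ballP; exists r => //= h.
  rewrite /ball/= sub0r normrN [_ *: 1]mulr1 => hr h0.
  have := H (h + t); rewrite addrK => /(_ hr).
  rewrite -ler_pdivrMr ?normr_gt0//; apply: le_trans.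
  by rewrite quotE// normrZ normfV mulrC.
by apply: DeriveDef; [apply/cvg_ex; exists d|exact: cvg_lim].
Qed.

End Epsilon.

(** [S] is an unordered list of exceptional points where only continuity is asked. Two primitives
    are combined by enlarging their lists, without common refinements of subdivisions. *)
Definition primitive {R : realType} {W : normedModType R} (a b : R) (S : seq R)
    (x G : R -> W) :=
  {within `[a, b], continuous x} /\
  forall t, a < t < b -> t \notin S -> is_derive t (1 : R) x (G t).

Section Dini.
Context {R : realType}.
Implicit Types (a b c s t : R) (S : seq R).

Lemma within_continuous_sub {W : normedModType R} a b c d (x : R -> W) :
  a <= c -> d <= b -> {within `[a, b], continuous x} -> {within `[c, d], continuous x}.
Proof.
move=> ac db; apply: continuous_subspaceW => t /=; rewrite !in_itv /=.
by move=> /andP[ct td]; rewrite (le_trans ac)// (le_trans td).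
Qed.

(** The upper right Dini derivative of [v] at [t] is at most 0. *)
Definition dini_le0 (v : R -> R) t := forall e, 0 < e -> exists2 r, 0 < r &
  forall s, t < s < t + r -> v s - v t <= e * (s - t).

Let dini_oo a b v : a < b -> {within `[a, b], continuous v} ->
  (forall t, a < t < b -> dini_le0 v t) -> v b <= v a.
Proof.
move=> ab cv dv.
(* The induction starts at [c > a], since nothing is assumed on the derivative at [a]; [c] is moved
   to [a] by continuity afterwards. *)
have H e c : 0 < e -> a < c < b -> v b - v c <= e * (b - c).
  move=> e0 /andP[ac cb].
  apply: (@real_induction _ c b (fun s => v s - v c <= e * (s - c))).
  - exact: ltW.
  - by rewrite !subrr mulr0.
  - move=> t /andP[ct tb] vt.
    have [|r r0 Hr] := dv t _ _ e0; first by rewrite tb (lt_le_trans ac).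
    have m1 : 0 < Num.min r (b - t) by rewrite lt_min r0 subr_gt0.
    have m2 : Num.min r (b - t) <= r by rewrite ge_min lexx.
    have m3 : Num.min r (b - t) <= b - t by rewrite ge_min lexx orbT.
    move: (Num.min r (b - t)) m1 m2 m3 => m m1 m2 m3.
    exists (t + m / 2); first by apply/andP; split; lra.
    have -> : e * (t + m / 2 - c) = e * (t + m / 2 - t) + e * (t - c) by ring.
    have : v (t + m / 2) - v t <= e * (t + m / 2 - t) by apply: Hr; apply/andP; split; lra.
    lra.
  - move=> t /andP[ct tb] Hs; apply/ler_addgt0Pr => k k0.
    have [|d d0 Hd] := (within_continuous_eps _ _ _).1 cv t _ _ k0.
      by rewrite tb andbT ltW// (lt_trans ac).
    have td : t - d < t by lra.
    have [s /andP[ds st] [cs vs]] := Hs _ td.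
    have : e * (s - c) <= e * (t - c) by rewrite ler_pM2l// lerD2r ltW.
    have : `|v s - v t| < k.
      by apply: Hd; rewrite ?ltr_distl; apply/andP; split; lra.
    rewrite ltr_distl => /andP[]; lra.
apply/ler_addgt0Pr => k k0.
have k2 : 0 < k / 2 by lra.
have [|d d0 Hd] := (within_continuous_eps _ _ _).1 cv a _ _ k2; first by rewrite lexx ltW.
have m1 : 0 < Num.min d (b - a) by rewrite lt_min d0 subr_gt0.
have m2 : Num.min d (b - a) <= d by rewrite ge_min lexx.
have m3 : Num.min d (b - a) <= b - a by rewrite ge_min lexx orbT.
move: (Num.min d (b - a)) m1 m2 m3 => m m1 m2 m3.
have e0 : 0 < k / 2 / (b - a) by rewrite divr_gt0// subr_gt0.
have := H (k / 2 / (b - a)) (a + m / 2) e0.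
have : k / 2 / (b - a) * (b - (a + m / 2)) <= k / 2.
  by rewrite mulrAC ler_pdivrMr ?subr_gt0// ler_pM2l//; lra.
have : `|v (a + m / 2) - v a| < k / 2.
  by apply: Hd; rewrite ?ltr_distl; apply/andP; split; lra.
rewrite ltr_distl => /andP[_ H1] H2 H3.
have : v b - v (a + m / 2) <= k / 2 / (b - a) * (b - (a + m / 2)).
  by apply: H3; apply/andP; split; lra.
lra.
Qed.

(** An exceptional point inside the interval splits it in two; the inequalities on the two halves
    are then chained. *)
Lemma dini a b S v : a <= b -> {within `[a, b], continuous v} ->
  (forall t, a < t < b -> t \notin S -> dini_le0 v t) -> v b <= v a.
Proof.
elim: S a b => [|c S IH] a b.
  rewrite le_eqVlt => /predU1P[->//|ab] cv dv.
  by apply: dini_oo => // t /dv; apply.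
move=> ab cv dv.
have [cab|cab] := boolP (a < c < b).
  have /andP[ac cb] := cab; apply: (@le_trans _ _ (v c)).
    apply: IH; [exact: ltW|by apply: within_continuous_sub cv; rewrite ?lexx ?ltW|].
    move=> t /andP[ct tb] tS; apply: dv; first by rewrite tb (lt_trans ac).
    by rewrite inE negb_or tS gt_eqF.
  apply: IH; [exact: ltW|by apply: within_continuous_sub cv; rewrite ?lexx ?ltW|].
  move=> t /andP[ct tb] tS; apply: dv; first by rewrite ct (lt_trans tb).
  by rewrite inE negb_or tS lt_eqF.
apply: IH => // t tab tS; apply: dv => //; rewrite inE negb_or tS andbT.
by apply: contraNneq cab => <-.
Qed.

End Dini.

Section PrimitiveTheory.
Context {R : realType} {W : normedModType R}.
Implicit Types (a b c d s t : R) (S : seq R) (x G : R -> W).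

Lemma primitive_sub a b c d S x G : a <= c -> d <= b ->
  primitive a b S x G -> primitive c d S x G.
Proof.
move=> ac db [cx dx]; split; first exact: within_continuous_sub cx.
by move=> t /andP[ct td]; apply: dx; rewrite (le_lt_trans ac)// (lt_le_trans td).
Qed.

Lemma primitive_subS a b S S' x G : {subset S <= S'} ->
  primitive a b S x G -> primitive a b S' x G.
Proof.
move=> SS' [cx dx]; split=> // t tab tS; apply: dx => //.
by apply: contra tS; apply: SS'.
Qed.

Lemma primitive_ext a b S x x' G G' :
  (forall t, a <= t <= b -> x t = x' t) ->
  (forall t, a < t < b -> t \notin S -> G t = G' t) ->
  primitive a b S x G -> primitive a b S x' G'.
Proof.
move=> xx' GG' [cx dx]; split.
  apply/within_continuous_eps => t tab e e0.
  have [r r0 H] := (within_continuous_eps _ _ _).1 cx t tab e e0.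
  by exists r => // s sab /(H _ sab); rewrite !xx'.
move=> t tab tS; rewrite -(GG' t)//.
apply: near_eq_is_derive (dx t tab tS).
have : \forall s \near t, s \in `]a, b[ by apply: near_in_itvoo; rewrite in_itv.
apply: filterS => s; rewrite in_itv /= => /andP[sa sb].
by rewrite xx'// !ltW.
Qed.

Lemma primitive_cst a b S (v : W) : primitive a b S (cst v) (cst 0).
Proof.
split; first by apply: continuous_subspaceT => t; exact: cst_continuous.
by move=> t _ _; exact: is_derive_cst.
Qed.

Lemma primitiveD a b S x G x' G' : primitive a b S x G -> primitive a b S x' G' ->
  primitive a b S (fun t => x t + x' t) (fun t => G t + G' t).
Proof.
move=> [cx dx] [cx' dx']; split.
  by move=> t; apply: cvgD; [exact: cx|exact: cx'].
by move=> t tab tS; apply: is_deriveD; [exact: dx|exact: dx'].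
Qed.

Lemma primitiveZ a b S k x G : primitive a b S x G ->
  primitive a b S (fun t => k *: x t) (fun t => k *: G t).
Proof.
move=> [cx dx]; split; first by move=> t; apply: cvgZr; exact: cx.
by move=> t tab tS; apply: is_deriveZ; exact: dx.
Qed.

Lemma primitiveB a b S x G x' G' : primitive a b S x G -> primitive a b S x' G' ->
  primitive a b S (fun t => x t - x' t) (fun t => G t - G' t).
Proof.
move=> H1 /(primitiveZ (-1)) H2; apply: primitive_ext (primitiveD H1 H2) => t _.
  by rewrite scaleN1r.
by rewrite scaleN1r.
Qed.

Lemma primitive_line a b S (c : R) (v : W) :
  primitive a b S (fun t => (t - c) *: v) (cst v).
Proof.
have D t : is_derive t (1 : R) (fun t => (t - c) *: v) v.
  apply/is_derive_eps => e e0; exists 1 => // s _.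
  rewrite -scalerBl opprB addrA subrK -scalerBl subrr scale0r normr0.
  by rewrite mulr_ge0// ltW.
split=> // ; apply: continuous_subspaceT => t.
by apply: differentiable_continuous; apply/derivable1_diffP; case: (D t).
Qed.

Lemma primitive_cat a b c S x G : a <= b -> b <= c ->
  primitive a b S x G -> primitive b c S x G -> primitive a c (b :: S) x G.
Proof.
move=> ab bc [cx dx] [cx' dx']; split; last first.
  move=> t /andP[ta tc]; rewrite inE negb_or => /andP[tb tS].
  have [tb'|tb'|tb'] := ltgtP t b.
  - by apply: dx; rewrite // ta.
  - by apply: dx'; rewrite // tb'.
  - by rewrite tb' eqxx in tb.
apply/within_continuous_eps => t /andP[ta tc] e e0.
have L : exists2 d, 0 < d & forall s, a <= s <= b -> t <= b ->
    `|s - t| < d -> `|x s - x t| < e.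
  have [tb|tb] := leP t b; last by exists 1.
  have [|d d0 H] := (within_continuous_eps _ _ _).1 cx t _ e e0; first by rewrite ta.
  by exists d => // s sab _; exact: H.
have Rt : exists2 d, 0 < d & forall s, b <= s <= c -> b <= t ->
    `|s - t| < d -> `|x s - x t| < e.
  have [tb|tb] := leP b t; last by exists 1.
  have [|d d0 H] := (within_continuous_eps _ _ _).1 cx' t _ e e0; first by rewrite tb.
  by exists d => // s sab _; exact: H.
have [d1 d10 H1] := L; have [d2 d20 H2] := Rt.
have [tb|tb|tb] := ltgtP t b.
- exists (Num.min d1 (b - t)); first by rewrite lt_min d10 subr_gt0.
  move=> s /andP[as_ sc]; rewrite lt_min => /andP[sd]; rewrite ltr_distl => /andP[_ sb].
  apply: H1 => //; last exact: ltW.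
  by rewrite as_/=; lra.
- exists (Num.min d2 (t - b)); first by rewrite lt_min d20 subr_gt0.
  move=> s /andP[as_ sc]; rewrite lt_min => /andP[sd]; rewrite ltr_distl => /andP[sb _].
  apply: H2 => //; last exact: ltW.
  by rewrite sc/= andbT; lra.
- exists (Num.min d1 d2); first by rewrite lt_min d10 d20.
  move=> s /andP[as_ sc]; rewrite lt_min => /andP[sd1 sd2].
  have [sb|sb] := leP s b; first by apply: H1 => //; rewrite ?as_ ?tb ?sb.
  apply: H2 => //; first by rewrite sc ltW.
  by rewrite tb.
Qed.

Lemma primitive_glue a b c S x G x' G' : a <= b -> b <= c -> x b = x' b ->
  primitive a b S x G -> primitive b c S x' G' ->
  primitive a c (b :: S) (fun t => if t <= b then x t else x' t)
    (fun t => if t < b then G t else G' t).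
Proof.
move=> ab bc xx' H1 H2; apply: primitive_cat => //.
  apply: primitive_ext H1 => t; first by move=> /andP[_ ->].
  by move=> /andP[_ ->].
apply: primitive_ext H2 => t.
  by move=> /andP[bt _]; case: ifP => // tb; rewrite (@le_anti _ _ t b) ?tb.
by move=> /andP[bt _] _; rewrite ltNge (ltW bt).
Qed.

End PrimitiveTheory.

Section Gronwall.
Context {R : realType} {W : normedModType R}.
Implicit Types (a b c d s t : R) (S : seq R) (x G : R -> W).

(** The norm of [w] discounted by [expR (- (L * (t - a)))], minus [phi], has nonpositive right Dini
    derivative, hence does not increase. Dini derivatives spare differentiating the norm. *)
Lemma gronwall a b S w G (phi psi : R -> R) L : a <= b -> 0 <= L ->
  primitive a b S w G -> primitive a b S phi psi ->
  (forall t, a < t < b -> t \notin S -> 0 <= psi t /\ `|G t| <= L * `|w t| + psi t) ->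
  `|w b| <= expR (L * (b - a)) * (`|w a| + (phi b - phi a)).
Proof.
move=> ab L0 [cw dw] [cphi dphi] HG.
pose v t := expR (- (L * (t - a))) * `|w t| - phi t.
have cv : {within `[a, b], continuous v}.
  move=> t; apply: cvgB; last exact: cphi.
  apply: cvgM; last by apply: cvg_norm; exact: cw.
  have : {within `[a, b], continuous (fun t => expR (- (L * (t - a))))}.
    apply: continuous_subspaceT => s.
    apply: (@continuous_comp _ _ _ (fun s => - (L * (s - a)))); last exact: continuous_expR.
    by apply: cvgN; apply: cvgMr; apply: cvgB; [exact: cvg_id|exact: cvg_cst].
  exact.
have : v b <= v a.
  apply: (dini (S := S)) => // t tab tS e e0.
  have [psi0 Gt] := HG t tab tS.
  have e2 : 0 < e / 2 by rewrite divr_gt0.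
  have [r1 r10 H1] := (is_derive_eps _ _ _).1 (dw t tab tS) _ e2.
  have [r2 r20 H2] := (is_derive_eps _ _ _).1 (dphi t tab tS) _ e2.
  exists (Num.min r1 r2) => [|s]; first by rewrite lt_min r10.
  rewrite -ltrBlDl lt_min => /andP[ts /andP[s1 s2]].
  have h0 : 0 < s - t by rewrite subr_gt0.
  have /H1 : `|s - t| < r1 by rewrite gtr0_norm.
  have /H2 : `|s - t| < r2 by rewrite gtr0_norm.
  rewrite !(gtr0_norm h0) => Hphi' Hw.
  have Hphi : - (e / 2 * (s - t)) <= phi s - phi t - (s - t) * psi t.
    by rewrite lerNl (le_trans (ler_norm _))// normrN.
  have ws : `|w s| <= `|w t| + (s - t) * (L * `|w t| + psi t) + e / 2 * (s - t).
    have -> : w s = w t + (s - t) *: G t + (w s - w t - (s - t) *: G t).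
      by rewrite [RHS]addrC -[w s - w t - _]addrA -opprD subrK.
    rewrite (le_trans (ler_normD _ _))// lerD// (le_trans (ler_normD _ _))// lerD//.
    by rewrite normrZ gtr0_norm// ler_wpM2l// ltW.
  rewrite /v; set Et := expR (- (L * (t - a))); set Es := expR (- (L * (s - a))).
  have Es0 : 0 <= Es by exact: expR_ge0.
  have Es1 : Es <= 1.
    rewrite -expR0 ler_expR oppr_le0 mulr_ge0// subr_ge0.
    by case/andP: tab => ta _; apply: ltW; apply: lt_trans ts.
  (* [1 + y <= expR y] lets the decrease of the discount over [[t, s]] absorb the growth factor
     [1 + L * (s - t)] of the norm. *)
  have EE : Es * (1 + L * (s - t)) <= Et.
    have -> : Et = Es * expR (L * (s - t)) by rewrite /Et /Es -expRD; congr expR; ring.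
    by rewrite ler_wpM2l// expR_ge1Dx.
  have A1 : Es * `|w s| <= Es * (`|w t| + (s - t) * (L * `|w t| + psi t) + e / 2 * (s - t)).
    by rewrite ler_wpM2l.
  have A2 : Es * (1 + L * (s - t)) * `|w t| <= Et * `|w t| by rewrite ler_wpM2r.
  have A3 : Es * ((s - t) * (psi t + e / 2)) <= (s - t) * (psi t + e / 2).
    by rewrite ler_piMl//; apply: mulr_ge0; [|apply: addr_ge0 => //]; exact: ltW.
  lra.
rewrite /v subrr mulr0 oppr0 expR0 mul1r => H.
have := ler_pM2l (expR_gt0 (L * (b - a))) (expR (- (L * (b - a))) * `|w b|) (`|w a| + (phi b - phi a)).
by rewrite mulrA -expRD subrr expR0 mul1r => ->; lra.
Qed.

(** Gronwall's estimate with [L = 0], applied to [w - w a]. *)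
Lemma mvt_norm a b S w G (phi psi : R -> R) : a <= b ->
  primitive a b S w G -> primitive a b S phi psi ->
  (forall t, a < t < b -> t \notin S -> `|G t| <= psi t) ->
  `|w b - w a| <= phi b - phi a.
Proof.
move=> ab dw dphi HG.
have dw' : primitive a b S (fun t => w t - w a) G.
  by apply: primitive_ext (primitiveB dw (primitive_cst a b S (w a))) => t _ //=; rewrite subr0.
have := gronwall ab (lexx 0) dw' dphi.
rewrite mul0r expR0 mul1r subrr normr0 add0r; apply => t tab tS.
rewrite mul0r add0r; have Gt := HG t tab tS; split=> //.
by rewrite (le_trans _ Gt).
Qed.

Lemma mvt_norm_cst a b S w G (M : R) : a <= b -> primitive a b S w G ->
  (forall t, a < t < b -> t \notin S -> `|G t| <= M) -> `|w b - w a| <= M * (b - a).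
Proof.
move=> ab dw HG.
have -> : M * (b - a) = M * b - M * a by rewrite mulrBr.
apply: (mvt_norm (psi := cst M) (phi := fun t => M * t) ab dw) => //.
have : primitive a b S (fun t => (t - 0) *: (M : R)) (cst M) by exact: primitive_line.
by apply: primitive_ext => t _ //=; rewrite subr0 mulrC.
Qed.

Lemma primitive_unique a b S x x' G : primitive a b S x G -> primitive a b S x' G ->
  x a = x' a -> forall t, a <= t <= b -> x t = x' t.
Proof.
move=> H H' xa t /andP[ta tb].
have D : primitive a t S (fun t => x t - x' t) (fun t => G t - G t).
  by apply: primitive_sub (primitiveB H H').
have := mvt_norm_cst (M := 0) ta D; rewrite mul0r xa subrr subr0.
move=> /(_ _)/[!normr_le0]/[!subr_eq0] E; apply/eqP; apply: E => s _ _.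
by rewrite subrr normr0.
Qed.

End Gronwall.

(** One-sided limits are asked for at every point, so that local arguments can be pasted by
    [real_induction], and inside [U], because the maps composed with [G] are continuous only within
    [U]. *)
Definition pcont {R : realType} {W : topologicalType} (a b : R) (S : seq R)
    (U : set W) (G : R -> W) :=
  [/\ forall t, a <= t <= b -> U (G t),
      forall t, a < t < b -> t \notin S -> {for t, continuous G},
      forall t, a <= t < b -> exists2 y, U y & G @ t^'+ --> y &
      forall t, a < t <= b -> exists2 y, U y & G @ t^'- --> y].

Lemma scalerRE {R : realType} (k v : R) : k *: v = k * v. Proof. by []. Qed.

Section Sequences.
Context {R : realType}.

Lemma le_cvg0 (A B : R) (e : nat -> R) :
  e @ \oo --> (0 : R) -> (forall n, A <= B + e n) -> A <= B.
Proof.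
move=> e0 H; apply/ler_addgt0Pr => k k0.
have /cvgrPdist_lt/(_ k k0)[n _ /(_ n)] := e0.
rewrite /= leqnn sub0r normrN => /(_ isT) en.
by apply: le_trans (H n) _; rewrite lerD2l (le_trans (ler_norm _))// ltW.
Qed.

Lemma uniform_limit (W : completeNormedModType R) (D : set R) (x : nat -> R -> W)
    (e : nat -> R) : e @ \oo --> (0 : R) ->
  (forall n m t, D t -> (n <= m)%N -> `|x n t - x m t| <= e n) ->
  exists y, forall n t, D t -> `|x n t - y t| <= e n.
Proof.
move=> e0 H.
have C t : D t -> cvg (x ^~ t @ \oo).
  move=> Dt; apply/cauchy_cvgP/cauchy_ballP => k k0.
  have k2 : 0 < k / 2 by rewrite divr_gt0.
  have /cvgrPdist_lt/(_ _ k2)[n _ /(_ n)] := e0.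
  rewrite /= leqnn sub0r normrN => /(_ isT) en.
  have Hn m : (n <= m)%N -> `|x n t - x m t| < k / 2.
    by move=> nm; rewrite (le_lt_trans (H _ _ _ Dt nm))// (le_lt_trans (ler_norm _)).
  exists ([set y | `|x n t - y| < k / 2], [set y | `|x n t - y| < k / 2]) => /=.
    by split; exists n => // m; exact: Hn.
  move=> [u v] /= [Hu Hv]; rewrite -ball_normE /ball_/= (splitr k).
  rewrite (le_lt_trans (ler_distD (x n t) _ _))// ltrD//.
  by rewrite distrC.
exists (fun t => lim (x ^~ t @ \oo)) => n t Dt.
have : (fun m => `|x n t - x m t|) @ \oo --> `|x n t - lim (x ^~ t @ \oo)|.
  by apply: cvg_norm; apply: cvgB; [exact: cvg_cst|exact: C].
move=> Hl; rewrite -(cvg_lim _ Hl)//; apply: limr_le; first by apply/cvg_ex; eexists; exact: Hl.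
by exists n => // m nm; exact: H.
Qed.

Lemma uniform_limit_continuous (W : normedModType R) a b (x : nat -> R -> W) y
    (e : nat -> R) : e @ \oo --> (0 : R) ->
  (forall n t, a <= t <= b -> `|x n t - y t| <= e n) ->
  (forall n, {within `[a, b], continuous (x n)}) ->
  {within `[a, b], continuous y}.
Proof.
move=> e0 H cx; apply/within_continuous_eps => t tab k k0.
have k3 : 0 < k / 3 by rewrite divr_gt0.
have /cvgrPdist_lt/(_ _ k3)[n _ /(_ n)] := e0.
rewrite /= leqnn sub0r normrN => /(_ isT) en.
have [d d0 Hd] := (within_continuous_eps _ _ _).1 (cx n) t tab _ k3.
exists d => // s sab sd.
have -> : y s - y t = (y s - x n s) + (x n s - x n t) + (x n t - y t).
  by rewrite !subrKA.
rewrite (le_lt_trans (ler_normD _ _))//.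
have := ler_normD (y s - x n s) (x n s - x n t); rewrite (distrC (y s)).
have := H n _ sab; have := H n _ tab; have := Hd _ sab sd; have := ler_norm (e n).
lra.
Qed.

Lemma cvg_geometric2 (M : R) : (fun n => M * 2^-1 ^+ n) @ \oo --> (0 : R).
Proof. by apply: (@cvg_geometric _ M 2^-1); rewrite ger0_norm; lra. Qed.

End Sequences.

Section Antiderivative.
Context {R : realType}.
Implicit Types (a b c d s t : R) (S : seq R).

Lemma cvg_right_eps (W : normedModType R) (G : R -> W) t y : G @ t^'+ --> y ->
  forall e, 0 < e -> exists2 r, 0 < r & forall s, t < s < t + r -> `|G s - y| <= e.
Proof.
move=> /cvgrPdist_le H e /H; rewrite near_withinE => /nbhs_ballP[r /= r0 {}H].
exists r => // s /andP[ts sr]; rewrite distrC; apply: H => //.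
by rewrite /ball/= ltr_distlC; apply/andP; split; lra.
Qed.

Lemma cvg_left_eps (W : normedModType R) (G : R -> W) t y : G @ t^'- --> y ->
  forall e, 0 < e -> exists2 r, 0 < r & forall s, t - r < s < t -> `|G s - y| <= e.
Proof.
move=> /cvgrPdist_le H e /H; rewrite near_withinE => /nbhs_ballP[r /= r0 {}H].
exists r => // s /andP[ts sr]; rewrite distrC; apply: H => //.
by rewrite /ball/= ltr_distlC; apply/andP; split; lra.
Qed.

(** On each side of a point [G] stays within [e] of its one-sided limit, so step functions
    approximate it; their piecewise affine primitives are extended by real induction. *)
Lemma pcont_primitive_approx (W : normedModType R) a b S (G : R -> W) e :
  a <= b -> 0 < e -> pcont a b S setT G -> exists S' x D,
  [/\ x a = 0, primitive a b S' x D &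
      forall t, a < t < b -> t \notin S' -> `|D t - G t| <= e].
Proof.
move=> ab e0 [_ _ Gr Gl].
have ext c d S' x D y : a <= c -> c <= d -> x a = 0 -> primitive a c S' x D ->
    (forall t, a < t < c -> t \notin S' -> `|D t - G t| <= e) ->
    (forall t, c < t < d -> `|G t - y| <= e) ->
    exists S' x D, [/\ x a = 0, primitive a d S' x D &
      forall t, a < t < d -> t \notin S' -> `|D t - G t| <= e].
  move=> ac cd xa0 px HD Hy.
  have py : primitive c d S' (fun t => x c + (t - c) *: y) (fun t => 0 + y).
    by apply: primitiveD; [exact: (primitive_cst c d S' (x c))|exact: primitive_line].
  have cE : x c = x c + (c - c) *: y by rewrite subrr scale0r addr0.
  have p := primitive_glue ac cd cE px py.
  eexists; eexists; eexists; split; [|exact: p|]; first by rewrite /= ac.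
  move=> t /andP[ta td]; rewrite inE negb_or => /andP[tc tS'] /=.
  case: ltP => [tc'|ct]; first by apply: HD; rewrite ?ta.
  by rewrite add0r distrC Hy// td andbT lt_neqAle eq_sym tc.
apply: (@real_induction _ a b (fun c => exists S' x D,
  [/\ x a = 0, primitive a c S' x D &
      forall t, a < t < c -> t \notin S' -> `|D t - G t| <= e])) => //.
- exists [::], (cst 0), (cst 0); split=> //; first exact: primitive_cst.
  by move=> t /andP[/lt_trans H /H]; rewrite ltxx.
- move=> c /andP[ac cb] [S' [x [D [xa px HD]]]].
  have [|y _ Gy] := Gr c; first by rewrite ac.
  have [r r0 Hr] := cvg_right_eps Gy e0.
  exists (Num.min b (c + r)).
    by rewrite lt_min cb ltrDl r0/= ge_min lexx.
  apply: ext px HD _ => //; first by rewrite le_min (ltW cb) lerDl ltW.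
  by move=> t; rewrite lt_min => /and3P[ct tb tr]; apply: Hr; rewrite ct.
- move=> c /andP[ac cb] H.
  have [|y _ Gy] := Gl c; first by rewrite ac.
  have [r r0 Hr] := cvg_left_eps Gy e0.
  have [|s /andP[rs sc] [as_ [S' [x [D [xa px HD]]]]]] := H (c - r); first by lra.
  apply: ext px HD _ => //; first exact: ltW.
  by move=> t /andP[st tc]; apply: Hr; rewrite tc andbT (lt_trans rs).
Qed.

(** The primitives of the step approximations converge uniformly. This is a Banach-valued integral
    built without measure theory. *)
Lemma pcont_primitive (W : completeNormedModType R) a b S (G : R -> W) :
  a <= b -> pcont a b S setT G -> exists x, x a = 0 /\ primitive a b S x G.
Proof.
move=> ab pG.
have ba0 : 0 <= b - a by rewrite subr_ge0.
pose ep n : R := 2^-1 ^+ n.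
have ep0 n : 0 < ep n by rewrite exprn_gt0// invr_gt0.
have /choice[x Hx] : forall n, exists x : R -> W, exists S' D,
  [/\ x a = 0, primitive a b S' x D &
      forall t, a < t < b -> t \notin S' -> `|D t - G t| <= ep n].
  move=> n; have [S' [x [D H]]] := pcont_primitive_approx ab (ep0 n) pG.
  by exists x, S', D.
have cx n : {within `[a, b], continuous (x n)} by have [? [? [_ []]]] := Hx n.
have cauchy n m t : a <= t <= b -> (n <= m)%N ->
    `|x n t - x m t| <= (ep n *+ 2 * (b - a)).
  move=> /andP[ta tb] nm; have [Sn [Dn [xna pn Hn]]] := Hx n.
  have [Sm [Dm [xma pm Hm]]] := Hx m.
  have p : primitive a t (Sn ++ Sm) (fun s => x n s - x m s) (fun s => Dn s - Dm s).
    apply: primitive_sub (lexx a) tb _; apply: primitiveB.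
      by apply: primitive_subS pn => s; rewrite mem_cat => ->.
    by apply: primitive_subS pm => s; rewrite mem_cat orbC => ->.
  have epm : ep m <= ep n by rewrite /ep ler_wiXn2l// ?invr_ge0// invf_le1// ler1n.
  have := mvt_norm_cst (M := ep n *+ 2) ta p; rewrite xna xma !subr0 => Hb.
  apply: le_trans (Hb _) _ => [s /andP[sa st]|].
    rewrite mem_cat negb_or => /andP[sn sm].
    have sab : a < s < b by rewrite sa (lt_le_trans st).
    rewrite -(subrKA (G s)) (le_trans (ler_normD _ _))// mulr2n lerD ?Hn//.
    by rewrite distrC (le_trans (Hm _ _ _)).
  by apply: ler_wpM2l; [rewrite mulrn_wge0// ltW|rewrite lerD2r].
have e0 : (fun n => ep n *+ 2 * (b - a)) @ \oo --> (0 : R).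
  have := @cvg_geometric2 R (2 * (b - a)); apply: cvg_trans; apply: near_eq_cvg.
  by near=> n; rewrite /ep -mulr_natl; ring.
have [y Hy] := uniform_limit e0 cauchy.
have cy := uniform_limit_continuous e0 Hy cx.
exists y; split.
  have aab : a <= a <= b by rewrite lexx.
  apply/eqP; rewrite -normr_le0; apply: (le_cvg0 e0) => n; rewrite add0r.
  by have := Hy n a aab; have [? [? [-> _ _]]] := Hx n; rewrite sub0r normrN.
split=> // t /andP[ta tb] tS; apply/is_derive_eps => e epos.
have [_ Gc _ _] := pG.
have : {for t, continuous G} by apply: Gc; rewrite ?ta.
move=> /cvgrPdist_le/(_ e epos)/nbhs_ballP[r /= r0 Hr].
pose rr := Num.min r (Num.min (t - a) (b - t)).
have rr0 : 0 < rr by rewrite !lt_min r0 !subr_gt0 ta.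
exists rr => // s; rewrite !lt_min => /and3P[sr].
rewrite !ltr_distl => /andP[s1 _] /andP[_ s2].
have sab : a <= s <= b by apply/andP; split; lra.
have tab : a <= t <= b by apply/andP; split; lra.
(* Subtracting [(s - t) *: G t] before the mean value inequality gives a bound that depends on [n]
   only through [ep n], so it survives the limit. *)
have key n : `|x n s - x n t - (s - t) *: G t| <= (e + ep n) * `|s - t|.
  have [Sn [Dn [xna pn Hn]]] := Hx n.
  have p c d : a <= c -> d <= b -> primitive c d Sn
      (fun s => x n s - (s - t) *: G t) (fun s => Dn s - G t).
    move=> ac db; apply: primitive_sub ac db _; apply: primitiveB pn _.
    exact: primitive_line.
  have HD z : a < z < b -> `|z - t| < r -> z \notin Sn -> `|Dn z - G t| <= e + ep n.
    move=> zab zt zS; rewrite [e + _]addrC -(subrKA (G z)) (le_trans (ler_normD _ _))// lerD ?Hn//.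
    by rewrite distrC; apply: Hr; rewrite /ball/= distrC.
  have /andP[as_ sb] := sab; have sr' := sr; rewrite ltr_distl in sr'; have /andP[sr1 sr2] := sr'.
  have [st|/ltW st] := leP s t.
  - have := mvt_norm_cst (M := e + ep n) st (p s t as_ (ltW tb)).
    rewrite subrr scale0r subr0 => H.
    have -> : `|s - t| = t - s by rewrite ler0_norm ?opprB// subr_le0.
    have -> : x n s - x n t - (s - t) *: G t = - (x n t - (x n s - (s - t) *: G t)) by zmod.
    rewrite normrN; apply: H => z /andP[sz zt].
    by apply: HD; rewrite ?ltr_distl; apply/andP; split; lra.
  - have := mvt_norm_cst (M := e + ep n) st (p t s (ltW ta) sb).
    rewrite subrr scale0r subr0 ger0_norm ?subr_ge0// => H.
    rewrite addrAC; apply: H => z /andP[sz zt].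
    by apply: HD; rewrite ?ltr_distl; apply/andP; split; lra.
have e1 : (fun n => ep n * `|s - t| + 2 * (ep n *+ 2 * (b - a))) @ \oo --> (0 : R).
  have := @cvg_geometric2 R (`|s - t| + 4 * (b - a)); apply: cvg_trans; apply: near_eq_cvg.
  by near=> n; rewrite /ep -mulr_natl; ring.
apply: (le_cvg0 e1) => n.
have -> : y s - y t - (s - t) *: G t = (x n s - x n t - (s - t) *: G t) +
   ((x n t - y t) - (x n s - y s)). by zmod.
rewrite (le_trans (ler_normD _ _))//.
have := key n; have := Hy n _ tab; have := Hy n _ sab.
have := ler_normB (x n t - y t) (x n s - y s).
lra.
Unshelve. all: by end_near.
Qed.

Lemma within_continuous_bounded (W : normedModType R) a b (x : R -> W) : a <= b ->
  {within `[a, b], continuous x} -> exists M, forall t, a <= t <= b -> `|x t| <= M.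
Proof.
move=> ab cx.
have cn : {within `[a, b], continuous (fun t => `|x t|)}.
  by move=> t; apply: cvg_norm; exact: cx.
have [c _ Hc] := EVT_max ab cn.
by exists `|x c| => t tab; apply: Hc; rewrite in_itv.
Qed.

(** Picard iteration on the whole interval at once: weighting the sup norm by
    [expR (2 * L * (t - a))] makes the iteration contract by 1/2 whatever the length [b - a]. *)
Lemma ode_exists (W : completeNormedModType R) a b S (F : R -> W -> W) (L : R) xi : a <= b ->
  0 <= L ->
  (forall t v w, a < t < b -> t \notin S -> `|F t v - F t w| <= L * `|v - w|) ->
  (forall x : R -> W, {within `[a, b], continuous x} ->
    pcont a b S setT (fun t => F t (x t))) ->
  exists x, x a = xi /\ primitive a b S x (fun t => F t (x t)).
Proof.
move=> ab L0 FL Fc.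
have ba0 : 0 <= b - a by rewrite subr_ge0.
have /choice[Phi HPhi] : forall x : R -> W, exists y, {within `[a, b], continuous x} ->
    y a = xi /\ primitive a b S y (fun t => F t (x t)).
  move=> x; have [cx|ncx] := pselect {within `[a, b], continuous x}; last by exists x.
  have [y [ya py]] := pcont_primitive ab (Fc x cx).
  exists (fun t => y t + xi) => _; rewrite ya add0r; split=> //.
  apply: primitive_ext (primitiveD py (primitive_cst a b S xi)) => // t _ _ /=.
  by rewrite addr0.
pose x n := iter n Phi (cst xi).
have cx n : {within `[a, b], continuous (x n)}.
  elim: n => [|n /HPhi[_ []]//].
  by apply: continuous_subspaceT => t; exact: cvg_cst.
have px n : x n.+1 a = xi /\ primitive a b S (x n.+1) (fun t => F t (x n t)).
  exact: HPhi.
have [C HC] : exists C, forall t, a <= t <= b -> `|x 1%N t - x 0%N t| <= C.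
  by apply: within_continuous_bounded => // t; apply: cvgB; exact: cx.
have C0 : 0 <= C by apply: le_trans (HC a _); rewrite ?lexx.
have step n t : a <= t <= b ->
    `|x n.+1 t - x n t| <= C * 2^-1 ^+ n * expR (2 * L * (t - a)).
  elim: n t => [|n IH] t tab.
    rewrite expr0 mulr1 (le_trans (HC t tab))// ler_peMr// -expR0 ler_expR.
    by case/andP: tab => ta _; rewrite !mulr_ge0// subr_ge0.
  have /andP[ta tb] := tab.
  pose c : R := C * 2^-1 ^+ n.+1.
  have c0 : 0 <= c by rewrite mulr_ge0// exprn_ge0// invr_ge0.
  have cE : c * 2 = C * 2^-1 ^+ n by rewrite /c exprSr mulrA divfK.
  (* The derivative [psi] of [phi] equals [L] times the bound at rank [n]: this is where the weight
     turns the factor [L] into 1/2. *)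
  pose phi s := c * expR (2 * L * (s - a)).
  pose psi s := c * (2 * L * expR (2 * L * (s - a))).
  have dphi s : is_derive s (1 : R) phi (psi s).
    have d1 : is_derive s (1 : R) (fun s => 2 * L * (s - a)) (2 * L).
      apply/is_derive_eps => e e0; exists 1 => // s' _.
      have -> : 2 * L * (s' - a) - 2 * L * (s - a) - (s' - s) *: (2 * L) = 0.
        by rewrite scalerRE; ring.
      by rewrite normr0 mulr_ge0// ltW.
    have d2 := @is_derive1_comp _ expR (fun s => 2 * L * (s - a)) s _ _ (is_derive_expR _) d1.
    have d3 := is_deriveZ c d2.
    by apply: (is_derive_eq d3); rewrite /psi scalerRE; ring.
  have pphi : primitive a t S phi psi.
    split=> //; apply: continuous_subspaceT => s.
    by apply: differentiable_continuous; apply/derivable1_diffP; case: (dphi s).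
  have p := primitiveB (px n.+1).2 (px n).2.
  have /mvt_norm/(_ pphi) := primitive_sub (lexx a) tb p.
  rewrite (px n.+1).1 (px n).1 subrr subr0 => /(_ ta) H.
  apply: le_trans (H _) _; last first.
    by rewrite /phi -/c gerBl mulr_ge0// expR_ge0.
  move=> s /andP[sa st] sS.
  have sab : a < s < b by rewrite sa (lt_le_trans st).
  apply: le_trans (FL _ _ _ sab sS) _.
  have /IH : a <= s <= b by case/andP: sab => *; rewrite !ltW.
  move=> /(ler_wpM2l L0)/le_trans; apply.
  by rewrite -cE /psi; have -> : L * (c * 2 * expR (2 * L * (s - a))) =
    c * (2 * L * expR (2 * L * (s - a))) by ring.
pose M := C * expR (2 * L * (b - a)).
have M0 : 0 <= M by rewrite mulr_ge0// expR_ge0.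
have step' n t : a <= t <= b -> `|x n.+1 t - x n t| <= M * 2^-1 ^+ n.
  move=> /[dup] tab /andP[ta tb]; apply: le_trans (step n t tab) _.
  have -> : M * 2^-1 ^+ n = C * 2^-1 ^+ n * expR (2 * L * (b - a)) by rewrite /M; ring.
  rewrite ler_wpM2l ?mulr_ge0 ?exprn_ge0 ?invr_ge0//.
  by rewrite ler_expR ler_wpM2l ?mulr_ge0// lerD2r.
have cauchy n m t : a <= t <= b -> (n <= m)%N -> `|x n t - x m t| <= 2 * M * 2^-1 ^+ n.
  move=> tab nm.
  have : `|x n t - x m t| <= 2 * M * 2^-1 ^+ n - 2 * M * 2^-1 ^+ m.
    elim: m nm => [|m IH]; first by rewrite leqn0 => /eqP ->; rewrite !subrr normr0.
    rewrite leq_eqVlt => /predU1P[<-|/IH {}IH]; first by rewrite !subrr normr0.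
    have := ler_distD (x m t) (x n t) (x m.+1 t); have := step' m t tab.
    rewrite (distrC (x m t) (x m.+1 t)) exprSr.
    have -> : 2 * M * (2^-1 ^+ m * 2^-1) = M * 2^-1 ^+ m by field.
    lra.
  move=> /le_trans; apply; rewrite gerBl !mulr_ge0// exprn_ge0// invr_ge0//.
have [y Hy] := uniform_limit (cvg_geometric2 (2 * M)) cauchy.
have cy := uniform_limit_continuous (cvg_geometric2 (2 * M)) Hy cx.
have [za pz] := HPhi y cy.
have zy t : a <= t <= b -> Phi y t = y t.
  move=> /[dup] tab /andP[ta tb]; apply/eqP; rewrite -subr_eq0 -normr_le0.
  apply: (le_cvg0 (cvg_geometric2 (L * (2 * M) * (b - a) + 2 * M))) => n; rewrite add0r.
  have := primitiveB pz (px n).2 => /(primitive_sub (lexx a) tb).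
  move=> /(mvt_norm_cst (M := L * (2 * M * 2^-1 ^+ n)) ta).
  rewrite za (px n).1 subrr subr0 => H.
  rewrite (le_trans (ler_distD (x n.+1 t) _ _))//.
  have := Hy n.+1 t tab.
  have : `|Phi y t - x n.+1 t| <= L * (2 * M * 2^-1 ^+ n) * (b - a).
    apply: (@le_trans _ _ (L * (2 * M * 2^-1 ^+ n) * (t - a))).
      apply: H => s /andP[sa st] sS.
      have sab : a < s < b by rewrite sa (lt_le_trans st).
      apply: le_trans (FL _ _ _ sab sS) _; apply: ler_wpM2l => //.
      by rewrite distrC Hy//; case/andP: sab => *; rewrite !ltW.
    apply: ler_wpM2l; last by rewrite lerD2r.
    by rewrite !mulr_ge0// exprn_ge0// invr_ge0.
  have : 2 * M * 2^-1 ^+ n.+1 <= 2 * M * 2^-1 ^+ n.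
    apply: ler_wpM2l; first by rewrite mulr_ge0.
    by rewrite exprS ler_piMl ?exprn_ge0 ?invr_ge0//; lra.
  lra.
exists y; split; first by rewrite -zy ?lexx.
exact: primitive_ext pz.
Qed.

End Antiderivative.

(** * Exceptional points and subdivisions *)

Section Near.
Context {R : realType}.
Implicit Types (a b c s t : R) (S : seq R).

Lemma near_right_notin S t : \forall s \near t^'+, s \notin S.
Proof.
elim: S => [|c S IH]; first by apply: nearW.
have H : \forall s \near t^'+, s != c.
  have [ct|tc] := leP c t.
    by near=> s; rewrite gt_eqF// (le_lt_trans ct)//; near: s; exact: nbhs_right_gt.
  by near=> s; rewrite lt_eqF//; near: s; exact: nbhs_right_lt.
by near=> s; rewrite inE negb_or; apply/andP; split; near: s.
Unshelve. all: by end_near. Qed.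

Lemma near_left_notin S t : \forall s \near t^'-, s \notin S.
Proof.
elim: S => [|c S IH]; first by apply: nearW.
have H : \forall s \near t^'-, s != c.
  have [tc|ct] := leP t c.
    by near=> s; rewrite lt_eqF// (lt_le_trans _ tc)//; near: s; exact: nbhs_left_lt.
  by near=> s; rewrite gt_eqF//; near: s; exact: nbhs_left_gt.
by near=> s; rewrite inE negb_or; apply/andP; split; near: s.
Unshelve. all: by end_near. Qed.

Lemma near_notin S t : t \notin S -> \forall s \near t, s \notin S.
Proof.
elim: S => [|c S IH]; first by move=> _; apply: (@nearW _ (nbhs t)).
rewrite inE negb_or => /andP[tc /IH H].
have H' : \forall s \near t, s != c.
  have [tc'|ct|/eqP] := ltgtP t c; last by rewrite (negPf tc).
    by near=> s; rewrite lt_eqF//; near: s; exact: lt_nbhsl.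
  by near=> s; rewrite gt_eqF//; near: s; exact: lt_nbhsr.
by near=> s; rewrite inE negb_or; apply/andP; split; near: s.
Unshelve. all: by end_near. Qed.

Lemma near_right_oo a b t : a <= t < b -> \forall s \near t^'+, a < s < b.
Proof.
move=> /andP[at_ tb]; near=> s; rewrite (le_lt_trans at_)/=; near: s.
  exact: nbhs_right_lt.
exact: nbhs_right_gt.
Unshelve. all: by end_near. Qed.

Lemma near_left_oo a b t : a < t <= b -> \forall s \near t^'-, a < s < b.
Proof.
move=> /andP[at_ tb]; near=> s; rewrite (lt_le_trans _ tb) ?andbT; near: s.
  exact: nbhs_left_gt.
exact: nbhs_left_lt.
Unshelve. all: by end_near. Qed.

Lemma near_oo a b t : a < t < b -> \forall s \near t, a < s < b.
Proof.
move=> tab; have : \forall s \near t, s \in `]a, b[ by apply: near_in_itvoo; rewrite in_itv.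
by apply: filterS => s; rewrite in_itv.
Qed.

(** Leads back from unordered exceptional lists to the ordered subdivisions of [PC1] and [NPC0]: 0,
    [T] and the points of [S] in between are sorted. *)
Lemma subdivision_of_seq T S : 0 < T -> exists k tau, subdivision T k tau /\
  forall i, (i <= k)%N -> 0 <= tau i /\ tau i.+1 <= T /\
    forall t, tau i < t < tau i.+1 -> t \notin S.
Proof.
move=> T0; pose s := sort <=%R (undup (0 :: T :: [seq c <- S | 0 < c < T])).
have ls : sorted <%R s by rewrite sort_lt_sorted undup_uniq.
have ms c : (c \in s) = [|| c == 0, c == T | (0 < c < T) && (c \in S)].
  by rewrite mem_sort mem_undup !inE mem_filter.
have us : uniq s by rewrite sort_uniq undup_uniq.
have bs c : c \in s -> 0 <= c <= T.
  rewrite ms => /or3P[/eqP->|/eqP->|/andP[/andP[c0 cT] _]]; rewrite ?lexx ?(ltW T0)//.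
  by rewrite !ltW.
have s2 : (1 < size s)%N.
  have : {subset [:: 0; T] <= s} by move=> c; rewrite ms !inE => /orP[]->//; rewrite orbT.
  by move=> /uniq_leq_size; apply; rewrite /= inE lt_eqF.
pose tau := nth T s.
have mono i j : (i < size s)%N -> (j < size s)%N -> (tau i < tau j) = (i < j)%N.
  by move=> *; rewrite /tau lt_sorted_ltn_nth.
have taus i : (i < size s)%N -> tau i \in s by move=> ?; rewrite mem_nth.
have tauP c : c \in s -> exists2 i, (i < size s)%N & tau i = c.
  by move=> cs; exists (index c s); rewrite ?index_mem// /tau nth_index.
have sizeE : size s = (size s).-2.+2 by rewrite !prednK//; case: (size s) s2 => [|[]].
exists (size s).-2, tau; split; first split.
- have [|i is_ ti] := tauP 0; first by rewrite ms eqxx.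
  have [i0|i0] := posnP i; first by rewrite -ti i0.
  have /andP[t0 _] := bs _ (taus 0%N (ltnW s2)).
  by have := mono 0%N i (ltnW s2) is_; rewrite i0 ti ltNge t0.
- have [|i is_ ti] := tauP T; first by rewrite ms eqxx orbT.
  have ks : ((size s).-2.+1 < size s)%N by rewrite [ltnRHS]sizeE.
  have [ki|ik|->//] := ltngtP (size s).-2.+1 i.
    by move: ki; rewrite ltnNge -ltnS -sizeE is_.
  have /andP[_ tT] := bs _ (taus _ ks).
  by have := mono i _ is_ ks; rewrite ik ti ltNge tT.
- move=> i ik; have i1 : (i.+1 < size s)%N by rewrite [ltnRHS]sizeE !ltnS.
  by rewrite mono// ltnW.
- move=> i ik.
  have i1 : (i.+1 < size s)%N by rewrite [ltnRHS]sizeE !ltnS.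
  have i0 : (i < size s)%N by exact: ltnW.
  have /andP[ti0 _] := bs _ (taus _ i0); have /andP[_ tiT] := bs _ (taus _ i1).
  split=> //; split=> // t /andP[it ti]; apply/negP => tS.
  have : t \in s by rewrite ms tS (le_lt_trans ti0)//= (lt_le_trans ti)// !orbT.
  move=> /tauP[j js jt]; move: it ti; rewrite -jt !mono// => ij.
  by rewrite ltnS leqNgt ij.
Qed.

End Near.

Section Pcont.
Context {R : realType}.
Implicit Types (a b c s t : R) (S : seq R).

Lemma pcont_sub (W : topologicalType) a b c d S (U : set W) G : a <= c -> d <= b ->
  pcont a b S U G -> pcont c d S U G.
Proof.
move=> ac db [HU Hc Hr Hl]; split=> t /andP[ct td].
- by apply: HU; rewrite (le_trans ac)// (le_trans td).
- by apply: Hc; rewrite (le_lt_trans ac)// (lt_le_trans td).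
- by apply: Hr; rewrite (le_trans ac)// (lt_le_trans td).
- by apply: Hl; rewrite (le_lt_trans ac)// (le_trans td).
Qed.

Lemma pcont_subS (W : topologicalType) a b S S' (U : set W) G : {subset S <= S'} ->
  pcont a b S U G -> pcont a b S' U G.
Proof.
move=> SS' [HU Hc Hr Hl]; split=> // t tab tS; apply: Hc => //.
by apply: contra tS; exact: SS'.
Qed.

Lemma within_continuous_cvg (W : topologicalType) a b (x : R -> W) (F : set_system R)
    {FF : Filter F} t : {within `[a, b], continuous x} -> a <= t <= b -> F --> t ->
  (\forall s \near F, a <= s <= b) -> x @ F --> x t.
Proof.
move=> /subspace_continuousP cx tab Ft Fab.
have tA : `[a, b]%classic t by rewrite /= in_itv.
apply: cvg_trans (cx t tA); apply: cvg_app => A /= HA.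
have {}HA := Ft _ HA; near=> s; apply: (near HA s) => //.
by rewrite /= in_itv/=; near: s.
Unshelve. all: by end_near. Qed.

Lemma within_continuous_cvg_right (W : topologicalType) a b (x : R -> W) t :
  {within `[a, b], continuous x} -> a <= t < b -> x @ t^'+ --> x t.
Proof.
move=> cx tab; apply: within_continuous_cvg cx _ _ _.
- by case/andP: tab => -> /= /ltW.
- exact: cvg_at_right_filter.
- by apply: filterS (near_right_oo tab) => s /andP[*]; rewrite !ltW.
Qed.

Lemma within_continuous_cvg_left (W : topologicalType) a b (x : R -> W) t :
  {within `[a, b], continuous x} -> a < t <= b -> x @ t^'- --> x t.
Proof.
move=> cx tab; apply: within_continuous_cvg cx _ _ _.
- by case/andP: tab => /ltW -> /=.
- exact: cvg_at_left_filter.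
- by apply: filterS (near_left_oo tab) => s /andP[*]; rewrite !ltW.
Qed.

Lemma pcont_continuous (W : topologicalType) a b S (U : set W) x :
  (forall t, a <= t <= b -> U (x t)) -> {within `[a, b], continuous x} ->
  pcont a b S U x.
Proof.
move=> HU cx; split=> // t tab.
- move=> _; apply: within_continuous_cvg cx _ _ _ => //.
    by case/andP: tab => *; rewrite !ltW.
  by apply: filterS (near_oo tab) => s /andP[*]; rewrite !ltW.
- exists (x t); last exact: within_continuous_cvg_right cx tab.
  by apply: HU; case/andP: tab => -> /= /ltW.
- exists (x t); last exact: within_continuous_cvg_left cx tab.
  by apply: HU; case/andP: tab => /ltW -> /=.
Qed.

Lemma pcont_pair (W W' : topologicalType) a b S (U : set W) (U' : set W') G G' :
  pcont a b S U G -> pcont a b S U' G' ->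
  pcont a b S (U `*` U') (fun t => (G t, G' t)).
Proof.
move=> [HU Hc Hr Hl] [HU' Hc' Hr' Hl']; split=> t.
- by move=> tab; split; [exact: HU|exact: HU'].
- by move=> tab tS; apply: cvg_pair; [exact: Hc|exact: Hc'].
- move=> tab; have [y Uy Gy] := Hr t tab; have [y' Uy' Gy'] := Hr' t tab.
  by exists (y, y') => //; exact: cvg_pair.
- move=> tab; have [y Uy Gy] := Hl t tab; have [y' Uy' Gy'] := Hl' t tab.
  by exists (y, y') => //; exact: cvg_pair.
Qed.

Lemma cvg_within_comp (W Z : topologicalType) (U : set W) (Phi : W -> Z) (F : set_system R)
  {FF : Filter F} (G : R -> W) y : {within U, continuous Phi} -> U y ->
  G @ F --> y -> (\forall s \near F, U (G s)) -> Phi (G s) @[s --> F] --> Phi y.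
Proof.
move=> /subspace_continuousP cPhi Uy Gy GU A HA.
have /Gy := cPhi y Uy A HA; rewrite /nbhs /= => H.
rewrite /nbhs /=; apply: filterS2 H GU => s; rewrite /=; exact.
Qed.

Lemma pcont_comp (W Z : topologicalType) a b S (U : set W) (V : set Z) (Phi : W -> Z) G :
  {within U, continuous Phi} -> (forall w, U w -> V (Phi w)) ->
  pcont a b S U G -> pcont a b S V (fun t => Phi (G t)).
Proof.
move=> cPhi PV [HU Hc Hr Hl]; split=> t.
- by move=> tab; apply/PV/HU.
- move=> tab tS; apply: (cvg_within_comp (y := G t) cPhi); [|exact: Hc|].
    by apply: HU; case/andP: tab => *; rewrite !ltW.
  by apply: filterS (near_oo tab) => s /andP[*]; apply: HU; rewrite !ltW.
- move=> tab; have [y Uy Gy] := Hr t tab; exists (Phi y); first exact: PV.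
  apply: (cvg_within_comp cPhi Uy Gy).
  by apply: filterS (near_right_oo tab) => s /andP[*]; apply: HU; rewrite !ltW.
- move=> tab; have [y Uy Gy] := Hl t tab; exists (Phi y); first exact: PV.
  apply: (cvg_within_comp cPhi Uy Gy).
  by apply: filterS (near_left_oo tab) => s /andP[*]; apply: HU; rewrite !ltW.
Qed.

Lemma pcont_switch (W : topologicalType) a b S (U : set W) G G' c :
  pcont a b S U G -> pcont a b S U G' ->
  pcont a b (c :: S) U (fun t => if t < c then G t else G' t).
Proof.
move=> [HU Hc Hr Hl] [HU' Hc' Hr' Hl']; split=> t.
- by move=> tab; case: ifP => _; [exact: HU|exact: HU'].
- move=> tab; rewrite inE negb_or => /andP[tc tS].
  suff : (fun s => if s < c then G s else G' s) @ t --> (if t < c then G t else G' t) by [].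
  have [ct|ct] := ltP t c.
    have Gt : G @ t --> G t by exact: Hc.
    apply: cvg_trans Gt; apply: near_eq_cvg.
    by near=> s; rewrite ifT//; near: s; exact: lt_nbhsl.
  have Gt : G' @ t --> G' t by exact: Hc'.
  apply: cvg_trans Gt; apply: near_eq_cvg.
  have {}ct : c < t by rewrite lt_neqAle eq_sym tc.
  by near=> s; rewrite ifF// ltNge ltW//; near: s; exact: lt_nbhsr.
- move=> tab; have [tc|ct] := ltP t c.
    have [y Uy Gy] := Hr t tab; exists y => //.
    apply: cvg_trans Gy; apply: near_eq_cvg.
    by near=> s; rewrite ifT//; near: s; exact: nbhs_right_lt.
  have [y Uy Gy] := Hr' t tab; exists y => //.
  apply: cvg_trans Gy; apply: near_eq_cvg.
  near=> s; rewrite ifF// ltNge (le_trans ct)// ltW//; near: s; exact: nbhs_right_gt.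
- move=> tab; have [tc|ct] := leP t c.
    have [y Uy Gy] := Hl t tab; exists y => //.
    apply: cvg_trans Gy; apply: near_eq_cvg.
    by near=> s; rewrite ifT// (lt_le_trans _ tc)//; near: s; exact: nbhs_left_lt.
  have [y Uy Gy] := Hl' t tab; exists y => //.
  apply: cvg_trans Gy; apply: near_eq_cvg.
  near=> s; rewrite ifF// ltNge ltW//; near: s; exact: nbhs_left_gt.
Unshelve. all: by end_near. Qed.

Lemma pcont_bounded (W : normedModType R) a b S (G : R -> W) : a <= b ->
  pcont a b S setT G -> exists2 M, 0 <= M & forall t, a <= t <= b -> `|G t| <= M.
Proof.
move=> ab [_ _ Hr Hl].
suff : exists M : R, forall t, a <= t <= b -> `|G t| <= M.
  move=> [M HM]; exists M => //; by apply: (le_trans (normr_ge0 (G a))); apply: HM; rewrite lexx ab.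
apply: (@real_induction _ a b (fun c => exists M : R, forall t, a <= t <= c -> `|G t| <= M)) => //.
- exists `|G a| => t /andP[ta tb]; by rewrite (@le_anti _ _ t a) ?ta ?tb.
- move=> c /andP[ac cb] [M HM].
  have [|y _ Gy] := Hr c; first by rewrite ac.
  have [r r0 H] := cvg_right_eps Gy ltr01.
  exists (Num.min b (c + r / 2)); first by rewrite lt_min cb ltrDl divr_gt0//= ge_min lexx.
  exists (Num.max M (`|y| + 1)) => t /andP[ta]; rewrite le_min => /andP[tb tc].
  rewrite le_max; have [tc'|ct] := leP t c; first by rewrite HM ?ta.
  apply/orP; right; have -> : G t = y + (G t - y) by zmod.
  rewrite (le_trans (ler_normD _ _))// lerD2l H// ct/=; lra.
- move=> c /andP[ac cb] H.
  have [|y _ Gy] := Hl c; first by rewrite ac.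
  have [r r0 Hr'] := cvg_left_eps Gy ltr01.
  have [|s /andP[rs sc] [as_ [M HM]]] := H (c - r); first lra.
  exists (Num.max M (Num.max `|G c| (`|y| + 1))) => t /andP[ta tc].
  rewrite !le_max; have [ts|st] := leP t s; first by rewrite HM ?ta.
  have [->|tc'] := eqVneq t c; first by rewrite lexx orbT.
  apply/orP; right; apply/orP; right; have -> : G t = y + (G t - y) by zmod.
  rewrite (le_trans (ler_normD _ _))// lerD2l Hr'// (lt_trans rs)//=.
  by rewrite lt_neqAle tc'.
Qed.

End Pcont.

(** * Lebesgue integrals as increments of primitives *)

Section Lebesgue.
Context {R : realType}.
Implicit Types (a b t : R) (S : seq R) (G y : R -> R).
Notation mu := (@lebesgue_measure R).

Lemma measurable_seq S : measurable [set` S].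
Proof.
apply: countable_measurable; first exact: measurable_set1.
exact/finite_set_countable/finite_seq.
Qed.

Lemma measurable_fun_seq S G : measurable_fun [set` S] G.
Proof.
elim: S => [|c S IH].
  have -> : [set` [::]] = set0 :> set R by apply/seteqP; split.
  exact: measurable_fun_set0.
rewrite (_ : [set` c :: S] = [set c] `|` [set` S]); last first.
  by apply/seteqP; split=> t /=; rewrite inE; [move/predU1P|move=> H; apply/predU1P].
apply/measurable_funU => //; last by split=> //; exact: measurable_fun_set1.
exact: measurable_seq.
Qed.

Lemma pcont_measurable a b S G : pcont a b S setT G -> measurable_fun `[a, b] G.
Proof.
move=> [_ Gc _ _].
pose D := `]a, b[%classic `&` ~` [set` S].
pose F := [set` [:: a, b & S]].
have mD : measurable D.
  by apply: measurableI => //; apply: measurableC; exact: measurable_seq.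
have oD : open D.
  apply: openI; first exact: interval_open.
  by apply: closed_openC; apply: compact_closed; [exact: Rhausdorff|apply: finite_compact; exact: finite_seq].
have mF : measurable F by exact: measurable_seq.
apply: (@measurable_funS _ _ _ _ (D `|` F)).
- exact: measurableU.
- move=> t /=; rewrite in_itv/= => /andP[at_ tb].
  have [tS|tS] := boolP (t \in [:: a, b & S]); first by right.
  left; move: tS; rewrite !inE !negb_or => /and3P[ta tb' tS]; split.
    by rewrite /= in_itv/= !lt_neqAle at_ tb tb' eq_sym ta.
  exact/negP.
apply/measurable_funU => //.
split; last exact: measurable_fun_seq.
apply: open_continuous_measurable_fun => // t; rewrite inE => -[]/=.
by rewrite in_itv/= => tab /negP tS; exact: Gc.
Qed.

Lemma pcont_integrable a b S G : a <= b -> pcont a b S setT G ->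
  mu.-integrable `[a, b] (EFin \o G).
Proof.
move=> ab pG; apply: measurable_bounded_integrable => //.
- by rewrite /= lebesgue_measure_itv; case: ifP => _; rewrite ?ltry// -EFinB ltry.
- exact: pcont_measurable pG.
- have [M M0 HM] := pcont_bounded ab pG.
  exists M; split; first exact: num_real.
  move=> x Mx t /=; rewrite in_itv/= => tab; exact: le_trans (HM t tab) (ltW Mx).
Qed.

Lemma pcont_integral_primitive a b S G : a < b -> pcont a b S setT G ->
  primitive a b S (fun t => parameterized_integral mu a t G) G.
Proof.
move=> ab pG; have iG := pcont_integrable (ltW ab) pG.
split; first exact: parameterized_integral_continuous (ltW ab) iG.
move=> t /andP[ta tb] tS; have [_ Gc _ _] := pG.
have cG : {for t, continuous G} by apply: Gc; rewrite ?ta.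
have [dF <-] := @continuous_FTC1_closed _ G a t b tb iG ta cG.
by rewrite derive1E; exact: DeriveDef.
Qed.

(** The indefinite Lebesgue integral and the given primitive have the same derivative off [S], so
    they differ by a constant. This turns the running costs of the objectives into increments of
    primitives. *)
Lemma primitive_Rintegral a b S y G : a < b -> pcont a b S setT G ->
  primitive a b S y G -> \int[mu]_(t in `[a, b]) G t = y b - y a.
Proof.
move=> ab pG py; have pI := pcont_integral_primitive ab pG.
have pI' := primitiveD pI (primitive_cst a b S (y a)).
have {}pI' : primitive a b S (fun t => parameterized_integral mu a t G + y a) G.
  by apply: primitive_ext pI' => // t _ _ /=; rewrite addr0.
rewrite -[LHS]/(parameterized_integral mu a b G).
apply/eqP; rewrite eq_sym subr_eq eq_sym; apply/eqP.
apply: (primitive_unique pI' py); last by rewrite lexx ltW.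
by rewrite /= /parameterized_integral set_itv1 Rintegral_set1 add0r.
Qed.

(** The first-order errors of the expansion tend to 0 only pointwise in time, so their integrals are
    controlled by dominated convergence. *)
Lemma dominated_primitive a b (S : nat -> seq R) (y G : nat -> R -> R) M : a < b ->
  (forall n, pcont a b (S n) setT (G n)) ->
  (forall n, primitive a b (S n) (y n) (G n)) ->
  (forall n, y n a = 0) ->
  (forall n t, a <= t <= b -> `|G n t| <= M) ->
  (forall t, a <= t <= b -> G ^~ t @ \oo --> (0 : R)) ->
  (fun n => y n b) @ \oo --> (0 : R).
Proof.
move=> ab pG py ya GM G0.
have [] := @dominated_convergence _ _ R mu `[a, b]%classic (measurable_itv _)
   (fun n t => (G n t)%:E) (fun=> 0%E) (fun=> M%:E).
- by move=> n; apply/measurable_EFinP; exact: pcont_measurable (pG n).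
- exact: measurable_cst.
- apply: aeW => t /=; rewrite in_itv/= => tab; apply: cvg_EFin; first exact: nearW.
  exact: G0.
- by apply: (pcont_integrable (S := [::]) (ltW ab));
    apply: pcont_continuous => //; apply: continuous_subspaceT => t; exact: cvg_cst.
- by apply: aeW => t n /=; rewrite in_itv/= => tab; rewrite lee_fin; exact: GM.
move=> _ _; rewrite integral0 => H.
have {}H : (fun n => (y n b)%:E) @ \oo --> 0%E.
  apply: cvg_trans H; apply: near_eq_cvg; apply: nearW => n /=.
  rewrite -[y n b]subr0 -(ya n) -(primitive_Rintegral ab (pG n) (py n)).
  rewrite /Rintegral fineK//; apply: integrable_fin_num => //.
  exact: (pcont_integrable (ltW ab) (pG n)).
exact: (fine_cvg H).
Qed.

End Lebesgue.

(** * Control and trajectory spaces *)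

Section ControlSpaces.
Context {R : realType}.
Implicit Types (T t : R) (S : seq R).

(* [NPC0] with its breakpoints collected in the list [S]. *)
Definition npc {W : topologicalType} T S (U : set W) (u : R -> W) :=
  [/\ pcont 0 T S U u, forall t : R, 0 <= t < T -> u @ t^'+ --> u t & u @ T^'- --> u T].

Lemma npc_NPC0 (W : topologicalType) T S (U : set W) (u : R -> W) : 0 < T ->
  npc T S U u -> NPC0 T U u.
Proof.
move=> T0 [pu ur uT]; split=> //.
have [HU Hc Hr Hl] := pu; split; first by move=> t; rewrite in_itv; exact: HU.
have [k [tau [st H]]] := subdivision_of_seq S T0.
exists k, tau; split=> // i ik; have [ti0 [tiT HS]] := H i ik.
have [_ _ mono] := st; have lt_tau := mono i ik; split.
- move=> t; rewrite in_itv/= => /[dup]/HS tS /andP[it ti]; apply: Hc => //.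
  by rewrite (le_lt_trans ti0)// (lt_le_trans ti).
- by apply: Hr; rewrite ti0 (lt_le_trans lt_tau).
- by apply: Hl; rewrite tiT (le_lt_trans ti0).
Qed.

Lemma subdivision_locate_left T k tau t : subdivision T k tau ->
  0 < t -> t <= T -> exists2 i, (i <= k)%N & tau i < t <= tau i.+1.
Proof.
move=> st t0; have [tau0 tauk mono] := st.
rewrite le_eqVlt => /predU1P[->|tT].
  by exists k; rewrite // tauk lexx andbT -tauk mono.
have [i ik /andP[it ti]] := subdivision_locate st (ltW t0) tT.
move: it; rewrite le_eqVlt => /predU1P[it|it].
  case: i it ik {ti} => [|i] it ik; first by move: t0; rewrite -it tau0 ltxx.
  by exists i; [exact: ltnW|rewrite -it lexx andbT mono// ltnW].
by exists i; rewrite // it ltW.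
Qed.

Lemma subdivision_oo T k tau t : subdivision T k tau -> 0 < t < T ->
  t \notin [seq tau i | i <- iota 0 k.+2] ->
  exists2 i, (i <= k)%N & tau i < t < tau i.+1.
Proof.
move=> st /andP[t0 tT] tS; have [i ik /andP[it ti]] := subdivision_locate st (ltW t0) tT.
exists i => //; rewrite ti andbT lt_neqAle it andbT; apply: contraNneq tS => <-.
by apply: map_f; rewrite mem_iota /= add0n ltnS ltnW.
Qed.

Lemma NPC0_npc (W : topologicalType) T (U : set W) (u : R -> W) :
  NPC0 T U u -> exists S, npc T S U u.
Proof.
move=> [[HU [k [tau [st H]]]] ur uT].
have ur' t : 0 <= t < T -> u @ t^'+ --> u t.
  by move=> tT; apply: ur; rewrite in_itv.
exists [seq tau i | i <- iota 0 k.+2]; split=> //; split.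
- by move=> t tT; apply: HU; rewrite in_itv.
- move=> t tT /(subdivision_oo st tT)[i ik it].
  by have [Hc _ _] := H i ik; apply: Hc; rewrite in_itv.
- move=> t tT; exists (u t); last exact: ur'.
  by apply: HU; rewrite in_itv/=; case/andP: tT => -> /ltW.
- move=> t /andP[t0 tT]; have [i ik] := subdivision_locate_left st t0 tT.
  have [Hc _ Hl] := H i ik; rewrite le_eqVlt => /andP[it /predU1P[->//|ti]].
  exists (u t); first by apply: HU; rewrite in_itv/= tT ltW.
  by apply: cvg_at_left_filter; apply: Hc; rewrite in_itv/= it.
Qed.

Lemma npc_comp (W Z : topologicalType) T S (U : set W) (V : set Z) (Phi : W -> Z) u :
  0 < T -> {within U, continuous Phi} -> (forall w, U w -> V (Phi w)) ->
  npc T S U u -> npc T S V (fun t => Phi (u t)).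
Proof.
move=> T0 cPhi PV [pu ur uT]; have [HU _ _ _] := pu; split; first exact: pcont_comp pu.
- move=> t tT; apply: (cvg_within_comp cPhi); [|exact: ur|].
    by apply: HU; case/andP: tT => -> /ltW.
  by apply: filterS (near_right_oo tT) => s /andP[*]; apply: HU; rewrite !ltW.
- apply: (cvg_within_comp cPhi) => //; first by apply: HU; rewrite lexx ltW.
  have TT : 0 < T <= T by rewrite T0 lexx.
  by apply: filterS (near_left_oo TT) => s /andP[*]; apply: HU; rewrite !ltW.
Qed.

Lemma npc_pair (W W' : topologicalType) T S (U : set W) (U' : set W') u u' :
  npc T S U u -> npc T S U' u' -> npc T S (U `*` U') (fun t => (u t, u' t)).
Proof.
move=> [pu ur uT] [pu' ur' uT']; split; first exact: pcont_pair.
  by move=> t tT; apply: cvg_pair; [exact: ur|exact: ur'].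
exact: cvg_pair.
Qed.

Lemma npc_subS (W : topologicalType) T S S' (U : set W) u : {subset S <= S'} ->
  npc T S U u -> npc T S' U u.
Proof. by move=> SS' [pu ur uT]; split=> //; exact: pcont_subS pu. Qed.

Lemma npc_continuous (W : topologicalType) T S (U : set W) x : 0 < T ->
  (forall t, 0 <= t <= T -> U (x t)) -> {within `[0, T], continuous x} ->
  npc T S U x.
Proof.
move=> T0 HU cx; split; first exact: pcont_continuous.
- by move=> t tT; apply: within_continuous_cvg_right cx tT.
- by apply: within_continuous_cvg_left cx _; rewrite T0 lexx.
Qed.

Lemma npc_switch (W : topologicalType) T S (U : set W) u u' c : 0 < c < T ->
  npc T S U u -> npc T S U u' ->
  npc T (c :: S) U (fun t => if t < c then u t else u' t).
Proof.
move=> /andP[c0 cT] [pu ur uT] [pu' ur' uT']; split; first exact: pcont_switch.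
- move=> t tT; have [tc|ct] := ltP t c.
    apply: cvg_trans (ur t tT); apply: near_eq_cvg.
    by near=> s; rewrite ifT//; near: s; exact: nbhs_right_lt.
  apply: cvg_trans (ur' t tT); apply: near_eq_cvg.
  near=> s; rewrite ifF// ltNge (le_trans ct)// ltW//; near: s; exact: nbhs_right_gt.
- rewrite ltNge (ltW cT)/=; apply: cvg_trans uT'; apply: near_eq_cvg.
  near=> s; rewrite ifF// ltNge ltW//; near: s; exact: nbhs_left_gt.
Unshelve. all: by end_near. Qed.

Section Trajectories.
Variable W : normedModType R.
Implicit Types (x F : R -> W).

Lemma PC1_primitive T (G : set W) x : PC1 T G x ->
  exists S, primitive 0 T S x (ext_deriv T x).
Proof.
move=> [Gx cx [k [tau stx]]]; have [st H] := stx.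
exists [seq tau i | i <- iota 0 k.+2]; split=> // t tT tS.
have [i ik it] := subdivision_oo st tT tS.
have [dx cdx _ _] := H i ik.
have it' : t \in `]tau i, tau i.+1[ by rewrite in_itv.
have tT' : t \in `[0, T] by rewrite in_itv/=; case/andP: tT => *; rewrite !ltW.
rewrite (ext_derivE stx tT') (ext_deriv_onE stx tT') lt_eqF; last by case/andP: tT.
have -> : lim (derive1 x @ t^'+) = 'D_1 x t.
  rewrite -derive1E; apply: cvg_lim => //; exact/cvg_at_right_filter/cdx.
exact/derivableP/dx.
Qed.

(** Since [F] is right continuous before [T] and left continuous at [T], the one-sided limits that
    define the extended derivative are values of [F]; hence the differential equation holds at every
    time, exceptional ones included. *)
Lemma primitive_PC1 T S (G : set W) x F : 0 < T ->
  (forall t, 0 <= t <= T -> G (x t)) -> primitive 0 T S x F -> npc T S setT F ->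
  PC1 T G x /\ forall t, 0 <= t <= T -> ext_deriv T x t = F t.
Proof.
move=> T0 Gx [cx dx] [pF Fr FT].
have dxE t : 0 < t < T -> t \notin S -> derive1 x t = F t.
  by move=> tT tS; have [_ <-] := dx t tT tS; rewrite derive1E.
have [_ Fc Fr' Fl'] := pF.
have dxR t : 0 <= t < T -> \forall s \near t^'+, derive1 x s = F s.
  move=> tT; apply: filterS2 (near_right_oo tT) (near_right_notin S t) => s.
  exact: dxE.
have dxL t : 0 < t <= T -> \forall s \near t^'-, derive1 x s = F s.
  move=> tT; apply: filterS2 (near_left_oo tT) (near_left_notin S t) => s.
  exact: dxE.
have [k [tau [st H]]] := subdivision_of_seq S T0.
have stx : PC1_subdivision T x k tau.
  split=> // i ik; have [ti0 [tiT HS]] := H i ik.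
  have [_ _ mono] := st; have lt_tau := mono i ik; split.
  - move=> t; rewrite in_itv/= => /[dup]/HS tS /andP[it ti].
    have tT : 0 < t < T by rewrite (le_lt_trans ti0)// (lt_le_trans ti).
    by have [] := dx t tT tS.
  - move=> t; rewrite in_itv/= => /[dup]/HS tS /andP[it ti].
    have tT : 0 < t < T by rewrite (le_lt_trans ti0)// (lt_le_trans ti).
    have Ft : F @ t --> F t by exact: Fc.
    suff : derive1 x @ t --> derive1 x t by [].
    rewrite dxE//; apply: cvg_trans Ft; apply: near_eq_cvg.
    by apply: filterS2 (near_oo tT) (near_notin tS) => s sT sS; rewrite dxE.
  - have tT : 0 <= tau i < T by rewrite ti0 (lt_le_trans lt_tau).
    have [y _ Fy] := Fr' _ tT; apply/cvg_ex; exists y; apply: cvg_trans Fy.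
    by apply: near_eq_cvg; apply: filterS (dxR _ tT) => s ->.
  - have tT : 0 < tau i.+1 <= T by rewrite tiT (le_lt_trans ti0).
    have [y _ Fy] := Fl' _ tT; apply/cvg_ex; exists y; apply: cvg_trans Fy.
    by apply: near_eq_cvg; apply: filterS (dxL _ tT) => s ->.
split; first by split=> //; exists k, tau.
move=> t tT; have tT' : t \in `[0, T] by rewrite in_itv.
rewrite (ext_derivE stx tT') (ext_deriv_onE stx tT'); case: eqVneq => [->|tNT].
  apply: cvg_lim => //; apply: cvg_trans FT; apply: near_eq_cvg.
  by apply: filterS (dxL _ _); rewrite ?T0 ?lexx// => s ->.
have tT2 : 0 <= t < T by case/andP: tT => -> ?; rewrite lt_neqAle tNT.
apply: cvg_lim => //; apply: cvg_trans (Fr t tT2); apply: near_eq_cvg.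
by apply: filterS (dxR _ tT2) => s ->.
Qed.

End Trajectories.
End ControlSpaces.

(** * Bounded linear maps *)

Section BoundedLinearTheory.
Context {R : realType} {X Y : normedModType R}.
Implicit Types A B : bounded_linear X Y.

Lemma bl_le A x : `|A x| <= `|A| * `|x|. Proof. exact: le_opnorm. Qed.

Lemma bl_norm_le A (c : R) : 0 <= c -> (forall x, `|A x| <= c * `|x|) -> `|A| <= c.
Proof. exact: opnorm_le. Qed.

Lemma bl_ext A B : A =1 B -> A = B.
Proof. by move=> AB; apply/val_inj/funext. Qed.

Lemma blDE A B x : (A + B) x = A x + B x. Proof. by []. Qed.
Lemma blNE A x : (- A) x = - A x. Proof. by []. Qed.
Lemma blBE A B x : (A - B) x = A x - B x. Proof. by []. Qed.
Lemma blZE (k : R) A x : (k *: A) x = k *: A x. Proof. by []. Qed.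
Lemma bl0E x : (0 : bounded_linear X Y) x = 0. Proof. by []. Qed.

Lemma bl_B A x y : A (x - y) = A x - A y. Proof. exact: linearB. Qed.
Lemma bl_D A x y : A (x + y) = A x + A y. Proof. exact: linearD. Qed.
Lemma bl_Z A (k : R) x : A (k *: x) = k *: A x. Proof. exact: linearZ. Qed.
Lemma bl_0 A : A 0 = 0. Proof. exact: linear0. Qed.

Lemma bl_sumE (I : Type) (r : seq I) (P : pred I) (F : I -> bounded_linear X Y) x :
  (\sum_(i <- r | P i) F i) x = \sum_(i <- r | P i) F i x.
Proof. by elim/big_rec2: _ => // i y1 y2 _ <-. Qed.

Lemma bl_eval_continuous : continuous (fun w : bounded_linear X Y * X => w.1 w.2).
Proof.
move=> [A0 x0]; apply/cvgrPdist_le => e e0 /=.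
pose k := `|A0| + `|x0| + 1.
have k0 : 0 < k by rewrite ltr_wpDl// addr_ge0.
pose d := Num.min 1 (e / k).
have d0 : 0 < d by rewrite lt_min ltr01 divr_gt0.
have d1 : d <= 1 by rewrite ge_min lexx.
have dk : d * k <= e by rewrite -ler_pdivlMr// ge_min lexx orbT.
have F1 : \forall w \near (A0, x0), `|A0 - w.1| <= d.
  have /cvgrPdist_le : fst w @[w --> (A0, x0)] --> A0 by exact: cvg_fst.
  by move=> /(_ _ d0).
have F2 : \forall w \near (A0, x0), `|x0 - w.2| <= d.
  have /cvgrPdist_le : snd w @[w --> (A0, x0)] --> x0 by exact: cvg_snd.
  by move=> /(_ _ d0).
apply: filterS2 F1 F2 => w wA wx.
have -> : A0 x0 - w.1 w.2 = (A0 - w.1) x0 + (A0 (x0 - w.2) - (A0 - w.1) (x0 - w.2)).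
  by rewrite !blBE !bl_B; zmod.
apply: le_trans dk; rewrite (le_trans (ler_normD _ _))//.
have H1 : `|(A0 - w.1) x0| <= d * `|x0|.
  by rewrite (le_trans (bl_le _ _))// ler_wpM2r.
have H2 : `|A0 (x0 - w.2)| <= `|A0| * d.
  by rewrite (le_trans (bl_le _ _))// ler_wpM2l.
have H3 : `|(A0 - w.1) (x0 - w.2)| <= d * 1.
  rewrite (le_trans (bl_le _ _))// ler_pM//; exact: le_trans wx d1.
have H4 := ler_normB (A0 (x0 - w.2)) ((A0 - w.1) (x0 - w.2)).
rewrite /k; lra.
Qed.

(** The product rule for a moving operator applied to a moving vector; it yields the duality between
    costate and linearized state. *)
Lemma is_derive_eval (p : R -> bounded_linear X Y) (z : R -> X) t p' z' :
  is_derive t (1 : R) p p' -> is_derive t (1 : R) z z' ->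
  is_derive t (1 : R) (fun s => p s (z s)) (p' (z t) + p t z').
Proof.
move=> dp dz; apply/is_derive_eps => e e0.
pose k := `|p t| + `|z t| + `|p'| + 1 + 1.
have k0 : 0 < k by rewrite ltr_wpDl// !addr_ge0.
have ek0 : 0 < e / k by rewrite divr_gt0.
have [r1 r10 H1] := (is_derive_eps _ _ _).1 dp _ ek0.
have [r2 r20 H2] := (is_derive_eps _ _ _).1 dz _ ek0.
have cz : {for t, continuous z}.
  by apply: differentiable_continuous; apply/derivable1_diffP; case: dz.
have m0 : 0 < Num.min 1 (e / k) by rewrite lt_min ltr01.
have /cvgrPdist_le/(_ _ m0)/nbhs_ballP[r3 /= r30 H3] := cz.
exists (Num.min r1 (Num.min r2 r3)) => [|s]; first by rewrite !lt_min r10 r20.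
rewrite !lt_min => /and3P[s1 s2 s3].
have {}H1 := H1 _ s1; have {}H2 := H2 _ s2.
have : `|z t - z s| <= Num.min 1 (e / k) by apply: H3; rewrite /ball/= distrC.
rewrite distrC le_min => /andP[z1 ze].
move: H1 H2; set a := `|s - t|; have a0 : 0 <= a by exact: normr_ge0.
set r := p s - p t - _; set q := z s - z t - _ => H1 H2.
have -> : p s (z s) - p t (z t) - (s - t) *: (p' (z t) + p t z') =
   r (z s) + p t q + (s - t) *: p' (z s - z t).
  by rewrite /r /q !blBE !bl_B !blZE bl_Z scalerDr scalerBr; zmod.
have zs : `|z s| <= `|z t| + 1.
  have -> : z s = z t + (z s - z t) by zmod.
  by rewrite (le_trans (ler_normD _ _))// lerD2l.
have B1 : `|r (z s)| <= e / k * a * (`|z t| + 1).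
  by rewrite (le_trans (bl_le _ _))// ler_pM.
have B2 : `|p t q| <= `|p t| * (e / k * a).
  by rewrite (le_trans (bl_le _ _))// ler_wpM2l.
have B3 : `|(s - t) *: p' (z s - z t)| <= a * (`|p'| * (e / k)).
  rewrite normrZ ler_wpM2l// (le_trans (bl_le _ _))// ler_wpM2l//.
rewrite (le_trans (ler_normD _ _))// (le_trans (lerD (ler_normD _ _) (lexx _)))//.
have -> : e * a = e / k * a * k by rewrite mulrAC divfK ?gt_eqF.
have : 0 <= e / k * a by rewrite mulr_ge0// ltW.
rewrite /k; lra.
Qed.

End BoundedLinearTheory.

Lemma bl_compE (R : realType) (X Y Z : normedModType R) (B : bounded_linear Y Z)
  (A : bounded_linear X Y) x : bl_comp B A x = B (A x).
Proof. by []. Qed.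

Lemma bl_comp_norm (R : realType) (X Y Z : normedModType R) (B : bounded_linear Y Z)
  (A : bounded_linear X Y) : `|bl_comp B A| <= `|B| * `|A|.
Proof.
apply: bl_norm_le => [|x]; first by rewrite mulr_ge0.
by rewrite (le_trans (bl_le B (A x)))// -mulrA ler_wpM2l// bl_le.
Qed.

Lemma bl_comp_continuous (R : realType) (X Y Z : normedModType R) :
  continuous (fun w : bounded_linear Y Z * bounded_linear X Y => bl_comp w.1 w.2).
Proof.
move=> [B0 A0]; apply/cvgrPdist_le => e e0 /=.
pose k := `|B0| + `|A0| + 1.
have k0 : 0 < k by rewrite ltr_wpDl// addr_ge0.
pose d := Num.min 1 (e / k).
have d0 : 0 < d by rewrite lt_min ltr01 divr_gt0.
have d1 : d <= 1 by rewrite ge_min lexx.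
have dk : d * k <= e by rewrite -ler_pdivlMr// ge_min lexx orbT.
have F1 : \forall w \near (B0, A0), `|B0 - w.1| <= d.
  have /cvgrPdist_le : fst w @[w --> (B0, A0)] --> B0 by exact: cvg_fst.
  by move=> /(_ _ d0).
have F2 : \forall w \near (B0, A0), `|A0 - w.2| <= d.
  have /cvgrPdist_le : snd w @[w --> (B0, A0)] --> A0 by exact: cvg_snd.
  by move=> /(_ _ d0).
apply: filterS2 F1 F2 => w wB wA.
have -> : bl_comp B0 A0 - bl_comp w.1 w.2 =
    bl_comp (B0 - w.1) A0 + (bl_comp B0 (A0 - w.2) - bl_comp (B0 - w.1) (A0 - w.2)).
  by apply: bl_ext => x; rewrite !(blBE, blDE, bl_compE) !bl_B; zmod.
apply: le_trans dk; rewrite (le_trans (ler_normD _ _))//.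
have H1 : `|bl_comp (B0 - w.1) A0| <= d * `|A0|.
  by rewrite (le_trans (bl_comp_norm _ _))// ler_wpM2r.
have H2 : `|bl_comp B0 (A0 - w.2)| <= `|B0| * d.
  by rewrite (le_trans (bl_comp_norm _ _))// ler_wpM2l.
have H3 : `|bl_comp (B0 - w.1) (A0 - w.2)| <= d * 1.
  rewrite (le_trans (bl_comp_norm _ _))// ler_pM//; exact: le_trans wA d1.
have H4 := ler_normB (bl_comp B0 (A0 - w.2)) (bl_comp (B0 - w.1) (A0 - w.2)).
rewrite /k; lra.
Qed.

Section BoundedLinearComplete.
Context {R : realType} {X : normedModType R} {Y : completeNormedModType R}.

(** The costate equation lives in the dual of [E], and its solution by Picard iteration needs
    completeness. A Cauchy filter converges pointwise, and its Cauchy bounds pass to the pointwise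
    limit. *)
Lemma bounded_linear_complete (F : set_system (bounded_linear X Y)) :
  ProperFilter F -> cauchy F -> cvg F.
Proof.
move=> FF /cauchy_ballP cF.
have H (e : R) : 0 < e -> exists2 P, F P & forall A B, P A -> P B -> `|A - B| <= e.
  move=> /cF[[P Q] /= [FP FQ] PQ]; exists (P `&` Q); first exact: filterI.
  move=> A B [PA _] [_ QB]; have := PQ (A, B); rewrite -ball_normE /ball_/=.
  by move=> /(_ (conj PA QB))/ltW.
have cx x : cvg ((fun A : bounded_linear X Y => A x) @ F).
  apply/cauchy_cvgP/cauchy_ballP => e e0.
  have x0 : 0 < `|x| + 1 by rewrite ltr_wpDl.
  have [P FP HP] := H (e / 2 / (`|x| + 1)) (divr_gt0 (divr_gt0 e0 (ltr0Sn _ 1)) x0).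
  exists ([set A x | A in P], [set A x | A in P]) => /=.
    have FS : F ((fun A : bounded_linear X Y => A x) @^-1` [set A x | A in P]).
      by apply: filterS FP => A PA; exists A.
    by split; exact: FS.
  move=> [_ _] /= [[A PA <-] [B PB <-]]; rewrite -ball_normE /ball_/=.
  rewrite -blBE (le_lt_trans (bl_le _ _))//.
  apply: (@le_lt_trans _ _ (e / 2 / (`|x| + 1) * (`|x| + 1))).
    by rewrite ler_pM ?HP// lerDl.
  by rewrite divfK ?gt_eqF//; lra.
pose L x := lim ((fun A : bounded_linear X Y => A x) @ F).
have HL x : (fun A : bounded_linear X Y => A x) @ F --> L x by exact: cx.
have LB (e : R) (P : set (bounded_linear X Y)) x (A : bounded_linear X Y) : F P ->
    (forall A B, P A -> P B -> `|A - B| <= e) -> P A ->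
    `|A x - L x| <= e * `|x|.
  move=> FP HP PA.
  have Hn : (fun B : bounded_linear X Y => `|A x - B x|) @ F --> `|A x - L x|.
    by apply: cvg_norm; apply: cvgB; [exact: cvg_cst|exact: HL].
  rewrite -(cvg_lim _ Hn)//; apply: limr_le; first by apply/cvg_ex; eexists; exact: Hn.
  apply: filterS FP => B PB; change (`|A x - B x| <= e * `|x|).
  have -> : A x - B x = (A - B) x by [].
  apply: (le_trans (bl_le (A - B) x)); rewrite ler_wpM2r//; exact: HP.
have Llin : is_bounded_linear L.
  split.
    move=> a x y; apply: cvg_lim => //.
    have : (fun A : bounded_linear X Y => a *: A x + A y) @ F --> a *: L x + L y.
      by apply: cvgD; [apply: cvgZr; exact: HL|exact: HL].
    apply: cvg_trans; apply: near_eq_cvg; apply: nearW => A.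
    by rewrite /= bl_D bl_Z.
  have [P FP HP] := H 1 ltr01; have [A0 PA0] := filter_ex FP.
  exists (`|A0| + 1) => x; have := LB _ _ x _ FP HP PA0.
  have := bl_le A0 x; have := ler_normB (A0 x) (A0 x - L x).
  have -> : A0 x - (A0 x - L x) = L x by zmod.
  rewrite mulrDl mul1r; lra.
have Lmem : L \in @bounded_linear_pred R X Y by rewrite inE.
apply/cvg_ex; exists (BoundedLinear Lmem).
apply/cvgrPdist_le => e e0; have [P FP HP] := H e e0.
apply: filterS (FP) => A PA; rewrite distrC; apply: bl_norm_le; first exact: ltW.
by move=> x; exact: (LB _ _ _ _ FP HP PA).
Qed.

HB.instance Definition _ := Uniform_isComplete.Build (bounded_linear X Y)
  bounded_linear_complete.

End BoundedLinearComplete.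

(** * The Poincare-Miranda theorem *)

Section GridCochains.
Variables (n p : nat) (lam : 'I_n -> ('I_n -> nat) -> bool).
Implicit Types (i j k : 'I_n) (ks : seq 'I_n) (z w : 'I_n -> nat) (I J : {set 'I_n}).
Implicit Types (F G : ('I_n -> nat) -> 'F_2).

Definition step i z : 'I_n -> nat := fun j => (z j + (j == i))%N.
Definition upd z i t : 'I_n -> nat := fun j => if j == i then t else z j.

Let lamF k z : 'F_2 := (lam k z)%:R.

Let addxx (x : 'F_2) : x + x = 0. Proof. by apply: addrr_pchar2; exact: pchar_Fp. Qed.

(** For [#|I| = size ks], the cubical cup product modulo 2 of the coboundaries of the labels in
    [ks], on the cube spanned at [z] by the directions [I]: a sum over the orders in which a
    monotone path can take the steps of [I], of the product of the label changes along it. *)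
Fixpoint cup ks I z : 'F_2 :=
  if ks is k :: ks' then
    \sum_(i in I) (lamF k (step i z) + lamF k z) * cup ks' (I :\ i) (step i z)
  else 1.

Lemma stepC i j z : step i (step j z) = step j (step i z).
Proof. by apply/funext => k; rewrite /step -!addnA (addnC (k == j)). Qed.

(** The ordered pairs [(i, j)] and [(j, i)] contribute equally and cancel in characteristic 2. *)
Lemma sum_sym0 I (H : 'I_n -> 'I_n -> 'F_2) : (forall i j, H i j = H j i) ->
  \sum_(i in I) \sum_(j in I :\ i) H i j = 0.
Proof.
move=> Hsym.
have -> : \sum_(i in I) \sum_(j in I :\ i) H i j =
    \sum_(i in I) \sum_(j in I | (j < i)%N) H i j +
    \sum_(i in I) \sum_(j in I | (i < j)%N) H i j.
  rewrite -big_split; apply: eq_bigr => i _.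
  rewrite (bigID (fun j : 'I_n => (j < i)%N)) /=; congr (_ + _); apply: eq_bigl => j.
    by rewrite !inE -val_eqE /=; case: ltngtP; rewrite ?andbF ?andbT.
  by rewrite !inE -val_eqE /=; case: ltngtP; rewrite ?andbF ?andbT.
rewrite [X in _ + X](exchange_big_dep (mem I))/=; last by move=> i j _ /andP[].
rewrite [X in _ + X](_ : _ = \sum_(i in I) \sum_(j in I | (j < i)%N) H i j) ?addxx//.
by apply: eq_bigr => i iI; apply: eq_big => [j|j _]; [rewrite iI|exact: Hsym].
Qed.

(** The contribution to a coboundary of the two opposite faces normal to [i]; modulo 2 it carries no
    sign. *)
Definition bdry F i z : 'F_2 := F (step i z) + F z.

(* The cup product of the closed 1-cochains [d lam_k] is closed, so it is the
   coboundary of [lam_k] times the cup product of the remaining ones. *)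
Lemma cup_closed_stokes ks :
  (forall I z, #|I| = (size ks).+1 -> \sum_(i in I) bdry (cup ks (I :\ i)) i z = 0) /\
  (forall k I z, #|I| = (size ks).+1 ->
    cup (k :: ks) I z = \sum_(i in I) bdry (fun w => lamF k w * cup ks (I :\ i) w) i z).
Proof.
elim: ks => [|k' ks [IHc IHs]].
  have closed I z : #|I| = 1%N -> \sum_(i in I) bdry (cup [::] (I :\ i)) i z = 0.
    by move=> _; apply: big1 => i _; rewrite /bdry /= addxx.
  split=> // k I z I1 /=.
  by apply: eq_bigr => i _; rewrite /bdry !mulr1.
have closed I z : #|I| = (size (k' :: ks)).+1 ->
    \sum_(i in I) bdry (cup (k' :: ks) (I :\ i)) i z = 0.
  move=> cI; pose G i j := fun w => lamF k' w * cup ks (I :\ i :\ j) w.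
  have GE i j : G i j = G j i.
    by apply/funext => w; rewrite /G; congr (_ * cup _ _ _); apply/setP => l; rewrite !inE andbCA.
  rewrite (eq_bigr (fun i => \sum_(j in I :\ i) (bdry (G i j) j (step i z) + bdry (G i j) j z))).
    apply: sum_sym0 => i j; rewrite GE /bdry stepC.
    by rewrite -!addrA; congr (_ + _); rewrite addrCA.
  move=> i iI; rewrite /bdry.
  have cIi : #|I :\ i| = (size ks).+1.
    by have := cardsD1 i I; rewrite iI cI /= add1n => -[].
  by rewrite !IHs// -big_split.
split=> // k I z cI.
have := closed I z cI; rewrite big_split /= => /eqP.
rewrite addr_eq0 => /eqP E.
rewrite [LHS]/= (eq_bigr (fun i => lamF k (step i z) * cup (k' :: ks) (I :\ i) (step i z) +
  lamF k z * cup (k' :: ks) (I :\ i) (step i z))); last by move=> i _; rewrite mulrDl.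
rewrite big_split/= -mulr_sumr E mulrN big_split/= -mulr_sumr; congr (_ + _).
by rewrite (oppr_pchar2 (pchar_Fp _)).
Qed.

(** A nonzero sum has a nonzero term, that is, a monotone path in the cube along whose successive
    edges the labels of [ks] change one after another. *)
Lemma cup_detect ks I z : cup ks I z != 0 -> forall k, k \in ks ->
  exists w w', [/\ lam k w != lam k w',
    forall j, (z j <= w j <= z j + (j \in I))%N &
    forall j, (z j <= w' j <= z j + (j \in I))%N].
Proof.
elim: ks I z => [//|k ks IH] I z /= nz.
have [i iI] : exists2 i, i \in I &
    (lamF k (step i z) + lamF k z) * cup ks (I :\ i) (step i z) != 0.
  apply/exists_inP; rewrite -negb_forall_in; apply: contraNN nz => /forall_inP H.
  by apply/eqP; apply: big1 => i /H/eqP.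
rewrite mulf_eq0 negb_or => /andP[lz cz] k'.
rewrite inE => /predU1P[->|k'ks].
  exists (step i z), z; split.
  - by apply: contraNneq lz; rewrite /lamF => ->; rewrite addxx.
  - move=> j; rewrite /step leq_addr leq_add2l /=.
    by case: eqP => // ->; rewrite iI.
  - by move=> j; rewrite leqnn leq_addr.
have [w [w' [ww' Hw Hw']]] := IH _ _ cz k' k'ks.
have sub v : (forall j, (step i z j <= v j <= step i z j + (j \in I :\ i))%N) ->
    forall j, (z j <= v j <= z j + (j \in I))%N.
  move=> Hv j; have := Hv j; rewrite /step !inE; case: eqP => [->|_] /=.
    by rewrite iI addn0; lia.
  by rewrite addn0.
by exists w, w'; split=> //; exact: sub.
Qed.

Fixpoint boxsum ks F z : 'F_2 :=
  if ks is k :: ks' then \sum_(t < p) boxsum ks' F (upd z k t) else F z.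

Lemma boxsumD ks F G z : boxsum ks (fun w => F w + G w) z = boxsum ks F z + boxsum ks G z.
Proof.
elim: ks z => [//|k ks IH] z /=.
by rewrite -big_split; apply: eq_bigr => t _; exact: IH.
Qed.

Lemma boxsum_sum (I : {set 'I_n}) ks (F : 'I_n -> ('I_n -> nat) -> 'F_2) z :
  boxsum ks (fun w => \sum_(i in I) F i w) z = \sum_(i in I) boxsum ks (F i) z.
Proof.
elim: ks z => [//|k ks IH] z /=.
by rewrite exchange_big; apply: eq_bigr => t _; exact: IH.
Qed.

Lemma boxsum_eq ks F G z : F =1 G -> boxsum ks F z = boxsum ks G z.
Proof. by move=> /funext ->. Qed.

Lemma boxsum_step ks F i z : i \notin ks ->
  boxsum ks (fun w => F (step i w)) z = boxsum ks F (step i z).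
Proof.
elim: ks z => [//|k ks IH] z; rewrite inE negb_or => /andP[ik iks] /=.
apply: eq_bigr => t _; rewrite IH//; congr boxsum; apply/funext => j.
rewrite /step /upd; case: eqP => // ->.
by rewrite eq_sym (negPf ik) addn0.
Qed.

Lemma boxsum_fix ks F i z : i \notin ks -> (forall w, w i = z i -> F w = 0) ->
  boxsum ks F z = 0.
Proof.
elim: ks z => [|k ks IH] z; first by move=> _; apply.
rewrite inE negb_or => /andP[ik iks] HF /=; apply: big1 => t _; apply: IH => // w wi.
by apply: HF; rewrite wi /upd (negPf ik).
Qed.

Lemma telescope2 (B : nat -> 'F_2) : \sum_(t < p) (B t.+1 + B t) = B p + B 0%N.
Proof.
elim: p => [|m IH]; first by rewrite big_ord0 addxx.
rewrite big_ord_recr /= IH; move: (B m.+1) (B m) (B 0%N) => x y w.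
by rewrite addrC -addrA (addrA y) addxx add0r.
Qed.

Lemma boxsum_bdry_head ks F i z : i \notin ks ->
  boxsum (i :: ks) (bdry F i) z = boxsum ks F (upd z i p) + boxsum ks F (upd z i 0).
Proof.
move=> iks /=; rewrite -(telescope2 (fun t => boxsum ks F (upd z i t))).
apply: eq_bigr => t _; rewrite boxsumD boxsum_step//; congr (boxsum _ _ _ + _).
apply/funext => j; rewrite /step /upd; case: eqP => _; first by rewrite addn1.
by rewrite addn0.
Qed.

Lemma boxsum_bdry0 ks F i z : uniq ks -> i \in ks ->
  (forall w, w i = 0%N \/ w i = p -> F w = 0) -> boxsum ks (bdry F i) z = 0.
Proof.
move=> + + F0; elim: ks z => [//|k ks IH] z /= /andP[kks uks].
rewrite inE => /predU1P[ik|iks]; last by apply: big1 => t _; exact: IH.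
rewrite -ik in kks *; rewrite -[LHS]/(boxsum (i :: ks) _ z) boxsum_bdry_head//.
by rewrite !(boxsum_fix kks) ?addr0// => w; rewrite /upd eqxx => wi; apply: F0; [left|right].
Qed.

Hypothesis lam0 : forall k z, z k = 0%N -> lam k z = false.
Hypothesis lamp : forall k z, z k = p -> lam k z = true.

(** By Stokes the sum over the box becomes a sum over its faces. Only the face where coordinate [k]
    equals [p] contributes: there label [k] is 1, and what remains is the same sum one dimension
    lower. *)
Lemma boxsum_cup ks z : uniq ks -> boxsum ks (cup ks [set i in ks]) z = 1.
Proof.
elim: ks z => [//|k ks IH] z /=/andP[kks uks].
set I := [set i in k :: ks].
have cI : #|I| = (size ks).+1 by rewrite cardsE /=; apply/card_uniqP; rewrite /= kks.
rewrite -[LHS]/(boxsum (k :: ks) (cup (k :: ks) I) z).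
have cupE w : cup (k :: ks) I w =
    \sum_(i in I) bdry (fun w => lamF k w * cup ks (I :\ i) w) i w.
  exact: (cup_closed_stokes ks).2.
rewrite (boxsum_eq _ _ cupE).
(* On a face normal to [i] the label [i] is constant, whereas a nonzero cup product would make it
   change. *)
have side i : i \in I -> i != k ->
    boxsum (k :: ks) (bdry (fun w => lamF k w * cup ks (I :\ i) w) i) z = 0.
  move=> iI ik.
  apply: boxsum_bdry0; [by rewrite /= kks|by move: iI; rewrite inE|].
  move=> w wi; apply/eqP; rewrite mulf_eq0; apply/orP; right.
  apply/negPn/negP => /cup_detect/(_ i) H.
  have iks : i \in ks by move: iI; rewrite !inE (negPf ik).
  have [v [v' [+ Hv Hv']]] := H iks.
  have := Hv i; have := Hv' i; rewrite !inE eqxx /= addn0 -!eqn_leq => /eqP vi' /eqP vi.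
  case: wi => wi; first by rewrite !lam0// -?vi -?vi'.
  by rewrite !lamp// -?vi -?vi'.
rewrite boxsum_sum (bigD1 k); last by rewrite !inE eqxx.
rewrite [X in _ (boxsum _ _ _) X]big1; last by move=> i /andP[iI ik]; exact: side.
rewrite -[LHS]/(boxsum (k :: ks) (bdry (fun w => lamF k w * cup ks (I :\ k) w) k) z + 0).
rewrite addr0.
rewrite boxsum_bdry_head//.
have -> : I :\ k = [set i in ks].
  by apply/setP => i; rewrite !inE; case: eqP => // ->; rewrite (negPf kks).
rewrite [X in _ + X](boxsum_fix kks); last first.
  by move=> w; rewrite /upd eqxx => wk; rewrite /lamF lam0// mul0r.
rewrite addr0 -[RHS](IH (upd z k p))//.
apply/eqP; rewrite -subr_eq0 (oppr_pchar2 (pchar_Fp _))// -boxsumD; apply/eqP.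
apply: (boxsum_fix kks) => w; rewrite /upd eqxx => wk.
by rewrite /lamF lamp// mul1r addxx.
Qed.

Lemma boxsum_neq0 ks F z : boxsum ks F z != 0 -> exists w,
  [/\ F w != 0, forall j, j \in ks -> (w j < p)%N & forall j, j \notin ks -> w j = z j].
Proof.
elim: ks z => [|k ks IH] z; first by exists z.
rewrite /= => nz.
have [t] : exists t : 'I_p, boxsum ks F (upd z k t) != 0.
  apply/existsP; rewrite -negb_forall; apply: contraNN nz => /forallP H.
  by apply/eqP; apply: big1 => i _; apply/eqP.
move=> /IH[w [Fw Hlt Heq]]; exists w; split=> // j; rewrite inE.
  move=> /predU1P[->|/Hlt//]; have [/Hlt//|/Heq ->] := boolP (k \in ks).
  by rewrite /upd eqxx.
by rewrite negb_or => /andP[jk /Heq ->]; rewrite /upd (negPf jk).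
Qed.

(** A cubical analogue of Sperner's lemma: the total over the grid is 1 modulo 2, so some cell has a
    nonzero cup product, and in that cell every label takes both values. *)
Lemma grid_cell : exists z : 'I_n -> nat, (forall j, (z j < p)%N) /\
  forall k, exists w w', [/\ lam k w != lam k w',
    forall j, (z j <= w j <= (z j).+1)%N & forall j, (z j <= w' j <= (z j).+1)%N].
Proof.
have : boxsum (enum 'I_n) (cup (enum 'I_n) [set i in enum 'I_n]) (fun=> 0%N) != 0.
  by rewrite boxsum_cup ?oner_eq0// enum_uniq.
move=> /boxsum_neq0[z [/cup_detect H Hp _]]; exists z; split.
  by move=> j; apply: Hp; rewrite mem_enum.
move=> k; have [|w [w' [ww' Hw Hw']]] := H k; first by rewrite mem_enum.
exists w, w'; split=> // j.
  by have := Hw j; rewrite !inE mem_enum inE addn1.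
by have := Hw' j; rewrite !inE mem_enum inE addn1.
Qed.

End GridCochains.

(** [n <= phi n] stands for a strictly increasing extraction; it is all that limits along [phi]
    use. *)
Lemma cvg_subseq (T : topologicalType) (u : nat -> T) (phi : nat -> nat) (l : T) :
  (forall n, (n <= phi n)%N) -> u @ \oo --> l -> (fun n => u (phi n)) @ \oo --> l.
Proof.
move=> nphi ul A /ul[N _ HN]; exists N => // n /= Nn; apply: HN => /=.
exact: leq_trans (nphi n).
Qed.

Lemma compact_subseq (R : realType) (V : normedModType R) (K : set V) (u : nat -> V) :
  compact K -> (forall n, K (u n)) -> exists phi y,
    [/\ forall n, (n <= phi n)%N, K y & (fun n => u (phi n)) @ \oo --> y].
Proof.
move=> cK Ku; have [|y [Ky cy]] := cK (u @ \oo) _; first by exists 0%N => // n _; exact: Ku.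
have H n : exists m, (n <= m)%N /\ `|u m - y| < n.+1%:R^-1.
  have A1 : (u @ \oo) [set u m | m in [set m | (n <= m)%N]].
    by exists n => // m /= nm; exists m.
  have n0 : 0 < n.+1%:R^-1 :> R by rewrite invr_gt0 ltr0n.
  have A2 : nbhs y [set v | `|v - y| < n.+1%:R^-1].
    apply/nbhs_ballP; exists n.+1%:R^-1 => //= v; rewrite -ball_normE /ball_/=.
    by rewrite distrC.
  have [_ [[m /= nm <-] mu]] := cy _ _ A1 A2.
  by exists m.
have [phi Hphi] := choice H.
exists phi, y; split=> //; first by move=> n; case: (Hphi n).
apply/cvgrPdist_lt => e e0; near=> n.
have [_] := Hphi n; rewrite distrC => /lt_trans; apply.
by near: n; exact: near_infty_natSinv_lt (PosNum e0).
Unshelve. all: by end_near. Qed.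

Lemma mx_norm_le (R : realType) (q : nat) (y : 'rV[R]_q) (e : R) : 0 <= e ->
  (forall i, `|y 0 i| <= e) -> `|y| <= e.
Proof.
move=> e0 H; rewrite [leLHS]mx_normrE; apply: bigmax_le => // -[i j] _ /=.
by rewrite ord1.
Qed.

Lemma mx_coord_le (R : realType) (q : nat) (y : 'rV[R]_q) i : `|y 0 i| <= `|y|.
Proof. by rewrite [leRHS]mx_normrE (le_bigmax _ _ (0, i)). Qed.

Definition cube {R : realType} (q : nat) (r : R) : set 'rV[R]_q :=
  [set y | forall i, `|y 0 i| <= r].

Arguments cube {R} q r _.

Section PoincareMiranda.
Context {R : realType} (q : nat) (r : R).
Hypothesis r0 : 0 < r.
Variable h : 'rV[R]_q -> 'I_q -> R.
Hypothesis hc : forall i, {within cube q r, continuous (h ^~ i)}.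
Hypothesis hp : forall y i, cube q r y -> y 0 i = r -> 0 <= h y i.
Hypothesis hn : forall y i, cube q r y -> y 0 i = - r -> h y i <= 0.

Lemma cube_compact : compact (cube q r).
Proof.
rewrite (_ : cube q r = [set v | forall i, `[- r, r]%classic (v ord0 i)]).
  by apply: (@rV_compact R q (fun=> `[- r, r]%classic)) => i; exact: segment_compact.
by apply/seteqP; split=> y /= H i; have := H i; rewrite /= in_itv /= ler_norml.
Qed.

Lemma cube_cell (e : R) : 0 < e -> exists2 y, cube q r y &
  forall i, exists w w', [/\ cube q r w, cube q r w', `|w - y| <= e, `|w' - y| <= e &
    0 <= h w i /\ h w' i <= 0].
Proof.
move=> e0.
pose p := (Num.truncn (2 * r / e)).+1.
have p0 : (0 : R) < p%:R by rewrite ltr0n.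
have pe : 2 * r / p%:R <= e.
  by rewrite ler_pdivrMr// [leRHS]mulrC -ler_pdivrMr// ltW// truncnS_gt.
pose pt (z : 'I_q -> nat) : 'rV[R]_q := \row_i (- r + 2 * r / p%:R * (z i)%:R).
(* On the two faces the label is imposed, because a weak sign of [h] does not determine it there;
   [lamT] and [lamF] show that each label still implies the corresponding weak sign. *)
pose lam k z := if z k == 0%N then false else if z k == p then true else 0 <= h (pt z) k.
have pr : 2 * r / p%:R * p%:R = 2 * r by rewrite divfK// gt_eqF.
have c0 : 0 < 2 * r / p%:R by rewrite divr_gt0// mulr_gt0.
have ptc z : (forall j, (z j <= p)%N) -> cube q r (pt z).
  move=> zp i; rewrite mxE ler_norml lerDl (mulr_ge0 (ltW c0))//=.
  have : 2 * r / p%:R * (z i)%:R <= 2 * r by rewrite -[leRHS]pr ler_pM2l// ler_nat.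
  lra.
have lam0 k z : z k = 0%N -> lam k z = false by rewrite /lam => ->.
have lamp k z : z k = p -> lam k z = true by rewrite /lam => ->; rewrite eqxx.
have lamT k z : (forall j, (z j <= p)%N) -> lam k z -> 0 <= h (pt z) k.
  rewrite /lam => zp; case: eqP => // _; case: eqP => // zk _; apply: hp; first exact: ptc.
  by rewrite mxE zk pr; lra.
have lamF k z : (forall j, (z j <= p)%N) -> ~~ lam k z -> h (pt z) k <= 0.
  rewrite /lam => zp; case: eqP => [zk _|_].
    by apply: hn; [exact: ptc|rewrite mxE zk mulr0 addr0].
  by case: eqP => // _; rewrite -ltNge => /ltW.
have [z [zp Hz]] := grid_cell lam0 lamp.
exists (pt z); first by apply: ptc => j; exact: ltnW.
have near_z w : (forall j, (z j <= w j <= (z j).+1)%N) ->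
    (forall j, (w j <= p)%N) /\ `|pt w - pt z| <= e.
  move=> Hw; split; first by move=> j; have := Hw j; have := zp j; lia.
  apply: mx_norm_le; first exact: ltW.
  move=> i; rewrite !mxE; have /andP[zw wz] := Hw i.
  have -> : - r + 2 * r / p%:R * (w i)%:R - (- r + 2 * r / p%:R * (z i)%:R) =
    2 * r / p%:R * ((w i)%:R - (z i)%:R) by ring.
  rewrite normrM (gtr0_norm c0) -natrB// normr_nat; apply: le_trans pe.
  by rewrite ler_piMr ?(ltW c0)// lern1 leq_subLR addn1.
move=> i; have [w [w' [ww' /near_z[wp we] /near_z[w'p w'e]]]] := Hz i.
have [lw|lw] := boolP (lam i w).
  have lw' : ~~ lam i w' by move: ww'; rewrite lw; case: (lam i w').
  by exists (pt w), (pt w'); split; [exact: ptc|exact: ptc|by []|by []|split; [exact: lamT|exact: lamF]].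
have lw' : lam i w' by move: ww'; rewrite (negPf lw); case: (lam i w').
by exists (pt w'), (pt w); split; [exact: ptc|exact: ptc|by []|by []|split; [exact: lamT|exact: lamF]].
Qed.

(** Cells of mesh tending to 0 accumulate at a point where, by continuity, each component is both
    [>= 0] and [<= 0]. *)
Theorem poincare_miranda : exists2 y, cube q r y & forall i, h y i = 0.
Proof.
have /choice[y Hy] : forall n : nat, exists y, cube q r y /\
  forall i, exists w w', [/\ cube q r w, cube q r w', `|w - y| <= n.+1%:R^-1,
    `|w' - y| <= n.+1%:R^-1 & 0 <= h w i /\ h w' i <= 0].
  move=> n; have n0 : 0 < n.+1%:R^-1 :> R by rewrite invr_gt0 ltr0n.
  by have [y] := cube_cell n0; exists y.
have [phi [l [nphi Kl yl]]] := compact_subseq cube_compact (fun n => (Hy n).1).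
exists l => // i.
have near_l (e : R) : 0 < e -> exists w w', [/\ cube q r w, cube q r w',
    `|h w i - h l i| < e, `|h w' i - h l i| < e & 0 <= h w i /\ h w' i <= 0].
  move=> e0; have /subspace_continuousP/(_ l Kl)/cvgrPdist_lt/(_ e e0) := @hc i.
  rewrite near_withinE => /nbhs_ballP[d /= d0 Hd].
  have d2 : 0 < d / 2 by rewrite divr_gt0.
  have : \forall n \near \oo, exists w w', [/\ cube q r w, cube q r w',
    `|h w i - h l i| < e, `|h w' i - h l i| < e & 0 <= h w i /\ h w' i <= 0].
    near=> n; have [_ /(_ i)[w [w' [cw cw' wy wy' hh]]]] := Hy (phi n).
    have yn : `|l - y (phi n)| < d / 2.
      by near: n; have /cvgrPdist_lt := yl; exact.
    have nd : n.+1%:R^-1 < d / 2 by near: n; exact: near_infty_natSinv_lt (PosNum d2).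
    have pn : (phi n).+1%:R^-1 < d / 2.
      by apply: le_lt_trans nd; rewrite lef_pV2 ?posrE ?ltr0n// ler_nat ltnS.
    have close v : cube q r v -> `|v - y (phi n)| <= (phi n).+1%:R^-1 -> `|h v i - h l i| < e.
      move=> cv vy; rewrite distrC; apply: Hd => //; rewrite -ball_normE /ball_/=.
      rewrite (le_lt_trans (ler_distD (y (phi n)) _ _))// (splitr d) ltrD//.
      by rewrite distrC (le_lt_trans vy).
    by exists w, w'; split=> //; exact: close.
  by case=> N _ /(_ N (leqnn N)).
apply/eqP; rewrite eq_le; apply/andP; split; apply/ler_addgt0Pr => e e0.
  have [w [w' [_ _ _ + [_ hw']]]] := near_l _ e0.
  by rewrite ltr_distl => /andP[H1 H2]; lra.
have [w [w' [_ _ + _ [hw _]]]] := near_l _ e0.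
by rewrite ltr_distl => /andP[H1 H2]; lra.
Unshelve. all: by end_near. Qed.

End PoincareMiranda.

(** * Separation of a cone from a point *)

Section ConeSeparation.
Context {R : realType} {I : finType}.
Variable D : set (I -> R).
Hypothesis D0 : D (fun=> 0).
Hypothesis Dcone : forall d d' (s : R), D d -> D d' -> 0 <= s -> D (fun i => d i + s * d' i).

(** [L] is [c] minus its Euclidean projection on the closure of [D]; as [D] need not be closed, it
    is obtained as the limit of a minimizing sequence. *)
Lemma cone_separation (c : I -> R) (e : R) : 0 < e ->
  (forall d, D d -> exists i, e <= `|c i - d i|) ->
  exists L : I -> R, (exists i, L i != 0) /\ forall d, D d -> \sum_i L i * d i <= 0.
Proof.
move=> e0 De.
pose N (d : I -> R) := \sum_i (c i - d i) ^+ 2.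
have N0 d : 0 <= N d by apply: sumr_ge0 => i _; exact: sqr_ge0.
have Ne d : D d -> e ^+ 2 <= N d.
  move=> /De[i ei]; rewrite /N (bigD1 i)//= -[leLHS]addr0 lerD//.
    by rewrite -(real_normK (num_real (c i - d i))) ler_pXn2r ?nnegrE// ltW.
  by apply: sumr_ge0 => j _; exact: sqr_ge0.
pose A := [set N d | d in D].
have hA : has_inf A.
  by split; [exists (N (fun=> 0)), (fun=> 0)|exists 0 => _ [d _ <-]].
pose mu := inf A.
have muN d : D d -> mu <= N d.
  by move=> Dd; apply: ge_inf; [case: hA|exists d].
have /choice[d Hd] : forall n : nat, exists d, D d /\ N d < mu + n.+1%:R^-1.
  move=> n; have n0 : 0 < n.+1%:R^-1 :> R by rewrite invr_gt0 ltr0n.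
  by have [_ [d Dd <-]] := inf_adherent n0 hA; exists d.
pose u n : 'rV[R]_#|I| := \row_k (c (enum_val k) - d n (enum_val k)).
have mu0 : 0 <= mu by apply: lb_le_inf; [case: hA|move=> _ [v _ <-]].
(* Each coordinate [x] has [x ^+ 2 <= mu + 1], and [2 * x <= x ^+ 2 + 1] turns this into a bound
   without square roots. *)
have uK n : cube #|I| (mu + 1 + 1) (u n).
  move=> k; rewrite mxE; set i := enum_val k.
  have [_ NHd] := Hd n.
  have n1 : n.+1%:R^-1 <= 1 :> R by rewrite invf_le1 ?ltr0n// ler1n.
  have : (c i - d n i) ^+ 2 <= N (d n).
    by rewrite /N (bigD1 i)//= lerDl; apply: sumr_ge0 => j _; exact: sqr_ge0.
  rewrite -(real_normK (num_real (c i - d n i))); set x : R := `|_| => Hx.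
  have : 2 * x <= x ^+ 2 + 1.
    by rewrite -subr_ge0 (_ : _ - _ = (x - 1) ^+ 2) ?sqr_ge0//; ring.
  move: (N (d n)) (n.+1%:R^-1 : R) (x ^+ 2 : R) NHd Hx n1 => Nd ni x2; lra.
have [phi [v [nphi _ uv]]] := compact_subseq (@cube_compact R #|I| (mu + 1 + 1)) uK.
pose L i := v 0 (enum_rank i).
have uL i : (fun n => c i - d (phi n) i) @ \oo --> L i.
  have cc : (fun w : 'rV[R]_#|I| => w 0 (enum_rank i)) @ v --> v 0 (enum_rank i).
    exact: coord_continuous.
  have := cvg_comp _ _ uv cc; apply: cvg_trans; apply: near_eq_cvg.
  by apply: nearW => n /=; rewrite mxE enum_rankK.
have LE : (fun n => N (d (phi n))) @ \oo --> \sum_i L i ^+ 2.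
  rewrite /N; apply: cvg_big => [|i _]; first exact: add_continuous.
  by rewrite expr2; under eq_fun do rewrite expr2; exact: cvgM.
have Lnz : e ^+ 2 <= \sum_i L i ^+ 2.
  rewrite -(cvg_lim _ LE)//; apply: limr_ge; first by apply/cvg_ex; eexists; exact: LE.
  by apply: nearW => n; apply: Ne; case: (Hd (phi n)).
exists L; split.
  apply/existsP; rewrite -negb_forall; apply/negP => /forallP L0.
  move: Lnz; rewrite big1 => [|i _]; first by rewrite leNgt exprn_gt0.
  by rewrite (eqP (L0 i)) expr0n.
move=> d' Dd'; set S := \sum_i _.
pose M := \sum_i d' i ^+ 2.
have M0 : 0 <= M by apply: sumr_ge0 => i _; exact: sqr_ge0.
have LS : (fun n => \sum_i (c i - d (phi n) i) * d' i) @ \oo --> S.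
  rewrite /S; apply: cvg_big => [|i _]; first exact: add_continuous.
  by apply: cvgM => //; exact: cvg_cst.
(* Near-minimality of [d (phi n)] is tested against the competitor [d (phi n) + s d']; the gap
   [n.+1%:R^-1] vanishes in the limit. *)
have key (s : R) : 0 < s -> 2 * s * S <= s ^+ 2 * M.
  move=> s0.
  have L2 : (fun n => 2 * s * (\sum_i (c i - d (phi n) i) * d' i) - n.+1%:R^-1) @ \oo
      --> 2 * s * S - 0.
    apply: cvgB; first by apply: cvgM => //; exact: cvg_cst.
    exact: cvg_harmonic.
  rewrite -[leLHS]subr0 -(cvg_lim _ L2)//; apply: limr_le.
    by apply/cvg_ex; eexists; exact: L2.
  apply: nearW => n /=; have [Dn Nn] := Hd (phi n).
  have := muN _ (Dcone Dn Dd' (ltW s0)).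
  have -> : N (fun i => d (phi n) i + s * d' i) = N (d (phi n)) -
      2 * s * (\sum_i (c i - d (phi n) i) * d' i) + s ^+ 2 * M.
    rewrite /N /M !mulr_sumr -sumrB -big_split /=.
    by apply: eq_bigr => i _; ring.
  have : (phi n).+1%:R^-1 <= n.+1%:R^-1 :> R.
    by rewrite lef_pV2 ?posrE ?ltr0n// ler_nat ltnS.
  move: Nn; move: (N (d (phi n))) (\sum_i _) (n.+1%:R^-1 : R) ((phi n).+1%:R^-1 : R).
  move: (s ^+ 2 * M) => sM Nd Sn ni np; lra.
rewrite leNgt; apply/negP => S0.
(* For [s = S / (M + 1)], [key] would read [2 * (M + 1) * s ^+ 2 <= M * s ^+ 2]. The added 1 avoids
   a division by zero when [M = 0]. *)
have M1 : 0 < M + 1 by rewrite ltr_wpDl.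
have s0 : 0 < S / (M + 1) by rewrite divr_gt0.
have := key _ s0.
have -> : 2 * (S / (M + 1)) * S = 2 * (M + 1) * (S / (M + 1)) ^+ 2.
  by field; rewrite gt_eqF.
have : 0 < (S / (M + 1)) ^+ 2 by rewrite exprn_gt0.
by rewrite [leRHS]mulrC; nra.
Qed.

End ConeSeparation.

(** * Differentiability along the trajectory *)

(** Proved without a metric because controls take values in a topological space. A filter that does
    not cluster at [l] contains a set missing a neighborhood of [l], hence lives on finitely many
    terms. *)
Lemma cvg_compact (T : topologicalType) (u : nat -> T) (l : T) :
  u @ \oo --> l -> compact ([set l] `|` range u).
Proof.
move=> ul F PF FK.
have [cl|ncl] := pselect (cluster F l); first by exists l; split=> //; left.
have [A [B [FA nB AB]]] : exists A B, [/\ F A, nbhs l B & A `&` B = set0].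
  apply: contrapT => H; apply: ncl => A B FA nB.
  by apply/set0P/eqP => AB; apply: H; exists A, B.
have [N _ HN] := ul _ nB.
pose K := [set u m | m in `I_N].
have cK : compact K by apply: finite_compact; apply: finite_image; exact: finite_II.
have FK' : F K.
  apply: filterS2 FK FA => x [->|[m _ <-]] Ax.
    by move: AB; rewrite -subset0 => /(_ l) []; split=> //; exact: nbhs_singleton.
  exists m => //=; rewrite ltnNge; apply/negP => Nm.
  by move: AB; rewrite -subset0 => /(_ (u m)) []; split=> //; exact: HN.
have [x [Kx cx]] := cK F PF FK'.
by exists x; split=> //; right; case: Kx => m _ <-; exists m.
Qed.

Section Gateaux.
Context {R : realType} {X Y : normedModType R}.
Implicit Types (f : X -> Y) (A : bounded_linear X Y).

Lemma gateaux_right_eps f x A h : is_gateaux f x A -> forall e, 0 < e ->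
  exists2 r, 0 < r & forall t, 0 < t < r ->
    `|f (x + t *: h) - f x - t *: A h| <= e * t.
Proof.
move=> /(_ h) /cvg_right_eps H e e0; have [r r0 {}H] := H e e0.
exists r => // t /andP[t0 tr]; have := H t; rewrite add0r t0 tr => /(_ isT).
have -> : f (x + t *: h) - f x - t *: A h = t *: (t^-1 *: (f (x + t *: h) - f x) - A h).
  by rewrite scalerBr scalerA mulfV ?gt_eqF// scale1r.
by rewrite normrZ (gtr0_norm t0) (mulrC e) ler_pM2l.
Qed.

(** The one-sided quotients along [h] and [- h] fit together because [A] is linear. *)
Lemma gateaux_line_derive f x A h : is_gateaux f x A ->
  is_derive (0 : R) (1 : R) (fun t : R => f (x + t *: h)) (A h).
Proof.
move=> fA; apply/is_derive_eps => e e0.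
have [r1 r10 H1] := gateaux_right_eps h fA e0.
have [r2 r20 H2] := gateaux_right_eps (- h) fA e0.
exists (Num.min r1 r2) => [|t]; first by rewrite lt_min r10.
rewrite subr0 scale0r addr0 lt_min => /andP[t1 t2].
have [t0|t0|->] := ltgtP t 0.
- rewrite ltr0_norm// in t2 *; have := H2 (- t); rewrite oppr_gt0 t0 t2 => /(_ isT).
  have -> : A (- h) = - A h by exact: linearN.
  by rewrite !scalerN !scaleNr !opprK.
- rewrite gtr0_norm// in t1 *; apply: H1; by rewrite t0.
- by rewrite !scale0r addr0 subrr subr0 !normr0 mulr0.
Qed.

Lemma DGP f x : gateaux_differentiable f x -> is_gateaux f x (DG f x).
Proof. by move=> [A fA]; exact: (@getPex _ (is_gateaux f x) (ex_intro _ A fA)). Qed.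

Lemma gateaux_lipschitz f c (r L : R) x y : 0 <= L ->
  (forall z, `|z - c| < r -> gateaux_differentiable f z /\ `|DG f z| <= L) ->
  `|x - c| < r -> `|y - c| < r -> `|f x - f y| <= L * `|x - y|.
Proof.
move=> L0 Hf xr yr.
pose w (s : R) := f (y + s *: (x - y)).
have zr (s : R) : 0 <= s <= 1 -> `|y + s *: (x - y) - c| < r.
  move=> /andP[s0 s1].
  have -> : y + s *: (x - y) - c = s *: (x - c) + (1 - s) *: (y - c).
    by rewrite scalerBl scale1r !scalerBr; zmod.
  rewrite (le_lt_trans (ler_normD _ _))// !normrZ ger0_norm// ger0_norm ?subr_ge0//.
  have [->|sN0] := eqVneq s 0; first by rewrite mul0r add0r subr0 mul1r.
  have {}s0 : 0 < s by rewrite lt_neqAle eq_sym sN0.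
  have : s * `|x - c| < s * r by rewrite ltr_pM2l.
  have : (1 - s) * `|y - c| <= (1 - s) * r by rewrite ler_wpM2l ?subr_ge0// ltW.
  lra.
pose G s := DG f (y + s *: (x - y)) (x - y).
have dw (s : R) : 0 <= s <= 1 -> is_derive s (1 : R) w (G s).
  move=> s01; have [/DGP fz _] := Hf _ (zr s s01).
  have := gateaux_line_derive (x - y) fz.
  rewrite !is_derive_eps => H e /H[d d0 {}H]; exists d => // t ts.
  have := H (t - s); rewrite subr0 => /(_ ts).
  rewrite scale0r addr0 /w.
  have -> : y + s *: (x - y) + (t - s) *: (x - y) = y + t *: (x - y).
    by rewrite scalerBl; zmod.
  by [].
have pw : primitive 0 1 [::] w G.
  split=> [|t /andP[t0 t1] _]; last by apply: dw; rewrite !ltW.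
  apply/within_continuous_eps => s s01 e e0.
  have : {for s, continuous w}.
    by apply: differentiable_continuous; apply/derivable1_diffP; case: (dw s s01).
  move=> /cvgrPdist_lt/(_ _ e0)/nbhs_ballP[d /= d0 H].
  by exists d => // t _ ts; rewrite distrC; apply: H; rewrite /ball/= distrC.
have := mvt_norm_cst (M := L * `|x - y|) ler01 pw.
have -> : w 1 = f x by rewrite /w scale1r; congr f; zmod.
rewrite /w scale0r addr0 subr0 mulr1; apply => s /andP[s0 s1] _.
have s01 : 0 <= s <= 1 by rewrite !ltW.
have [_ DL] := Hf _ (zr s s01).
by apply: le_trans (bl_le _ _) _; rewrite ler_wpM2r.
Qed.

End Gateaux.

Section NearRight.
Context {R : realType}.
Implicit Types (c r s : R) (P : R -> Prop).

Lemma near_rightP c P : (\forall s \near c^'+, P s) ->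
  exists2 r, 0 < r & forall s, c < s < c + r -> P s.
Proof.
rewrite near_withinE => /nbhs_ballP[r /= r0 H]; exists r => // s /andP[cs sr].
by apply: H => //; rewrite /ball/= ltr_distlC; apply/andP; split; lra.
Qed.

Lemma near_leftP c P : (\forall s \near c^'-, P s) ->
  exists2 r, 0 < r & forall s, c - r < s < c -> P s.
Proof.
rewrite near_withinE => /nbhs_ballP[r /= r0 H]; exists r => // s /andP[cs sr].
by apply: H => //; rewrite /ball/= ltr_distlC; apply/andP; split; lra.
Qed.

(** A property indexed by [n] that at no rank holds near [c] fails along a sequence tending to [c];
    such sequences feed [good_seq]. *)
Lemma not_near_right (P : nat -> R -> Prop) c : (forall n, ~ \forall s \near c^'+, P n s) ->
  exists t : nat -> R, (forall n, ~ P n (t n)) /\ t @ \oo --> c^'+.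
Proof.
move=> H; have /choice[t Ht] : forall n, exists s, ~ P n s /\ c < s < c + n.+1%:R^-1.
  move=> n; apply: contrapT => Hn; apply: (H n).
  have n0 : 0 < n.+1%:R^-1 :> R by rewrite invr_gt0 ltr0n.
  have cn : c <= c < c + n.+1%:R^-1 by rewrite lexx ltrDl.
  apply: filterS (near_right_oo cn) => s cs; apply: contrapT => nP.
  by apply: Hn; exists s.
exists t; split; first by move=> n; case: (Ht n).
move=> A /near_rightP[r r0 Hr].
have : \forall n \near \oo, A (t n).
  near=> n; apply: Hr; have [_ /andP[-> /= /lt_trans]] := Ht n; apply.
  by rewrite ltrD2l; near: n; exact: near_infty_natSinv_lt (PosNum r0).
by [].
Unshelve. all: by end_near. Qed.

Lemma not_near_left (P : nat -> R -> Prop) c : (forall n, ~ \forall s \near c^'-, P n s) ->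
  exists t : nat -> R, (forall n, ~ P n (t n)) /\ t @ \oo --> c^'-.
Proof.
move=> H; have /choice[t Ht] : forall n, exists s, ~ P n s /\ c - n.+1%:R^-1 < s < c.
  move=> n; apply: contrapT => Hn; apply: (H n).
  have n0 : 0 < n.+1%:R^-1 :> R by rewrite invr_gt0 ltr0n.
  have cn : c - n.+1%:R^-1 < c <= c by rewrite lexx ltrBlDr ltrDl n0.
  apply: filterS (near_left_oo cn) => s cs; apply: contrapT => nP.
  by apply: Hn; exists s.
exists t; split; first by move=> n; case: (Ht n).
move=> A /near_leftP[r r0 Hr].
have : \forall n \near \oo, A (t n).
  near=> n; apply: Hr; have [_ /andP[nt ->]] := Ht n; rewrite andbT.
  apply: lt_trans nt; rewrite ltrD2l ltrN2.
  by near: n; exact: near_infty_natSinv_lt (PosNum r0).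
by [].
Unshelve. all: by end_near. Qed.

End NearRight.

Section Tube.
Context {R : realType} {E : completeNormedModType R} {Y : topologicalType}.
Variables (T : R) (Omega : set E) (U : set Y) (x0 : R -> E).
Hypothesis T0 : 0 < T.
Hypothesis Omega_open : open Omega.
Hypothesis x0c : {within `[0, T], continuous x0}.
Hypothesis x0O : forall t, 0 <= t <= T -> Omega (x0 t).

Section Output.
Variables (F : normedModType R) (phi : R -> E -> Y -> F).
Hypothesis phi_reg : regular_along T Omega U x0 phi.
Variables (S : seq R) (u : R -> Y).
Hypothesis u_npc : npc T S U u.

(** One number is both the radius and the inverse of the bound, which makes the property monotone in
    [eta]. *)
Let good (eta : R) t := forall xi, `|xi - x0 t| < eta ->
  Omega xi /\ `|DG (phi t ^~ (u t)) xi| <= eta^-1.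

Let good_le eta eta' t : 0 < eta' -> eta' <= eta -> good eta t -> good eta' t.
Proof.
move=> eta0 ee Ht xi Hxi; have [|Oxi HD] := Ht xi; first exact: lt_le_trans Hxi ee.
split=> //; apply: le_trans HD _; rewrite lef_pV2 ?posrE//.
exact: lt_le_trans ee.
Qed.

Let uU t : 0 <= t <= T -> U (u t).
Proof. by move=> tT; have [[HU _ _ _] _ _] := u_npc; exact: HU. Qed.

(** If [good] failed at every rank, the offending states [xi n] would converge to [x0 c]. Together
    with their limits, these states and the control values form compact sets, on which the
    differentials would be unbounded. *)
Let good_seq (t : nat -> R) c y : 0 <= c <= T -> (forall n, 0 <= t n <= T) ->
  t @ \oo --> c -> (fun n => u (t n)) @ \oo --> y -> U y ->
  ~ (forall n, ~ good n.+1%:R^-1 (t n)).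
Proof.
move=> cT tT tc uy Uy bad.
have /choice[xi Hxi] : forall n, exists xi, `|xi - x0 (t n)| < n.+1%:R^-1 /\
    ~ (Omega xi /\ `|DG (phi (t n) ^~ (u (t n))) xi| <= n.+1%:R^-1^-1).
  move=> n; apply: contrapT => H; apply: (bad n) => xi Hxi; apply: contrapT => H'.
  by apply: H; exists xi.
have x0t : (fun n => x0 (t n)) @ \oo --> x0 c.
  apply/cvgrPdist_lt => e e0.
  have [d d0 Hd] := (within_continuous_eps _ _ _).1 x0c c cT e e0.
  have /cvgrPdist_lt/(_ d d0) := tc; apply: filterS => n tn.
  by rewrite distrC; apply: Hd => //; rewrite distrC.
have xic : xi @ \oo --> x0 c.
  apply/cvgrPdist_lt => e e0; have e2 : 0 < e / 2 by rewrite divr_gt0.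
  near=> n; rewrite (le_lt_trans (ler_distD (x0 (t n)) _ _))// (splitr e) ltrD//.
    by near: n; have /cvgrPdist_lt := x0t; exact.
  rewrite distrC; have [+ _] := Hxi n; move=> /lt_trans; apply.
  by near: n; exact: near_infty_natSinv_lt (PosNum e2).
have [N _ HN] : \forall n \near \oo, Omega (xi n).
  by apply: xic; apply: open_nbhs_nbhs; split=> //; exact: x0O.
(* Dropping the first [N] terms keeps the compact set of states inside [Omega]. *)
have addN : forall n, (n <= n + N)%N by move=> n; exact: leq_addr.
have xicN := cvg_subseq addN xic; have uyN := cvg_subseq addN uy.
have [_ _ _ _ /(_ _ _ (cvg_compact xicN))] := phi_reg.
pose K := [set x0 c] `|` range (fun n => xi (n + N)%N).
pose M := [set y] `|` range (fun n => u (t (n + N)%N)).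
move=> /(_ M); rewrite -/K => H; have /H {}H : K !=set0 by exists (x0 c); left.
have /H {}H : K `<=` Omega.
  by move=> _ [->|[n _ <-]]; [exact: x0O|apply: HN => /=; exact: leq_addl].
have /H {}H : compact M by exact: cvg_compact uyN.
have /H {}H : M !=set0 by exists y; left.
have /H : M `<=` U by move=> _ [->//|[n _ <-]]; exact: uU.
set sp := ereal_sup _ => spoo.
have ub n : (`|DG (phi (t (n + N)%N) ^~ (u (t (n + N)%N))) (xi (n + N)%N)|%:E <= sp)%E.
  apply: ereal_sup_ubound; exists (t (n + N)%N, xi (n + N)%N, u (t (n + N)%N)) => //=.
  by split; [split; [rewrite in_itv /=; exact: tT|right; exists n]|right; exists n].
(* The supremum is below [+oo] by regularity, and above [-oo] because the set contains a norm. *)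
have : sp \is a fin_num.
  rewrite fin_numE (lt_eqF spoo) andbT gt_eqF//.
  exact: lt_le_trans (ltNyr _) (ub 0%N).
move=> /fineK spE.
have [n Hn] : exists n : nat, fine sp <= n.+1%:R.
  by exists (Num.truncn (fine sp)); rewrite ltW// truncnS_gt.
have [_] := Hxi (n + N)%N; apply; split; first by apply: HN => /=; exact: leq_addl.
rewrite invrK; have := ub n; rewrite -spE lee_fin => /le_trans; apply.
by apply: le_trans Hn _; rewrite ler_nat ltnS leq_addr.
Unshelve. all: by end_near. Qed.

Let good_right c : 0 <= c < T -> exists2 eta, 0 < eta & \forall t \near c^'+, good eta t.
Proof.
move=> /[dup] cT /andP[c0 cT']; apply: contrapT => H.
have [t [bad tc]] : exists t : nat -> R, (forall n, ~ (0 <= t n <= T -> good n.+1%:R^-1 (t n))) /\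
    t @ \oo --> c^'+.
  apply: (not_near_right (P := fun n t => 0 <= t <= T -> good n.+1%:R^-1 t)) => n Hn.
  apply: H; exists n.+1%:R^-1; first by rewrite invr_gt0 ltr0n.
  apply: filterS2 Hn (near_right_oo cT) => s + /andP[s0 sT]; apply.
  by rewrite !ltW.
have tT n : 0 <= t n <= T by apply: contrapT => tT; apply: (bad n).
have [[_ _ Hr _] _ _] := u_npc; have [y Uy uy] := Hr c cT.
apply: (good_seq (t := t) (c := c) (y := y)) => //.
- by rewrite c0 ltW.
- by apply: cvg_trans tc _; apply: cvg_at_right_filter; exact: cvg_id.
- exact: cvg_comp tc uy.
- by move=> n g; apply: (bad n).
Qed.

Let good_left c : 0 < c <= T -> exists2 eta, 0 < eta & \forall t \near c^'-, good eta t.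
Proof.
move=> /[dup] cT /andP[c0 cT']; apply: contrapT => H.
have [t [bad tc]] : exists t : nat -> R, (forall n, ~ (0 <= t n <= T -> good n.+1%:R^-1 (t n))) /\
    t @ \oo --> c^'-.
  apply: (not_near_left (P := fun n t => 0 <= t <= T -> good n.+1%:R^-1 t)) => n Hn.
  apply: H; exists n.+1%:R^-1; first by rewrite invr_gt0 ltr0n.
  apply: filterS2 Hn (near_left_oo cT) => s + /andP[s0 sT]; apply.
  by rewrite !ltW.
have tT n : 0 <= t n <= T by apply: contrapT => tT; apply: (bad n).
have [[_ _ _ Hl] _ _] := u_npc; have [y Uy uy] := Hl c cT.
apply: (good_seq (t := t) (c := c) (y := y)) => //.
- by rewrite cT' ltW.
- by apply: cvg_trans tc _; apply: cvg_at_left_filter; exact: cvg_id.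
- exact: cvg_comp tc uy.
- by move=> n g; apply: (bad n).
Qed.

Let good_at c : 0 <= c <= T -> exists2 eta, 0 < eta & good eta c.
Proof.
move=> cT; apply: contrapT => H.
apply: (good_seq (t := fun=> c) (c := c) (y := u c)) => //.
- exact: cvg_cst.
- exact: cvg_cst.
- exact: uU.
- by move=> n g; apply: H; exists n.+1%:R^-1; rewrite ?invr_gt0 ?ltr0n.
Qed.

(** Radii valid to the right of a time, to its left and at the time itself are pasted by real
    induction; the time itself is treated apart because [u] may jump there. *)
Lemma tube_bound : exists2 eta, 0 < eta & forall t, 0 <= t <= T ->
  forall xi, `|xi - x0 t| < eta -> Omega xi /\ `|DG (phi t ^~ (u t)) xi| <= eta^-1.
Proof.
pose P c := exists2 eta, 0 < eta & forall t, 0 <= t <= c -> good eta t.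
suff : P T by [].
apply: (@real_induction _ 0 T P); first exact: ltW.
- have [|eta eta0 Heta] := good_at (c := 0); first by rewrite lexx ltW.
  exists eta => // t /andP[t0 t0']; by rewrite (@le_anti _ _ t 0) ?t0 ?t0'.
- move=> c cT [eta eta0 Heta]; have [eta' eta'0] := good_right cT.
  move=> /near_rightP[r r0 Hr]; have /andP[c0 cT'] := cT.
  exists (Num.min T (c + r / 2)).
    by rewrite lt_min cT' ltrDl divr_gt0//= ge_min lexx.
  exists (Num.min eta eta'); first by rewrite lt_min eta0.
  move=> t /andP[t0]; rewrite le_min => /andP[tT tr].
  have m0 : 0 < Num.min eta eta' by rewrite lt_min eta0.
  have [tc|ct] := leP t c.
    by apply: good_le (Heta t _) => //; rewrite ?ge_min ?lexx ?t0.
  by apply: good_le (Hr t _) => //; rewrite ?ge_min ?lexx ?orbT// ct/=; lra.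
- move=> c cT H; have [eta' eta'0] := good_left cT.
  move=> /near_leftP[r r0 Hr]; have /andP[c0 cT'] := cT.
  have [|s /andP[rs sc] [s0 [eta eta0 Heta]]] := H (c - r); first lra.
  have [|eta2 eta20 Heta2] := good_at (c := c); first by rewrite cT' ltW.
  have m0 : 0 < Num.min eta (Num.min eta' eta2) by rewrite !lt_min eta0 eta'0.
  exists (Num.min eta (Num.min eta' eta2)) => // t /andP[t0 tc].
  have [ts|st] := leP t s.
    by apply: good_le (Heta t _) => //; rewrite ?ge_min ?lexx ?t0.
  have [->|tNc] := eqVneq t c.
    by apply: good_le Heta2 => //; rewrite !ge_min lexx !orbT.
  apply: good_le (Hr t _) => //; first by rewrite !ge_min lexx orbT.
  by rewrite (lt_trans rs)//= lt_neqAle tNc.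
Qed.

Lemma tube_lipschitz : exists2 eta, 0 < eta & forall t, 0 <= t <= T ->
  (forall xi, `|xi - x0 t| < eta -> Omega xi) /\
  forall xi xi', `|xi - x0 t| < eta -> `|xi' - x0 t| < eta ->
    `|phi t xi (u t) - phi t xi' (u t)| <= eta^-1 * `|xi - xi'|.
Proof.
have [eta eta0 H] := tube_bound; exists eta => // t tT; split.
  by move=> xi /(H t tT)[].
move=> xi xi' Hxi Hxi'.
apply: (gateaux_lipschitz (f := phi t ^~ (u t)) (c := x0 t) (r := eta)) => //.
  by rewrite invr_ge0 ltW.
move=> z /(H t tT)[Oz DL]; split=> //.
have [_ HG _ _ _] := phi_reg; by apply: HG => //; exact: uU.
Qed.

End Output.
End Tube.

(** * Needle variations *)

Section Clip.
Context {R : realType} {V : normedModType R}.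
Variable d : R.
Hypothesis d0 : 0 < d.
Implicit Types v w : V.

(** The radial retraction onto the closed ball of radius [d]. *)
Definition clip v : V := (d / Num.max d `|v|) *: v.

Let m0 v : 0 < Num.max d `|v|. Proof. by rewrite lt_max d0. Qed.

Lemma clip_id v : `|v| <= d -> clip v = v.
Proof. by move=> vd; rewrite /clip max_l// divff ?gt_eqF// scale1r. Qed.

Lemma clip_norm v : `|clip v| <= d.
Proof.
rewrite normrZ ger0_norm; last by rewrite divr_ge0// ltW.
by rewrite mulrAC ler_pdivrMr// ler_pM2l// le_max lexx orbT.
Qed.

(** The displacement and the change of the scaling factor each cost at most the norm of [v - w],
    hence the constant 2. *)
Lemma clip_lipschitz v w : `|clip v - clip w| <= 2 * `|v - w|.
Proof.
rewrite /clip; set mv := Num.max d `|v|; set mw := Num.max d `|w|.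
have v0 : 0 < mv := m0 v; have w0 : 0 < mw := m0 w.
have -> : (d / mv) *: v - (d / mw) *: w =
    (d / mv) *: (v - w) + (d / mv * ((mw - mv) / mw)) *: w.
  have -> : d / mv * ((mw - mv) / mw) = d / mv - d / mw.
    by field; rewrite !gt_eqF.
  by rewrite scalerBr scalerBl; zmod.
have dv : d / mv <= 1 by rewrite ler_pdivrMr// mul1r le_max lexx.
have dv0 : 0 <= d / mv by rewrite divr_ge0// ltW.
have mm : `|mw - mv| <= `|v - w|.
  have max_lip (p q D : R) : `|p - q| <= D -> `|Num.max d q - Num.max d p| <= D.
    rewrite ler_norml => /andP[? ?]; rewrite ler_norml; apply/andP.
    by case: (leP d q) => ?; case: (leP d p) => ?; split; lra.
  exact/max_lip/ler_dist_dist.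
have ww : `|w| / mw <= 1 by rewrite ler_pdivrMr// mul1r le_max lexx orbT.
have n1 : `|(d / mv) *: (v - w)| <= `|v - w|.
  by rewrite normrZ ger0_norm// -[leRHS]mul1r ler_wpM2r.
have n2 : `|(d / mv * ((mw - mv) / mw)) *: w| <= `|v - w|.
  rewrite normrZ normrM (ger0_norm dv0) normrM normfV (gtr0_norm w0).
  have -> : d / mv * (`|mw - mv| / mw) * `|w| = (d / mv) * (`|mw - mv| * (`|w| / mw)) by ring.
  have H0 : 0 <= `|mw - mv| * (`|w| / mw) by rewrite !mulr_ge0// invr_ge0 ltW.
  apply: le_trans (ler_wpM2r H0 dv) _; rewrite mul1r.
  by apply: le_trans (ler_wpM2l (normr_ge0 _) ww) _; rewrite mulr1.
rewrite (le_trans (ler_normD _ _))//; lra.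
Qed.

End Clip.

Section Ramp.
Context {R : realType}.
Implicit Types (a b s e t : R) (S : seq R).

Definition ramp s e t := if t <= s then 0 else if t <= e then t - s else e - s.

Lemma ramp_ge0 s e t : s <= e -> 0 <= ramp s e t.
Proof.
move=> se; rewrite /ramp; have [//|st] := leP t s.
by have [_|_] := leP t e; rewrite subr_ge0// ltW.
Qed.

Lemma ramp_le s e t : s <= e -> ramp s e t <= e - s.
Proof.
move=> se; rewrite /ramp; have [_|st] := leP t s; first by rewrite subr_ge0.
by have [te|//] := leP t e; rewrite lerD2r.
Qed.

Lemma ramp0 s e t : t <= s -> ramp s e t = 0.
Proof. by rewrite /ramp => ->. Qed.

Lemma ramp1 s e t : s <= e -> e <= t -> ramp s e t = e - s.
Proof.
rewrite /ramp => se et; have [ts|st] := leP t s.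
  have -> : e = s by apply: le_anti; rewrite se (le_trans et).
  by rewrite subrr.
by have [te|//] := leP t e; congr (_ - _); apply: le_anti; rewrite te.
Qed.

Lemma primitive_ramp a b s e S : a <= s -> s <= e -> e <= b -> s \in S -> e \in S ->
  primitive a b S (ramp s e) (fun t => (s <= t < e)%R%:R).
Proof.
move=> as_ se eb sS eS.
have p1 : primitive a s [:: e] (cst (0 : R)) (cst 0) by exact: primitive_cst.
have p2 : primitive s e [::] (fun t => t - s) (cst 1).
  have := primitive_line s e [::] s (1 : R).
  by apply: primitive_ext => // t _; rewrite scalerRE mulr1.
have p3 : primitive e b [::] (cst (e - s)) (cst 0) by exact: primitive_cst.
have eE : (fun t : R => t - s) e = cst (e - s) e by [].
have p23 := primitive_glue se eb eE p2 p3.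
have sE : cst (0 : R) s = (fun t => if t <= e then t - s else cst (e - s) t) s.
  by rewrite /= se subrr.
have p := primitive_glue as_ (le_trans se eb) sE p1 p23.
have : primitive a b [:: s; e] (ramp s e) (fun t => (s <= t < e)%R%:R).
  apply: primitive_ext p => t _ //= _; rewrite ltNge; have [st|//] := leP s t.
  by have [_|_] := ltP t e.
by apply: primitive_subS => t; rewrite !inE => /orP[/eqP->|/eqP->].
Qed.

End Ramp.

Section NeedleControl.
Context {R : realType} {Y : topologicalType}.
Variables (T : R) (U : set Y) (S : seq R) (u : R -> Y).
Variables (N : nat) (tk : 'I_N -> R) (vk : 'I_N -> Y).
Hypothesis T0 : 0 < T.
Hypothesis u_npc : npc T S U u.
Hypothesis tkT : forall k, 0 <= tk k < T.
Hypothesis vkU : forall k, U (vk k).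
Implicit Types (r t : R) (b : 'I_N -> R) (k : 'I_N).

(* The [k]-th needle has length [r * b k] and is shifted by [k.+1 * r] to the
   right of [tk k], so that needles based at the same point do not overlap. *)
Definition nstart r k : R := tk k + k.+1%:R * r.
Definition nactive r b k t := nstart r k <= t < nstart r k + r * b k.
Definition nchoose (a : pred 'I_N) (ks : seq 'I_N) (w : Y) : Y :=
  foldr (fun k w => if a k then vk k else w) w ks.
Definition nctrl r b t := nchoose (fun k => nactive r b k t) (enum 'I_N) (u t).
Definition nbreaks r b (S' : seq R) : seq R :=
  foldr (fun k S' => [:: nstart r k, nstart r k + r * b k & S']) S' (enum 'I_N).

(** Disjointness, and ending before [T], are asked of needles of full length [r], so that the
    condition is independent of the weights in [[0, 1]]. *)
Definition small r := [/\ 0 < r, forall k, nstart r k + r < T &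
  forall k j t, k != j -> nactive r (fun=> 1) k t -> ~~ nactive r (fun=> 1) j t].

Definition box b := forall k, 0 <= b k <= 1.

Lemma small_near : \forall r \near (0 : R)^'+, small r.
Proof.
have H1 k : \forall r \near (0 : R)^'+, nstart r k + r < T.
  have /andP[_ tT] := tkT k.
  have k0 : 0 < (T - tk k) / (k.+1%:R + 1) by rewrite divr_gt0 ?subr_gt0.
  near=> r; have : r < (T - tk k) / (k.+1%:R + 1) by near: r; exact: nbhs_right_lt.
  by rewrite ltr_pdivlMr// /nstart => ?; lra.
have H2 k j : \forall r \near (0 : R)^'+, k != j ->
    forall t, nactive r (fun=> 1) k t -> ~~ nactive r (fun=> 1) j t.
  have [kj|kj|kj] := ltgtP (tk k) (tk j).
  (* Different base points: the earlier needle ends at most [(k.+1%:R + 1) * r] after its base,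
     hence before the later base point. *)
  - have k0 : 0 < (tk j - tk k) / (k.+1%:R + 1) by rewrite divr_gt0 ?subr_gt0.
    near=> r; move=> _ t /andP[_ tk1]; rewrite negb_and; apply/orP; left.
    have : r < (tk j - tk k) / (k.+1%:R + 1) by near: r; exact: nbhs_right_lt.
    have : 0 < r by near: r; exact: nbhs_right_gt.
    rewrite ltr_pdivlMr// => r0 rk; rewrite -ltNge; apply: lt_le_trans tk1 _.
    rewrite /nstart mulr1; have : 0 <= j.+1%:R * r by rewrite mulr_ge0// ltW.
    lra.
  - have k0 : 0 < (tk k - tk j) / (j.+1%:R + 1) by rewrite divr_gt0 ?subr_gt0.
    near=> r; move=> _ t /andP[kt _]; rewrite negb_and; apply/orP; right.
    have : r < (tk k - tk j) / (j.+1%:R + 1) by near: r; exact: nbhs_right_lt.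
    have : 0 < r by near: r; exact: nbhs_right_gt.
    rewrite ltr_pdivlMr// => r0 rk; rewrite -leNgt; apply: le_trans kt.
    rewrite /nstart mulr1; have : 0 <= k.+1%:R * r by rewrite mulr_ge0// ltW.
    lra.
  (* Same base point: two shifts differ by at least [r], the full length of a needle. *)
  - near=> r; move=> kNj t /andP[kt tk1].
    have r0 : 0 < r by near: r; exact: nbhs_right_gt.
    have [lkj|ljk|/val_inj/eqP] := ltngtP k j; last by rewrite (negPf kNj).
      have : (k.+1%:R + 1) * r <= j.+1%:R * r.
        by rewrite ler_pM2r// -natr1 natr1 natr1 ler_nat.
      move: tk1; rewrite /nactive /nstart kj !mulr1 => tk1 kjr.
      by rewrite negb_and -ltNge; apply/orP; left; lra.
    have : (j.+1%:R + 1) * r <= k.+1%:R * r.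
      by rewrite ler_pM2r// -natr1 natr1 natr1 ler_nat.
    move: kt; rewrite /nactive /nstart kj !mulr1 => kt kjr.
    by rewrite negb_and -!leNgt; apply/orP; right; lra.
have H1' : \forall r \near (0 : R)^'+, forall k, nstart r k + r < T by exact: filter_forall.
have H2' : \forall r \near (0 : R)^'+, forall k j, k != j ->
    forall t, nactive r (fun=> 1) k t -> ~~ nactive r (fun=> 1) j t.
  by apply: filter_forall => k; apply: filter_forall => j; exact: H2.
near=> r; split; first by near: r; exact: nbhs_right_gt.
  by near: r.
move=> k j t kj; move: k j kj t; near: r; exact: H2'.
Unshelve. all: by end_near. Qed.

Lemma nactive1 r b k t : box b -> 0 < r -> nactive r b k t -> nactive r (fun=> 1) k t.
Proof.
move=> bb r0 /andP[kt tk1]; rewrite /nactive kt /=; apply: lt_le_trans tk1 _.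
by rewrite lerD2l ler_pM2l//; case/andP: (bb k).
Qed.

Lemma nchoose_eq (a a' : pred 'I_N) ks w : a =1 a' -> nchoose a ks w = nchoose a' ks w.
Proof. by move=> aa; elim: ks => //= k ks ->; rewrite aa. Qed.

Lemma nchoose_out (a : pred 'I_N) ks w : (forall k, ~~ a k) -> nchoose a ks w = w.
Proof. by move=> H; elim: ks => //= k ks ->; rewrite (negPf (H k)). Qed.

Lemma nchoose_in (a : pred 'I_N) ks w k : k \in ks -> a k ->
  (forall j, j != k -> ~~ a j) -> nchoose a ks w = vk k.
Proof.
move=> + ak H; elim: ks => //= j ks IH; rewrite inE => /predU1P[<-|/IH ->].
  by rewrite ak.
by case: eqVneq (H j) => [->|_ /(_ isT)/negPf ->]; rewrite ?ak.
Qed.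

Lemma nctrl_in r b k t : box b -> small r -> nactive r b k t -> nctrl r b t = vk k.
Proof.
move=> bb [r0 _ dj] kt; apply: nchoose_in; rewrite ?mem_enum//.
move=> j jk; have kj : k != j by rewrite eq_sym.
by apply: contra (dj k j t kj (nactive1 bb r0 kt)); exact: nactive1.
Qed.

Lemma nctrl_out r b t : (forall k, ~~ nactive r b k t) -> nctrl r b t = u t.
Proof. exact: nchoose_out. Qed.

Lemma nstart_gt0 r k : 0 < r -> 0 < nstart r k.
Proof. by move=> r0; rewrite /nstart ltr_wpDl ?mulr_gt0//; case/andP: (tkT k). Qed.

Lemma nend_lt r b k : box b -> small r -> nstart r k + r * b k < T.
Proof.
move=> bb [r0 kT _]; apply: le_lt_trans (kT k); rewrite lerD2l ler_piMr ?(ltW r0)//.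
by case/andP: (bb k).
Qed.

Lemma nctrl_npc r b : box b -> small r -> npc T (nbreaks r b S) U (nctrl r b).
Proof.
move=> bb sr; have [r0 _ _] := sr.
rewrite /nctrl /nbreaks; elim: (enum 'I_N) => [|k ks IH]; first exact: u_npc.
rewrite /=.
have s0 := nstart_gt0 k r0; have eT := nend_lt k bb sr.
have b0 : 0 <= r * b k by rewrite mulr_ge0 ?(ltW r0)//; case/andP: (bb k).
have sT : 0 < nstart r k < T by rewrite s0/= (le_lt_trans _ eT)// lerDl.
have eT' : 0 < nstart r k + r * b k < T by rewrite eT (lt_le_trans s0)// lerDl.
have v_npc S' : npc T S' U (fun=> vk k).
  by apply: npc_continuous => // t; exact: cvg_cst.
have p := npc_switch sT (npc_subS _ IH) (npc_switch eT' (v_npc _) IH).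
have -> : (fun t => if nactive r b k t then vk k else
   nchoose (fun k0 => nactive r b k0 t) ks (u t)) =
  (fun t => if t < nstart r k then nchoose (fun k0 => nactive r b k0 t) ks (u t) else
   if t < nstart r k + r * b k then vk k else nchoose (fun k0 => nactive r b k0 t) ks (u t)).
  by apply/funext => t; rewrite /nactive ltNge; case: leP.
by apply: p => t tS; rewrite inE tS orbT.
Qed.

Lemma nbreaks_sub r b S' : {subset S' <= nbreaks r b S'}.
Proof.
by rewrite /nbreaks; elim: (enum 'I_N) => [|k ks IH] t //= /IH; rewrite !inE => ->; rewrite !orbT.
Qed.

Lemma nstart_breaks r b S' k : nstart r k \in nbreaks r b S'.
Proof.
rewrite /nbreaks; have : k \in enum 'I_N by rewrite mem_enum.
by elim: (enum 'I_N) => //= j ks IH; rewrite !inE => /predU1P[->|/IH ->]; rewrite ?eqxx ?orbT.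
Qed.

Lemma nend_breaks r b S' k : nstart r k + r * b k \in nbreaks r b S'.
Proof.
rewrite /nbreaks; have : k \in enum 'I_N by rewrite mem_enum.
by elim: (enum 'I_N) => //= j ks IH; rewrite !inE => /predU1P[->|/IH ->]; rewrite ?eqxx ?orbT.
Qed.

End NeedleControl.

Section PrimitiveSum.
Context {R : realType} {W : normedModType R}.

Lemma primitive_sum (I : Type) (r : seq I) (a b : R) S (x G : I -> R -> W) :
  (forall i, primitive a b S (x i) (G i)) ->
  primitive a b S (fun t => \sum_(i <- r) x i t) (fun t => \sum_(i <- r) G i t).
Proof.
move=> H; elim: r => [|i r IH].
  by apply: primitive_ext (primitive_cst a b S 0) => t *; rewrite big_nil.
by apply: primitive_ext (primitiveD (H i) IH) => t *; rewrite big_cons.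
Qed.

Lemma primitive_scale (a b : R) S (m dm : R -> R) (x G : R -> W) :
  primitive a b S m dm -> primitive a b S x G ->
  primitive a b S (fun t => m t *: x t) (fun t => dm t *: x t + m t *: G t).
Proof.
move=> [cm dm_] [cx dx]; split; first by move=> t; apply: cvgZ; [exact: cm|exact: cx].
(* The scalar factor is regarded as a moving multiple of the identity operator, so that
   [is_derive_eval] applies. *)
move=> t tab tS; have idb : is_bounded_linear (id : W -> W).
  by split=> [c v w //|]; exists 1 => v; rewrite mul1r.
have idm : (id : W -> W) \in @bounded_linear_pred R W W by rewrite inE.
pose A := BoundedLinear idm.
have dA : is_derive t (1 : R) (fun s => m s *: A) (dm t *: A).
  apply/is_derive_eps => e e0; have A0 : 0 < `|A| + 1 by rewrite ltr_wpDl.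
  have [r r0 H] := (is_derive_eps _ _ _).1 (dm_ t tab tS) _ (divr_gt0 e0 A0).
  exists r => // s /H Hs.
  have -> : m s *: A - m t *: A - (s - t) *: (dm t *: A) =
      (m s - m t - (s - t) *: dm t) *: A by rewrite scalerA -!scalerBl.
  rewrite normrZ; apply: le_trans (ler_wpM2r (normr_ge0 _) Hs) _.
  rewrite mulrAC ler_wpM2r// mulrAC ler_pdivrMr// ler_pM2l// lerDl ler01//.
exact: (is_derive_eval dA (dx t tab tS)).
Qed.

End PrimitiveSum.

Lemma comp_npc (R : realType) (E F : normedModType R) (Y : topologicalType) (T : R)
    (Omega : set E) (U : set Y) (phi : R -> E -> Y -> F) S x u : 0 < T ->
  {within `[0, T]%classic `*` Omega `*` U,
    continuous (fun w : R * E * Y => phi w.1.1 w.1.2 w.2)} ->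
  {within `[0, T], continuous x} -> (forall t, 0 <= t <= T -> Omega (x t)) ->
  npc T S U u -> npc T S setT (fun t => phi t (x t) (u t)).
Proof.
move=> T0 cphi cx xO nu.
have idn : npc T S `[0, T]%classic (@id R).
  by apply: npc_continuous => //; apply: continuous_subspaceT => t; exact: cvg_id.
have xn : npc T S Omega x by exact: npc_continuous.
exact: (npc_comp (V := setT) T0 cphi _ (npc_pair (npc_pair idn xn) nu)).
Qed.

(** * Trajectories of needle controls *)

Section Variation.
Context {R : realType} {E : completeNormedModType R} {Y : topologicalType}.
Variables (T : R) (Omega : set E) (U : set Y) (f : R -> E -> Y -> E).
Variables (x0 : R -> E) (u0 : R -> Y) (S0 : seq R).
Variables (N : nat) (tk : 'I_N -> R) (vk : 'I_N -> Y).
Hypothesis T0 : 0 < T.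
Hypothesis x0O : forall t, 0 <= t <= T -> Omega (x0 t).
Hypothesis u0n : npc T S0 U u0.
Hypothesis x0p : primitive 0 T S0 x0 (fun t => f t (x0 t) (u0 t)).
Hypothesis tkT : forall k, 0 <= tk k < T.
Hypothesis vkU : forall k, U (vk k).

Definition uses t w := w = u0 t \/ exists k, w = vk k.
Definition tube_lip {F : normedModType R} (d L : R) (phi : R -> E -> Y -> F) :=
  forall t w xi xi', 0 <= t <= T -> uses t w -> `|xi - x0 t| < d -> `|xi' - x0 t| < d ->
    `|phi t xi w - phi t xi' w| <= L * `|xi - xi'|.

Variables (d L C0 : R).
Hypothesis d0 : 0 < d.
Hypothesis L0 : 0 <= L.
Hypothesis C00 : 0 <= C0.
Hypothesis fc : {within `[0, T]%classic `*` Omega `*` U,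
  continuous (fun w : R * E * Y => f w.1.1 w.1.2 w.2)}.
Hypothesis HO : forall t xi, 0 <= t <= T -> `|xi - x0 t| < d -> Omega xi.
Hypothesis HL : tube_lip d L f.
Hypothesis HC : forall t k, 0 <= t <= T ->
  `|f t (x0 t) (vk k) - f t (x0 t) (u0 t)| <= C0.

Implicit Types (r t : R) (b : 'I_N -> R) (k : 'I_N).
Local Notation nctrl := (nctrl u0 tk vk).
Local Notation nbreaks r b := (nbreaks tk r b S0).
Local Notation small := (small T tk).

Let x0c : {within `[0, T], continuous x0}. Proof. by case: x0p. Qed.

Lemma nctrl_uses r b t : uses t (nctrl r b t).
Proof.
rewrite /nctrl /nchoose; elim: (enum 'I_N) => [|k ks IH] /=; first by left.
by case: ifP => // _; right; exists k.
Qed.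

Let d2 : 0 < d / 2. Proof. by rewrite divr_gt0. Qed.
(* Projecting the state on a tube around [x0] makes the dynamics globally
   Lipschitz; trajectories that stay in the tube are not affected. *)
Let pt t xi : E := x0 t + clip (d / 2) (xi - x0 t).

Let pt_ball t xi : `|pt t xi - x0 t| < d.
Proof.
have -> : pt t xi - x0 t = clip (d / 2) (xi - x0 t) by rewrite /pt; zmod.
apply: le_lt_trans (clip_norm d2 _) _.
by rewrite ltr_pdivrMr// ltr_pMr// ltr1n.
Qed.

Let x0_ball t : `|x0 t - x0 t| < d. Proof. by rewrite subrr normr0. Qed.

Let pt_lip t xi xi' : `|pt t xi - pt t xi'| <= 2 * `|xi - xi'|.
Proof.
rewrite /pt; have -> : x0 t + clip (d / 2) (xi - x0 t) - (x0 t + clip (d / 2) (xi' - x0 t)) =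
  clip (d / 2) (xi - x0 t) - clip (d / 2) (xi' - x0 t) by zmod.
apply: le_trans (clip_lipschitz d2 _ _) _; rewrite ler_pM2l//.
by have -> : xi - x0 t - (xi' - x0 t) = xi - xi' by zmod.
Qed.

Let pt_x0 t : pt t (x0 t) = x0 t.
Proof. by rewrite /pt subrr clip_id ?normr0 ?addr0// ltW. Qed.

Let pt_id t xi : `|xi - x0 t| <= d / 2 -> pt t xi = xi.
Proof. by move=> H; rewrite /pt clip_id//; zmod. Qed.

Let pt_continuous x : {within `[0, T], continuous x} ->
  {within `[0, T], continuous (fun t => pt t (x t))}.
Proof.
move=> cx.
have cxx : {within `[0, T], continuous (fun t => x t - x0 t)}.
  by move=> t; apply: cvgB; [exact: cx|exact: x0c].
have cc : continuous (clip (d / 2) : E -> E).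
  move=> v; apply/cvgrPdist_lt => e e0.
  apply/nbhs_ballP; exists (e / 2); first by rewrite /= divr_gt0.
  move=> w; rewrite -ball_normE /ball_/= => vw.
  apply: le_lt_trans (clip_lipschitz d2 _ _) _; by rewrite mulrC -ltr_pdivlMr.
move=> t; apply: cvgD; first exact: x0c.
exact: (@continuous_comp (subspace _) _ _ (fun t => x t - x0 t) (clip (d / 2)) t (cxx t) (cc _)).
Qed.

Lemma traj_exists r b : box b -> small r -> exists x, x 0 = x0 0 /\
  primitive 0 T (nbreaks r b) x (fun t => f t (pt t (x t)) (nctrl r b t)).
Proof.
move=> bb sr; have nn := nctrl_npc T0 u0n tkT vkU bb sr.
apply: (ode_exists (L := L * 2) (F := fun t xi => f t (pt t xi) (nctrl r b t))).
- exact: ltW.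
- by rewrite mulr_ge0.
- move=> t v w /andP[t0 tT] _; have tT' : 0 <= t <= T by rewrite !ltW.
  apply: le_trans (HL tT' (nctrl_uses _ _ _) (pt_ball _ _) (pt_ball _ _)) _.
  by rewrite -mulrA ler_wpM2l.
- move=> x cx.
  by have [] := comp_npc T0 fc (pt_continuous cx) (fun t tT => HO tT (pt_ball t (x t))) nn.
Qed.

Definition traj r b : R -> E := get [set x | x 0 = x0 0 /\
  primitive 0 T (nbreaks r b) x (fun t => f t (pt t (x t)) (nctrl r b t))].

Lemma trajP r b : box b -> small r -> traj r b 0 = x0 0 /\
  primitive 0 T (nbreaks r b) (traj r b) (fun t => f t (pt t (traj r b t)) (nctrl r b t)).
Proof. by move=> bb sr; exact: (getPex (traj_exists bb sr)). Qed.

Let act_sum r b t k : nactive tk r b k t -> (1 : R) <= \sum_k (nactive tk r b k t)%:R.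
Proof. by move=> kt; rewrite (bigD1 k)//= kt lerDl sumr_ge0. Qed.

Let fdiff r b t : box b -> small r -> 0 <= t <= T ->
  `|f t (x0 t) (nctrl r b t) - f t (x0 t) (u0 t)| <=
    C0 * \sum_k (nactive tk r b k t)%:R.
Proof.
move=> bb sr tT; have [/existsP[k kt]|/existsPn H] := boolP [exists k, nactive tk r b k t].
  rewrite (nctrl_in u0 vk bb sr kt); apply: le_trans (HC k tT) _.
  by rewrite -[leLHS]mulr1 ler_wpM2l// (act_sum kt).
rewrite (nctrl_out u0 vk H) subrr normr0 mulr_ge0// sumr_ge0//.
Qed.

(** Compared with [u0], the needle control causes a velocity error of at most [C0] during a total
    time of at most [N * r], and Gronwall propagates it. The rate is [2 * L] because [pt] is
    2-Lipschitz in the state. *)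
Lemma traj_close : exists2 K, 0 <= K & forall r b t, box b -> small r -> 0 <= t <= T ->
  `|traj r b t - x0 t| <= K * r.
Proof.
exists (expR (2 * L * T) * (C0 * N%:R)); first by rewrite !mulr_ge0// expR_ge0.
move=> r b t bb sr /andP[t0 tT]; have [traj0 px] := trajP bb sr; have [r0 _ _] := sr.
have rb k : 0 <= r * b k by rewrite mulr_ge0 ?(ltW r0)//; case/andP: (bb k).
have pw := primitiveB px (primitive_subS (@nbreaks_sub _ _ tk r b S0) x0p).
pose phi s := C0 * \sum_k ramp (nstart tk r k) (nstart tk r k + r * b k) s.
have pphi : primitive 0 T (nbreaks r b) phi (fun s => C0 * \sum_k (nactive tk r b k s)%:R).
  apply: primitiveZ; apply: primitive_sum => k; apply: primitive_ramp.
  - by rewrite ltW// (nstart_gt0 tkT).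
  - by rewrite lerDl.
  - by rewrite ltW// (nend_lt _ bb sr).
  - exact: nstart_breaks.
  - exact: nend_breaks.
have := gronwall (L := 2 * L) t0 _ (primitive_sub (lexx 0) tT pw) (primitive_sub (lexx 0) tT pphi).
rewrite traj0 subrr normr0 add0r subr0 => H; apply: le_trans (H _ _) _.
- by rewrite mulr_ge0.
- move=> s /andP[s0 st] _; have sT : 0 <= s <= T by rewrite !ltW// (lt_le_trans st).
  split; first by rewrite mulr_ge0// sumr_ge0.
  set u := nctrl r b s; rewrite -(subrKA (f s (x0 s) u)) (le_trans (ler_normD _ _))// lerD//.
    apply: le_trans (HL sT (nctrl_uses _ _ _) (pt_ball _ _) (x0_ball _)) _.
    have := pt_lip s (traj r b s) (x0 s); rewrite pt_x0 => /(ler_wpM2l L0).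
    by rewrite mulrA (mulrC L 2).
  exact: fdiff.
have phi0 : phi 0 = 0.
  rewrite /phi big1 ?mulr0// => k _; rewrite ramp0//.
  by rewrite ltW// (nstart_gt0 tkT).
rewrite phi0 subr0 -!mulrA; apply: ler_pM; rewrite ?expR_ge0//.
- by rewrite mulr_ge0// sumr_ge0// => k _; apply: ramp_ge0; rewrite lerDl.
- by rewrite ler_expR ler_pM2l// ler_wpM2l.
rewrite ler_wpM2l// mulr_natl -[X in _ *+ X]card_ord -sumr_const; apply: ler_sum => k _.
apply: le_trans (ramp_le _ _) _; rewrite ?lerDl// addrC addKr.
by rewrite ler_piMr ?(ltW r0)//; case/andP: (bb k).
Qed.

(** The two controls differ only between the two end points of a same needle, so on a set of length
    at most [r] times the sum of the weight differences. This provides the continuity in the weights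
    that the Poincare-Miranda theorem requires. *)
Lemma traj_cont : exists2 K, 0 <= K & forall r b b' t, box b -> box b' -> small r ->
  0 <= t <= T -> `|traj r b t - traj r b' t| <= K * (r * \sum_k `|b k - b' k|).
Proof.
(* Each of the two velocities is within [L * d + C0] of [f s (x0 s) (u0 s)]. *)
pose C1 := L * d + C0 + (C0 + L * d).
have C10 : 0 <= C1 by rewrite !addr_ge0// mulr_ge0// ltW.
exists (expR (2 * L * T) * C1); first by rewrite mulr_ge0// expR_ge0.
move=> r b b' t bb bb' sr /andP[t0 tT].
have [traj0 px] := trajP bb sr; have [traj0' px'] := trajP bb' sr; have [r0 _ _] := sr.
pose S := nbreaks r b ++ nbreaks r b'.
have S1 : {subset nbreaks r b <= S} by move=> s; rewrite mem_cat => ->.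
have S2 : {subset nbreaks r b' <= S} by move=> s; rewrite mem_cat orbC => ->.
have pw := primitiveB (primitive_subS S1 px) (primitive_subS S2 px').
pose en (b : 'I_N -> R) k := nstart tk r k + r * b k.
pose lo k := Num.min (en b k) (en b' k); pose hi k := Num.max (en b k) (en b' k).
have lohi k : lo k <= hi k by rewrite /lo /hi ge_min le_max lexx.
pose phi s := C1 * \sum_k ramp (lo k) (hi k) s.
have bge c k : box c -> 0 <= r * c k.
  by move=> bc; rewrite mulr_ge0 ?(ltW r0)//; case/andP: (bc k).
have lo0 k : 0 <= lo k.
  by have s0 := ltW (nstart_gt0 tkT k r0); rewrite /lo le_min /en !(addr_ge0 s0) ?bge.
have pphi : primitive 0 T S phi (fun s => C1 * \sum_k (lo k <= s < hi k)%R%:R).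
  apply: primitiveZ; apply: primitive_sum => k; apply: primitive_ramp => //.
  - by rewrite /hi ge_max !ltW// (nend_lt _ _ sr).
  - rewrite /lo; case: leP => _; first by apply: S1; exact: nend_breaks.
    by apply: S2; exact: nend_breaks.
  - rewrite /hi; case: leP => _; last by apply: S1; exact: nend_breaks.
    by apply: S2; exact: nend_breaks.
have := gronwall (L := 2 * L) t0 _ (primitive_sub (lexx 0) tT pw) (primitive_sub (lexx 0) tT pphi).
rewrite traj0 traj0' subrr normr0 add0r subr0 => H; apply: le_trans (H _ _) _.
- by rewrite mulr_ge0.
- move=> s /andP[s0 st] _; have sT : 0 <= s <= T by rewrite !ltW// (lt_le_trans st).
  split; first by rewrite mulr_ge0// sumr_ge0.
  have [/existsP[k kt]|/existsPn same] := boolP [exists k, (lo k <= s < hi k)].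
    have : (1 : R) <= \sum_k (lo k <= s < hi k)%R%:R.
      by rewrite (bigD1 k)//= kt lerDl sumr_ge0.
    move=> /(ler_wpM2l C10); rewrite mulr1 => H1.
    have far c : box c -> `|f s (pt s (traj r c s)) (nctrl r c s) - f s (x0 s) (u0 s)|
        <= L * d + C0.
      move=> bc; rewrite -(subrKA (f s (x0 s) (nctrl r c s))) (le_trans (ler_normD _ _))//.
      apply: lerD.
        apply: le_trans (HL sT (nctrl_uses _ _ _) (pt_ball _ _) (x0_ball _)) _.
        by rewrite ler_wpM2l// ltW// pt_ball.
      have [->|[j ->]] := nctrl_uses r c s; first by rewrite subrr normr0.
      exact: HC.
    have : `|f s (pt s (traj r b s)) (nctrl r b s) - f s (pt s (traj r b' s)) (nctrl r b' s)| <= C1.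
      rewrite -(subrKA (f s (x0 s) (u0 s))) (le_trans (ler_normD _ _))// lerD ?far//.
      by rewrite distrC (addrC C0) far.
    have : 0 <= 2 * L * `|traj r b s - traj r b' s| by rewrite !mulr_ge0.
    lra.
  (* Outside the intervals from [lo k] to [hi k], each needle is active for [b] exactly when it is
     active for [b']. *)
  have -> : nctrl r b s = nctrl r b' s.
    apply: nchoose_eq => k; rewrite /nactive; congr (_ && _).
    have := same k; rewrite /lo /hi -[nstart tk r k + r * b k]/(en b k) -[_ + r * b' k]/(en b' k).
    have [H1|H1] := leP (en b k) (en b' k); rewrite negb_and -ltNge -leNgt => /orP[H2|H2].
    - by rewrite H2 (lt_le_trans H2 H1).
    - by rewrite ltNge (le_trans H1 H2) ltNge H2.
    - by rewrite H2 (lt_trans H2 H1).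
    - by rewrite ltNge H2 ltNge (le_trans (ltW H1) H2).
  rewrite -[leLHS]addr0 lerD//; last by rewrite mulr_ge0// sumr_ge0.
  apply: le_trans (HL sT (nctrl_uses _ _ _) (pt_ball _ _) (pt_ball _ _)) _.
  by rewrite (mulrC 2) -mulrA ler_wpM2l//; exact: pt_lip.
have phi0 : phi 0 = 0 by rewrite /phi big1 ?mulr0// => k _; rewrite ramp0.
rewrite phi0 subr0 -!mulrA; apply: ler_pM; rewrite ?expR_ge0//.
- by rewrite mulr_ge0// sumr_ge0// => k _; exact: ramp_ge0.
- by rewrite ler_expR ler_pM2l// ler_wpM2l.
rewrite ler_wpM2l// mulr_sumr; apply: ler_sum => k _.
apply: le_trans (ramp_le _ _) _ => //.
have -> : r * `|b k - b' k| = `|en b k - en b' k|.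
  by rewrite -{1}(gtr0_norm r0) -normrM /en; congr (`|_|); ring.
rewrite /lo /hi; have [H1|H1] := leP (en b k) (en b' k).
  by rewrite ler0_norm ?subr_le0// opprB.
by rewrite ger0_norm// subr_ge0 ltW.
Qed.

Lemma traj_sol r b : box b -> small r ->
  (forall t, 0 <= t <= T -> `|traj r b t - x0 t| <= d / 2) ->
  primitive 0 T (nbreaks r b) (traj r b) (fun t => f t (traj r b t) (nctrl r b t)).
Proof.
move=> bb sr H; have [_ p] := trajP bb sr; apply: primitive_ext p => // t /andP[t0 tT] _.
by rewrite pt_id// H// !ltW.
Qed.

End Variation.

Section PcontAlgebra.
Context {R : realType}.
Implicit Types (a b : R) (S : seq R).

Lemma pcont_map (W Z : topologicalType) a b S (Phi : W -> Z) G :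
  continuous Phi -> pcont a b S setT G -> pcont a b S setT (fun t => Phi (G t)).
Proof. by move=> cPhi; apply: pcont_comp => //; exact: continuous_subspaceT. Qed.

Lemma pcont_map2 (W W' Z : topologicalType) a b S (Phi : W * W' -> Z) G G' :
  continuous Phi -> pcont a b S setT G -> pcont a b S setT G' ->
  pcont a b S setT (fun t => Phi (G t, G' t)).
Proof.
move=> cPhi pG pG'; have := pcont_pair pG pG'; rewrite setXTT.
exact: pcont_map.
Qed.

Lemma pcontB (W : normedModType R) a b S (G G' : R -> W) :
  pcont a b S setT G -> pcont a b S setT G' -> pcont a b S setT (fun t => G t - G' t).
Proof.
apply: (pcont_map2 (Phi := fun w : W * W => w.1 - w.2)).
by move=> [v w]; apply: cvgB; [exact: cvg_fst|exact: cvg_snd].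
Qed.

Lemma pcontD (W : normedModType R) a b S (G G' : R -> W) :
  pcont a b S setT G -> pcont a b S setT G' -> pcont a b S setT (fun t => G t + G' t).
Proof.
apply: (pcont_map2 (Phi := fun w : W * W => w.1 + w.2)).
by move=> [v w]; apply: cvgD; [exact: cvg_fst|exact: cvg_snd].
Qed.

Lemma pcont_norm (W : normedModType R) a b S (G : R -> W) :
  pcont a b S setT G -> pcont a b S setT (fun t => `|G t|).
Proof. by apply: (pcont_map (Phi := fun w : W => `|w|)) => w; exact: norm_continuous. Qed.

Lemma pcontZ (W : normedModType R) a b S (k : R) (G : R -> W) :
  pcont a b S setT G -> pcont a b S setT (fun t => k *: G t).
Proof.
by apply: (pcont_map (Phi := fun w : W => k *: w)) => w; apply: cvgZr; exact: cvg_id.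
Qed.

Lemma pcont_eval (X W : normedModType R) a b S (B : R -> bounded_linear X W) (x : R -> X) :
  pcont a b S setT B -> pcont a b S setT x -> pcont a b S setT (fun t => B t (x t)).
Proof. exact: (pcont_map2 (@bl_eval_continuous R X W)). Qed.

Lemma primitive_le a b S (phi psi : R -> R) : a <= b -> primitive a b S phi psi ->
  (forall t, a < t < b -> 0 <= psi t) -> phi a <= phi b.
Proof.
move=> ab p psi0; rewrite -subr_ge0.
apply: le_trans (mvt_norm ab (primitive_cst a b S (0 : R)) p _) => //.
by move=> t tab _; rewrite normr0; exact: psi0.
Qed.

End PcontAlgebra.

Lemma cvg_sumr (R : realType) (V : normedModType R) (I : Type) (r : seq I)
    (u : I -> nat -> V) (l : I -> V) : (forall i, u i @ \oo --> l i) ->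
  (fun n => \sum_(i <- r) u i n) @ \oo --> \sum_(i <- r) l i.
Proof.
move=> ul; elim: r => [|i r IH].
  by rewrite big_nil; under eq_fun do rewrite big_nil; exact: cvg_cst.
by rewrite big_cons; under eq_fun do rewrite big_cons; exact: cvgD.
Qed.

(** * First-order expansion along a sequence of needle variations *)

Section VariationLimit.
Context {R : realType} {E : completeNormedModType R} {Y : topologicalType}.
Variables (T : R) (Omega : set E) (U : set Y).
Variables (x0 : R -> E) (u0 : R -> Y) (S0 : seq R).
Variables (N : nat) (tk : 'I_N -> R) (vk : 'I_N -> Y).
Hypothesis T0 : 0 < T.
Hypothesis x0O : forall t, 0 <= t <= T -> Omega (x0 t).
Hypothesis x0c : {within `[0, T], continuous x0}.
Hypothesis u0n : npc T S0 U u0.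
Hypothesis tkT : forall k, 0 <= tk k < T.
Hypothesis vkU : forall k, U (vk k).
Variables (r_ : nat -> R) (b_ : nat -> 'I_N -> R) (x_ : nat -> R -> E) (d K : R).
Hypothesis r_small : forall n, small T tk (r_ n).
Hypothesis b_box : forall n, box (b_ n).
Hypothesis r_cvg : r_ @ \oo --> (0 : R).
Hypothesis d0 : 0 < d.
Hypothesis K0 : 0 <= K.
Hypothesis x_c : forall n, {within `[0, T], continuous (x_ n)}.
Hypothesis x_O : forall n t, 0 <= t <= T -> Omega (x_ n t).
Hypothesis x_K : forall n t, 0 <= t <= T -> `|x_ n t - x0 t| <= K * r_ n.
Hypothesis x_d : forall n t, 0 <= t <= T -> `|x_ n t - x0 t| < d.

Implicit Types (n : nat) (t : R) (k : 'I_N).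
Let u_ n := nctrl u0 tk vk (r_ n) (b_ n).
Let S_ n := nbreaks tk (r_ n) (b_ n) S0.
Let act n k t := nactive tk (r_ n) (b_ n) k t.
Let s_ n k := nstart tk (r_ n) k.
Let rmp n k t : R := ramp (s_ n k) (s_ n k + r_ n * b_ n k) t.

Let r0 n : 0 < r_ n. Proof. by case: (r_small n). Qed.
Let rV0 n : 0 <= (r_ n)^-1. Proof. by rewrite invr_ge0 ltW. Qed.
Let rb0 n k : 0 <= r_ n * b_ n k.
Proof. by rewrite mulr_ge0 ?(ltW (r0 n))//; case/andP: (b_box n k). Qed.

(* The first-order remainder of [y n - y0]: [rmp n k t] is the time spent by the
   [k]-th needle before [t], hence [r_ n * b_ n k] once the needle is over. *)
Definition var_rem {F : normedModType R} (y : nat -> R -> F) (y0 : R -> F)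
    (zeta : 'I_N -> R -> F) n t : F :=
  (r_ n)^-1 *: (y n t - y0 t) - \sum_k ((r_ n)^-1 * rmp n k t) *: zeta k t.

Section Output.
Variables (F : normedModType R) (phi : R -> E -> Y -> F) (L : R).
Variables (B : R -> bounded_linear E F) (z : 'I_N -> R -> E) (zeta : 'I_N -> R -> F).
Variables (y : nat -> R -> F) (y0 : R -> F).
Hypothesis L0 : 0 <= L.
Hypothesis phic : {within `[0, T]%classic `*` Omega `*` U,
  continuous (fun w : R * E * Y => phi w.1.1 w.1.2 w.2)}.
Hypothesis phiL : tube_lip T x0 u0 vk d L phi.
Hypothesis Bc : pcont 0 T S0 setT B.
Hypothesis phiD : forall t, 0 <= t <= T -> forall e, 0 < e -> exists2 r, 0 < r &
  forall xi, `|xi - x0 t| < r ->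
    `|phi t xi (u0 t) - phi t (x0 t) (u0 t) - B t (xi - x0 t)| <= e * `|xi - x0 t|.
Hypothesis zetap : forall k,
  primitive 0 T (tk k :: S0) (zeta k) (fun t => if t < tk k then 0 else B t (z k t)).
Hypothesis zeta0 : forall k, zeta k (tk k) =
  phi (tk k) (x0 (tk k)) (vk k) - phi (tk k) (x0 (tk k)) (u0 (tk k)).
Hypothesis yp : forall n, primitive 0 T (S_ n) (y n) (fun t => phi t (x_ n t) (u_ n t)).
Hypothesis y0p : primitive 0 T S0 y0 (fun t => phi t (x0 t) (u0 t)).
Hypothesis y_y0 : forall n, y n 0 = y0 0.

Let u_npc n : npc T (S_ n) U (u_ n).
Proof. exact: nctrl_npc. Qed.

Let SS n : {subset S0 <= S_ n}. Proof. exact: nbreaks_sub. Qed.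

Let rho n t := (r_ n)^-1 *
  `|phi t (x_ n t) (u_ n t) - phi t (x0 t) (u_ n t) - B t (x_ n t - x0 t)|.

Let rho_pcont n : pcont 0 T (S_ n) setT (rho n).
Proof.
have [p1 _ _] := comp_npc T0 phic (@x_c n) (x_O n) (u_npc n).
have [p2 _ _] := comp_npc T0 phic x0c x0O (u_npc n).
have p3 : pcont 0 T (S_ n) setT (fun t => x_ n t - x0 t).
  by apply: pcont_continuous => // t; apply: cvgB; [exact: x_c|exact: x0c].
exact: (pcontZ _ (pcont_norm (pcontB (pcontB p1 p2) (pcont_eval (pcont_subS (@SS n) Bc) p3)))).
Qed.

Let x0d t : `|x0 t - x0 t| < d. Proof. by rewrite subrr normr0. Qed.

Let r_lt e : 0 < e -> \forall n \near \oo, r_ n < e.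
Proof.
move=> e0; have /cvgrPdist_lt/(_ e e0) := r_cvg; apply: filterS => n.
by rewrite sub0r normrN gtr0_norm.
Qed.

(** Needles shrink to their base points and, being shifted to the right, never contain them; so at
    each fixed time the perturbed control is eventually [u0 t]. *)
Let inactive t : \forall n \near \oo, forall k, ~~ act n k t.
Proof.
apply: filter_forall => k; have [tt|tt] := leP t (tk k).
  apply: nearW => n; rewrite /act /nactive negb_and -ltNge; apply/orP; left.
  by apply: le_lt_trans tt _; rewrite ltrDl mulr_gt0.
have k0 : 0 < (t - tk k) / (k.+1%:R + 1) by rewrite divr_gt0 ?subr_gt0// addr_gt0.
apply: filterS (r_lt k0) => n; rewrite ltr_pdivlMr ?addr_gt0// => rn.
rewrite /act /nactive negb_and -leNgt; apply/orP; right; rewrite /nstart.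
have : r_ n * b_ n k <= r_ n * 1.
  by apply: ler_wpM2l; [exact: ltW|case/andP: (b_box n k)].
lra.
Qed.

(** [rho] is bounded through the Lipschitz constant and the bound of [B]. It tends to 0 at each
    time, because the control is eventually [u0 t] and [phi] is differentiable at [x0 t]; this is
    not uniform in time, whence dominated convergence. *)
Let rho_cvg : exists P : nat -> R -> R, [/\ forall n, P n 0 = 0,
  forall n, primitive 0 T (S_ n) (P n) (rho n) & (fun n => P n T) @ \oo --> (0 : R)].
Proof.
have /choice[P HP] : forall n, exists P, P 0 = 0 /\ primitive 0 T (S_ n) P (rho n).
  by move=> n; apply: pcont_primitive (rho_pcont n); exact: ltW.
exists P; split; [by move=> n; case: (HP n)|by move=> n; case: (HP n)|].
have [M M0 BM] := pcont_bounded (ltW T0) Bc.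
have scaled n (A c : R) : 0 <= c -> A <= c * (K * r_ n) -> (r_ n)^-1 * A <= c * K.
  by move=> c0 H; rewrite ler_pdivrMl// mulrC -mulrA.
apply: (dominated_primitive (M := (L + M) * K) T0 rho_pcont) => [n|n|n t tT|t tT].
- by case: (HP n).
- by case: (HP n).
- rewrite ger0_norm; last by rewrite mulr_ge0.
  apply: scaled; first by rewrite addr_ge0.
  rewrite (le_trans (ler_normB _ _))// mulrDl lerD//.
    apply: le_trans (phiL tT (nctrl_uses _ _ _ _ _ _) (x_d n tT) (x0d t)) _.
    by rewrite ler_wpM2l// x_K.
  by apply: le_trans (bl_le _ _) _; rewrite ler_pM ?BM ?x_K.
- apply/cvgrPdist_le => e e0.
  have K1 : 0 < K + 1 by rewrite ltr_wpDl.
  have eK : 0 < e / (K + 1) by rewrite divr_gt0.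
  have [q q0 Hq] := phiD tT eK.
  near=> n; rewrite sub0r normrN ger0_norm; last by rewrite mulr_ge0.
  have un : u_ n t = u0 t by apply: nctrl_out; near: n; exact: inactive.
  have xq : `|x_ n t - x0 t| < q.
    apply: le_lt_trans (x_K n tT) _; apply: (@le_lt_trans _ _ ((K + 1) * r_ n)).
      by rewrite ler_wpM2r ?(ltW (r0 n))// lerDl.
    rewrite mulrC -ltr_pdivlMr//; near: n; apply: r_lt; exact: divr_gt0.
  apply: (@le_trans _ _ (e / (K + 1) * K)).
    apply: scaled; first exact: ltW.
    rewrite un; apply: le_trans (Hq _ xq) _; rewrite ler_wpM2l ?x_K//.
    exact: ltW.
  by rewrite mulrAC ler_pdivrMr// ler_pM2l// lerDl.
Unshelve. all: by end_near. Qed.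

(** The jump of [phi] and [zeta k] coincide at [tk k] and are both right continuous there, while the
    needle lies in an interval shrinking to [tk k] from the right. *)
Let zeta_close e : 0 < e -> \forall n \near \oo, forall k t, act n k t ->
  `|phi t (x0 t) (vk k) - phi t (x0 t) (u0 t) - zeta k t| <= e.
Proof.
move=> e0; apply: filter_forall => k.
have vn : npc T S0 U (fun=> vk k).
  by apply: npc_continuous => // t; exact: cvg_cst.
have [_ p1 _] := comp_npc T0 phic x0c x0O vn.
have [_ p2 _] := comp_npc T0 phic x0c x0O u0n.
have [zc _] := zetap k.
have p3 := within_continuous_cvg_right zc (tkT k).
have H : (fun t => phi t (x0 t) (vk k) - phi t (x0 t) (u0 t) - zeta k t) @ (tk k)^'+ --> (0 : F).
  rewrite -(subrr (zeta k (tk k))) {1}zeta0.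
  by apply: cvgB p3; apply: cvgB; [exact: p1 (tkT k)|exact: p2 (tkT k)].
have [q q0 Hq] := cvg_right_eps H e0.
have q2 : 0 < q / (k.+1%:R + 1) by rewrite divr_gt0// addr_gt0.
apply: filterS (r_lt q2) => n; rewrite ltr_pdivlMr ?addr_gt0// => rn t /andP[st te].
have := Hq t; rewrite subr0; apply.
have : r_ n * b_ n k <= r_ n * 1.
  by apply: ler_wpM2l; [exact: ltW|case/andP: (b_box n k)].
move: st te; rewrite /nstart; have : 0 < k.+1%:R * r_ n by rewrite mulr_gt0.
by move=> *; apply/andP; split; lra.
Qed.

Let S'_ n := [seq tk k | k <- enum 'I_N] ++ S_ n.
Let S'S n : {subset S_ n <= S'_ n}. Proof. by move=> t tS; rewrite mem_cat tS orbT. Qed.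

Let rmp_prim n k : primitive 0 T (S'_ n) (rmp n k) (fun t => (act n k t)%:R).
Proof.
apply: primitive_subS (@S'S n) _; apply: primitive_ramp.
- by rewrite ltW// (nstart_gt0 tkT).
- by rewrite lerDl.
- by rewrite ltW// (nend_lt _ (b_box n) (r_small n)).
- exact: nstart_breaks.
- exact: nend_breaks.
Qed.

Lemma var_rem0 n : var_rem y y0 zeta n 0 = 0.
Proof.
rewrite /var_rem y_y0 subrr scaler0 big1 ?subr0// => k _.
by rewrite /rmp ramp0 ?mulr0 ?scale0r// ltW// (nstart_gt0 tkT).
Qed.

(** The defect has two sources: the linearization error [rho] and, while needle [k] is active, the
    mismatch between the actual jump and [zeta k]. Divided by [r_ n], the active times integrate to
    at most [N], so each source contributes at most [e / 2]. *)
Lemma var_deriv (e : R) : 0 < e -> \forall n \near \oo, exists S' D (psi Psi : R -> R),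
  [/\ primitive 0 T S' (var_rem y y0 zeta n) D, primitive 0 T S' Psi psi,
     forall t, 0 < t < T -> 0 <= psi t /\ `|D t - B t (var_rem x_ x0 z n t)| <= psi t &
     Psi T - Psi 0 <= e].
Proof.
move=> e0; have [P [P0 Pp PT]] := rho_cvg.
have N1 : (0 : R) < N%:R + 1 by rewrite ltr_wpDl.
have e2 : 0 < e / 2 / (N%:R + 1) by rewrite !divr_gt0.
have e20 : 0 < e / 2 by rewrite divr_gt0.
have PTe0 : \forall n \near \oo, `|0 - P n T| <= e / 2.
  by have /cvgrPdist_le := PT; apply.
apply: filterS (filterI (zeta_close e2) PTe0) => n [close]; rewrite sub0r normrN => PTe.
pose psi t := rho n t + e / 2 / (N%:R + 1) * ((r_ n)^-1 * \sum_k (act n k t)%:R).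
pose Psi t := P n t + e / 2 / (N%:R + 1) * ((r_ n)^-1 * \sum_k rmp n k t).
pose G k t := if t < tk k then 0 else B t (z k t).
pose D t := (r_ n)^-1 *: (phi t (x_ n t) (u_ n t) - phi t (x0 t) (u0 t)) -
  \sum_k (((r_ n)^-1 * (act n k t)%:R) *: zeta k t + ((r_ n)^-1 * rmp n k t) *: G k t).
exists (S'_ n), D, psi, Psi; split.
- apply: primitiveB.
    apply: primitiveZ; apply: primitiveB.
      exact: primitive_subS (@S'S n) (yp n).
    apply: primitive_subS y0p => t tS; apply: S'S; exact: SS.
  apply: primitive_sum => k; apply: primitive_scale; first exact: primitiveZ (rmp_prim n k).
  apply: primitive_subS (zetap k) => t; rewrite inE => /predU1P[->|tS].
    by rewrite mem_cat map_f// mem_enum.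
  by apply: S'S; exact: SS.
- apply: primitiveD; first exact: primitive_subS (@S'S n) (Pp n).
  by do 2 apply: primitiveZ; apply: primitive_sum => k; exact: rmp_prim.
- move=> t /andP[t0 tT]; have tT' : 0 <= t <= T by rewrite !ltW.
  have sum0 : 0 <= (r_ n)^-1 * \sum_k (act n k t)%:R by rewrite mulr_ge0// sumr_ge0.
  split; first by rewrite addr_ge0// mulr_ge0// ltW.
  (* Before [tk k] the ramp vanishes, so the cutoff in [G] disappears once multiplied by it. *)
  have rG k : (rmp n k t) *: G k t = (rmp n k t) *: B t (z k t).
    rewrite /G; case: ltP => // ttk; rewrite /rmp ramp0 ?scale0r//.
    by rewrite ltW// (lt_trans ttk)// ltrDl mulr_gt0.
  have -> : D t - B t (var_rem x_ x0 z n t) =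
      (r_ n)^-1 *: (phi t (x_ n t) (u_ n t) - phi t (x0 t) (u_ n t) - B t (x_ n t - x0 t)) +
      (r_ n)^-1 *: (phi t (x0 t) (u_ n t) - phi t (x0 t) (u0 t) -
         \sum_k (act n k t)%:R *: zeta k t).
    have -> : B t (var_rem x_ x0 z n t) = (r_ n)^-1 *: B t (x_ n t - x0 t) -
        \sum_k ((r_ n)^-1 * rmp n k t) *: G k t.
      rewrite /var_rem bl_B bl_Z; congr (_ - _).
      rewrite (big_morph (B t) (bl_D _) (bl_0 _)); apply: eq_bigr => k _.
      by rewrite bl_Z -!scalerA rG.
    rewrite /D big_split /=; under eq_bigr do rewrite -scalerA; rewrite -scaler_sumr.
    rewrite !scalerBr; zmod.
  rewrite (le_trans (ler_normD _ _))// lerD//.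
    by rewrite normrZ ger0_norm.
  rewrite normrZ ger0_norm//.
  have [/existsP[k kt]|/existsPn H] := boolP [exists k, act n k t].
    have other j : j != k -> ~~ act n j t.
      move=> jk; have [_ _ dj] := r_small n; have kj : k != j by rewrite eq_sym.
      by apply: contra (dj k j t kj (nactive1 (b_box n) (r0 n) kt)); exact: nactive1 (b_box n) (r0 n).
    have uE : u_ n t = vk k by exact: nctrl_in.
    rewrite uE (bigD1 k)//= big1 => [|j jk]; last by rewrite (negPf (other j jk)) scale0r.
    rewrite kt scale1r addr0 (bigD1 k)//= kt big1 ?addr0; last first.
      by move=> j jk; rewrite (negPf (other j jk)).
    by rewrite mulr1 [leRHS]mulrC ler_wpM2l// close.
  rewrite [u_ n t](nctrl_out _ _ H) subrr sub0r normrN big1 => [|k _].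
    by rewrite normr0 mulr0 mulr_ge0// ltW.
  by rewrite (negPf (H k)) scale0r.
- rewrite /Psi P0 add0r.
  have -> : \sum_k rmp n k 0 = 0.
    by apply: big1 => k _; rewrite /rmp ramp0// ltW// (nstart_gt0 tkT).
  rewrite !mulr0 subr0; have sumN : (r_ n)^-1 * \sum_k rmp n k T <= N%:R.
    rewrite ler_pdivrMl// mulr_natr -[X in _ *+ X]card_ord -sumr_const; apply: ler_sum => k _.
    apply: le_trans (ramp_le _ _) _; rewrite ?lerDl// addrC addKr.
    by rewrite ler_piMr ?(ltW (r0 n))//; case/andP: (b_box n k).
  have : e / 2 / (N%:R + 1) * ((r_ n)^-1 * \sum_k rmp n k T) <= e / 2.
    apply: (@le_trans _ _ (e / 2 / (N%:R + 1) * N%:R)).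
      by rewrite ler_wpM2l// ltW.
    by rewrite mulrAC ler_pdivrMr// ler_pM2l ?divr_gt0// lerDl.
  have := ler_norm (P n T); lra.
Qed.

Lemma var_end n : var_rem y y0 zeta n T =
  (r_ n)^-1 *: (y n T - y0 T) - \sum_k b_ n k *: zeta k T.
Proof.
congr (_ - _); apply: eq_bigr => k _; congr (_ *: _).
rewrite /rmp ramp1 ?lerDl//; last by rewrite ltW// (nend_lt _ (b_box n) (r_small n)).
by rewrite addrC addKr mulKf// gt_eqF.
Qed.

End Output.

Section StateLimit.
Variables (f : R -> E -> Y -> E) (L : R) (A : R -> bounded_linear E E) (z : 'I_N -> R -> E).
Hypothesis L0 : 0 <= L.
Hypothesis fc : {within `[0, T]%classic `*` Omega `*` U,
  continuous (fun w : R * E * Y => f w.1.1 w.1.2 w.2)}.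
Hypothesis fL : tube_lip T x0 u0 vk d L f.
Hypothesis Ac : pcont 0 T S0 setT A.
Hypothesis fD : forall t, 0 <= t <= T -> forall e, 0 < e -> exists2 r, 0 < r &
  forall xi, `|xi - x0 t| < r ->
    `|f t xi (u0 t) - f t (x0 t) (u0 t) - A t (xi - x0 t)| <= e * `|xi - x0 t|.
Hypothesis zp : forall k,
  primitive 0 T (tk k :: S0) (z k) (fun t => if t < tk k then 0 else A t (z k t)).
Hypothesis z0 : forall k, z k (tk k) =
  f (tk k) (x0 (tk k)) (vk k) - f (tk k) (x0 (tk k)) (u0 (tk k)).
Hypothesis xp : forall n, primitive 0 T (S_ n) (x_ n) (fun t => f t (x_ n t) (u_ n t)).
Hypothesis x0p : primitive 0 T S0 x0 (fun t => f t (x0 t) (u0 t)).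
Hypothesis x_x0 : forall n, x_ n 0 = x0 0.

(** For the state itself [zeta] is [z], and [var_deriv] becomes a linear differential inequality for
    the remainder, closed by Gronwall. *)
Lemma state_limit (e : R) : 0 < e -> \forall n \near \oo, forall t, 0 <= t <= T ->
  `|var_rem x_ x0 z n t| <= e.
Proof.
move=> e0; have [M M0 AM] := pcont_bounded (ltW T0) Ac.
have c0 : 0 < expR (M * T) by exact: expR_gt0.
have e1 : 0 < e / expR (M * T) by rewrite divr_gt0.
apply: filterS (var_deriv L0 fc fL Ac fD zp z0 xp x0p e1).
move=> n [S' [D [psi [Psi [pR pPsi Hpsi PsiT]]]]] t /andP[t0 tT].
have := gronwall (L := M) t0 M0 (primitive_sub (lexx 0) tT pR) (primitive_sub (lexx 0) tT pPsi).
rewrite var_rem0// normr0 add0r subr0 => H.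
have {}H : `|var_rem x_ x0 z n t| <= expR (M * t) * (Psi t - Psi 0).
  apply: H => s /andP[s0 st] _; have sT : 0 < s < T by rewrite s0 (lt_le_trans st).
  have [psi0 Dpsi] := Hpsi s sT; split=> //.
  rewrite -[D s](subrK (A s (var_rem x_ x0 z n s))) addrC.
  rewrite (le_trans (ler_normD _ _))// lerD//.
  apply: le_trans (bl_le _ _) _; rewrite ler_wpM2r// AM//.
  by case/andP: sT => *; rewrite !ltW.
apply: le_trans H _.
have PtT : Psi t <= Psi T.
  apply: (primitive_le tT (primitive_sub t0 (lexx T) pPsi)) => s /andP[ts sT].
  by have [] := Hpsi s; rewrite ?sT ?(le_lt_trans t0).
have P0t : Psi 0 <= Psi t.
  apply: (primitive_le t0 (primitive_sub (lexx 0) tT pPsi)) => s /andP[ts sT].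
  by have [] := Hpsi s; rewrite ?ts ?(lt_le_trans sT).
rewrite -[leRHS](divfK (lt0r_neq0 c0)) [leRHS]mulrC ler_pM ?expR_ge0 ?subr_ge0//.
  by rewrite ler_expR ler_wpM2l.
by apply: le_trans PsiT; rewrite lerD2r.
Qed.

(** For an output the driving term, [B] applied to the state remainder, is already small by
    [state_limit], so a single integration suffices. The convergence of the weights enters only at
    the end, through [var_end]. *)
Lemma output_limit (F : normedModType R) (phi : R -> E -> Y -> F) (Lp : R)
    (B : R -> bounded_linear E F) (zeta : 'I_N -> R -> F) (y : nat -> R -> F)
    (y0 : R -> F) (bl : 'I_N -> R) : 0 <= Lp ->
  {within `[0, T]%classic `*` Omega `*` U,
    continuous (fun w : R * E * Y => phi w.1.1 w.1.2 w.2)} ->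
  tube_lip T x0 u0 vk d Lp phi -> pcont 0 T S0 setT B ->
  (forall t, 0 <= t <= T -> forall e, 0 < e -> exists2 r, 0 < r &
    forall xi, `|xi - x0 t| < r ->
      `|phi t xi (u0 t) - phi t (x0 t) (u0 t) - B t (xi - x0 t)| <= e * `|xi - x0 t|) ->
  (forall k, primitive 0 T (tk k :: S0) (zeta k)
    (fun t => if t < tk k then 0 else B t (z k t))) ->
  (forall k, zeta k (tk k) =
    phi (tk k) (x0 (tk k)) (vk k) - phi (tk k) (x0 (tk k)) (u0 (tk k))) ->
  (forall n, primitive 0 T (S_ n) (y n) (fun t => phi t (x_ n t) (u_ n t))) ->
  primitive 0 T S0 y0 (fun t => phi t (x0 t) (u0 t)) ->
  (forall n, y n 0 = y0 0) ->
  (forall k, (fun n => b_ n k) @ \oo --> bl k) ->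
  (fun n => (r_ n)^-1 *: (y n T - y0 T)) @ \oo --> \sum_k bl k *: zeta k T.
Proof.
move=> Lp0 phic phiL Bc phiD zetap zeta0 yp y0p y_y0 bbl.
have [M M0 BM] := pcont_bounded (ltW T0) Bc.
have rem0 : (fun n => var_rem y y0 zeta n T) @ \oo --> (0 : F).
  apply/cvgrPdist_le => e e0; have e2 : 0 < e / 2 by rewrite divr_gt0.
  have MT : 0 < M * T + 1 by rewrite ltr_wpDl// mulr_ge0// ltW.
  have e3 : 0 < e / 2 / (M * T + 1) by rewrite divr_gt0.
  apply: filterS (filterI (state_limit e3)
    (var_deriv Lp0 phic phiL Bc phiD zetap zeta0 yp y0p e2)).
  move=> n [Hx [S' [D [psi [Psi [pR pPsi Hpsi PsiT]]]]]].
  rewrite sub0r normrN.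
  set c := e / 2 / (M * T + 1) in e3 Hx.
  have pl := primitiveD pPsi (primitive_line 0 T S' 0 (M * c)).
  have := mvt_norm (ltW T0) pR pl; rewrite (var_rem0 zeta y_y0) subr0 => H.
  apply: le_trans (H _) _ => [s sT _|].
    have sT' : 0 <= s <= T by case/andP: sT => *; rewrite !ltW.
    have [psi0 Dpsi] := Hpsi s sT.
    rewrite -[D s](subrK (B s (var_rem x_ x0 z n s))).
    rewrite (le_trans (ler_normD _ _))// lerD//.
    by apply: le_trans (bl_le _ _) _; rewrite ler_pM ?BM// Hx.
  rewrite !scalerRE !subr0 mul0r addr0.
  have : T * (M * c) <= e / 2.
    rewrite (_ : T * (M * c) = e / 2 * (M * T / (M * T + 1))); last by rewrite /c; ring.
    by rewrite ler_piMr ?(ltW e2)// ler_pdivrMr// mul1r lerDl.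
  lra.
have sumc : (fun n => \sum_k b_ n k *: zeta k T) @ \oo --> \sum_k bl k *: zeta k T.
  by apply: cvg_sumr => k; apply: cvgZ; [exact: bbl|exact: cvg_cst].
have -> : (fun n => (r_ n)^-1 *: (y n T - y0 T)) =
    (fun n => var_rem y y0 zeta n T + \sum_k b_ n k *: zeta k T).
  by apply/funext => n; rewrite (var_end zeta y y0 n) subrK.
by rewrite -[X in _ --> X]add0r; exact: cvgD.
Qed.

End StateLimit.
End VariationLimit.

(** * Frechet and Hadamard differentials as estimates *)

Section Differentials.
Context {R : realType} {X W : normedModType R}.
Implicit Types (f : X -> W) (A B : bounded_linear X W).

Lemma DFP f x : frechet_differentiable f x -> is_frechet f x (DF f x).
Proof. by move=> [A fA]; exact: (@getPex _ (is_frechet f x) (ex_intro _ A fA)). Qed.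

Lemma DHP f x : hadamard_differentiable f x -> is_hadamard f x (DH f x).
Proof. by move=> [A fA]; exact: (@getPex _ (is_hadamard f x) (ex_intro _ A fA)). Qed.

Lemma bl_continuous A : continuous (A : X -> W).
Proof.
move=> x; apply/cvgrPdist_le => e e0; have A1 : 0 < `|A| + 1 by rewrite ltr_wpDl.
apply/nbhs_ballP; exists (e / (`|A| + 1)); first by rewrite /= divr_gt0.
move=> y; rewrite -ball_normE /ball_/= => xy; rewrite -bl_B.
apply: le_trans (bl_le _ _) _; apply: (@le_trans _ _ ((`|A| + 1) * `|x - y|)).
  by rewrite ler_wpM2r// lerDl.
by rewrite mulrC -ler_pdivlMr// ltW.
Qed.

Lemma frechet_eps f x A : is_frechet f x A <-> forall e, 0 < e -> exists2 r, 0 < r &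
  forall y, `|y - x| < r -> `|f y - f x - A (y - x)| <= e * `|y - x|.
Proof.
split.
  move=> [df dA] e e0; have /eqaddoP/(_ e e0) := diff_locally df.
  rewrite nearE => /nbhs_ballP[r /= r0 H]; exists r => // y yx.
  have := H (y - x); rewrite -ball_normE /ball_/= sub0r normrN => /(_ yx).
  have <- : ('d f x : X -> W) = A by exact: dA.
  rewrite /= !fctE subrK.
  by have -> : f y - (f x + 'd f x (y - x)) = f y - f x - 'd f x (y - x) by zmod.
move=> H.
have cA : continuous (A : X -> W) by exact: bl_continuous.
have fA : f \o shift x = cst (f x) + A +o_ (0 : X) id.
  apply/eqaddoP => e e0; have [r r0 Hr] := H e e0.
  apply/nbhs_ballP; exists r => // y; rewrite -ball_normE /ball_/= sub0r normrN => yr.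
  have := Hr (y + x); rewrite addrK => /(_ yr).
  by rewrite !fctE /= (_ : f (y + x) - (f x + A y) = f (y + x) - f x - A y) //; zmod.
have dA : 'd f x = A :> (X -> W) by exact: (diff_unique cA fA).
split=> //; apply/diff_locallyP; rewrite dA; split=> //.
Qed.

(** The rescaled directions and their limit form a compact set, on which the Hadamard quotients
    converge uniformly. *)
Lemma hadamard_seq f x A (r : nat -> R) (y : nat -> X) Z : is_hadamard f x A ->
  (forall n, 0 < r n) -> r @ \oo --> (0 : R) ->
  (fun n => (r n)^-1 *: (y n - x)) @ \oo --> Z ->
  (fun n => (r n)^-1 *: (f (y n) - f x)) @ \oo --> A Z.
Proof.
move=> fA r0 rc yZ; pose w n := (r n)^-1 *: (y n - x).
have ck : compact ([set Z] `|` range w) by exact: cvg_compact yZ.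
have K0 : [set Z] `|` range w !=set0 by exists Z; left.
have {}fA := fA _ ck K0.
have rr : r @ \oo --> (0 : R)^'+.
  move=> P /near_rightP[d d0 Hd].
  have : \forall n \near \oo, `|0 - r n| < d by have /cvgrPdist_lt := rc; apply.
  apply: filterS => n; rewrite sub0r normrN gtr0_norm// => rd; apply: Hd.
  by rewrite r0 add0r.
have Aw : (fun n => A (w n)) @ \oo --> A Z.
  by apply: continuous_cvg yZ; exact: bl_continuous.
rewrite -[A Z]addr0.
have -> : (fun n => (r n)^-1 *: (f (y n) - f x)) =
  (fun n => A (w n) + ((r n)^-1 *: (f (y n) - f x) - A (w n))).
  by apply/funext => n; rewrite [RHS]addrC subrK.
apply: cvgD Aw _; apply/cvgrPdist_le => e e0.
have lte : nbhs 0%E [set s : \bar R | (s < e%:E)%E].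
  by apply: open_nbhs_nbhs; split; [exact: open_ereal_lt_ereal|rewrite /= lte_fin].
pose err t := ereal_sup [set `|t^-1 *: (f (x + t *: k) - f x) - A k|%:E
  | k in [set Z] `|` range w].
have : \forall n \near \oo, (err (r n) < e%:E)%E.
  have errlt : \forall t \near 0^'+, (err t < e%:E)%E by exact: fA lte.
  exact: (rr _ errlt).
apply: filterS => n H; rewrite sub0r normrN -lee_fin; apply: le_trans (ltW H).
apply: ereal_sup_ubound; exists (w n); first by right; exists n.
by rewrite /w scalerA divff ?gt_eqF// scale1r (addrC x) subrK.
Qed.

End Differentials.

Section SmoothOutput.
Context {R : realType} {E : completeNormedModType R} {Y : topologicalType}.
Variables (T : R) (Omega : set E) (U : set Y) (x0 : R -> E) (u0 : R -> Y) (S0 : seq R).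
Hypothesis T0 : 0 < T.
Hypothesis Omega_open : open Omega.
Hypothesis x0c : {within `[0, T], continuous x0}.
Hypothesis x0O : forall t, 0 <= t <= T -> Omega (x0 t).
Hypothesis u0n : npc T S0 U u0.

(** Retains from [regular_along] what the expansion uses, in a form shared by the dynamics, the
    running costs and the zero running cost attached to each inequality constraint. *)
Definition smooth_output {F : normedModType R} (phi : R -> E -> Y -> F)
    (B : R -> bounded_linear E F) :=
  [/\ {within `[0, T]%classic `*` Omega `*` U,
        continuous (fun w : R * E * Y => phi w.1.1 w.1.2 w.2)},
      forall S u, npc T S U u -> exists2 eta, 0 < eta & forall t, 0 <= t <= T ->
        (forall xi, `|xi - x0 t| < eta -> Omega xi) /\
        forall xi xi', `|xi - x0 t| < eta -> `|xi' - x0 t| < eta ->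
          `|phi t xi (u t) - phi t xi' (u t)| <= eta^-1 * `|xi - xi'|,
      npc T S0 setT B &
      forall t, 0 <= t <= T -> forall e, 0 < e -> exists2 r, 0 < r &
        forall xi, `|xi - x0 t| < r ->
          `|phi t xi (u0 t) - phi t (x0 t) (u0 t) - B t (xi - x0 t)| <= e * `|xi - x0 t|].

Lemma regular_smooth (F : normedModType R) (phi : R -> E -> Y -> F) :
  regular_along T Omega U x0 phi ->
  smooth_output phi (fun t => DF (phi t ^~ (u0 t)) (x0 t)).
Proof.
move=> reg; have [phic _ phiF DFc _] := reg.
have uU t : 0 <= t <= T -> U (u0 t) by case: u0n => -[H _ _ _] _ _; exact: H.
split=> //.
- move=> S u un; exact: (tube_lipschitz T0 Omega_open x0c x0O reg un).
- have idn : npc T S0 `[0, T]%classic (@id R).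
    by apply: npc_continuous => //; apply: continuous_subspaceT => t; exact: cvg_id.
  exact: (npc_comp (V := setT) T0 DFc _ (npc_pair idn u0n)).
- move=> t tT; apply/frechet_eps; apply: DFP; apply: phiF; last exact: uU.
  by rewrite in_itv.
Qed.

Lemma smooth_output0 (F : normedModType R) (eta : R) : 0 < eta ->
  (forall t xi, 0 <= t <= T -> `|xi - x0 t| < eta -> Omega xi) ->
  smooth_output (fun _ _ _ => 0 : F) (fun=> 0).
Proof.
move=> eta0 HO; split=> //.
- by move=> w; exact: cvg_cst.
- move=> S u un; exists eta => // t tT; split=> [xi|xi xi' _ _]; first exact: HO.
  by rewrite subrr normr0 mulr_ge0// invr_ge0 ltW.
- by apply: npc_continuous => // t; exact: cvg_cst.
- move=> t tT e e0; exists 1 => // xi _.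
  by rewrite subrr bl0E subrr normr0 mulr_ge0// ltW.
Qed.

(** Holding for all small [eta], the estimates for finitely many outputs can share one radius. The
    estimate at a needle value is the one along the constant control with that value. *)
Lemma smooth_near (F : normedModType R) (phi : R -> E -> Y -> F) B N (vk : 'I_N -> Y) :
  smooth_output phi B -> (forall k, U (vk k)) -> \forall eta \near (0 : R)^'+,
    (forall t xi, 0 <= t <= T -> `|xi - x0 t| < eta -> Omega xi) /\
    tube_lip T x0 u0 vk eta eta^-1 phi.
Proof.
move=> [_ H _ _] vkU.
pose Q u eta := forall t, 0 <= t <= T ->
    (forall xi, `|xi - x0 t| < eta -> Omega xi) /\
    forall xi xi', `|xi - x0 t| < eta -> `|xi' - x0 t| < eta ->
      `|phi t xi (u t) - phi t xi' (u t)| <= eta^-1 * `|xi - xi'|.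
have one S u : npc T S U u -> \forall eta \near (0 : R)^'+, Q u eta.
  move=> un; have [eta eta0 Heta] := H S u un.
  have ee : 0 <= (0 : R) < eta by rewrite lexx.
  apply: filterS (near_right_oo ee) => e /andP[e0 ee'] t tT.
  have [HO HL] := Heta t tT; split=> [xi xie|xi xi' xie xie'].
    by apply: HO; exact: lt_trans ee'.
  apply: (le_trans (HL xi xi' (lt_trans xie ee') (lt_trans xie' ee'))).
  by rewrite ler_wpM2r// lef_pV2 ?posrE// ltW.
have vn k : npc T S0 U (fun=> vk k).
  by apply: npc_continuous => // t; exact: cvg_cst.
have allk : \forall eta \near (0 : R)^'+, forall k, Q (fun=> vk k) eta.
  by apply: filter_forall => k; exact: one (vn k).
apply: filterS (filterI (one S0 u0 u0n) allk) => eta [H0 Hk]; split=> [t xi tT|].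
  by have [HO _] := H0 t tT; exact: HO.
move=> t w xi xi' tT [->|[k ->]]; first by have [_] := H0 t tT; apply.
by have [_] := Hk k t tT; apply.
Qed.

End SmoothOutput.

(** * Multipliers *)

Section Variations.
Context {R : realType}.
Variables (T : R) (S0 : seq R).
Implicit Types (t : R).

Let extend (F : normedModType R) t S (x G : R -> F) : 0 <= t < T -> primitive t T S x G ->
  exists x', x' t = x t /\ (forall s, t <= s -> x' s = x s) /\
    primitive 0 T (t :: S) x' (fun s => if s < t then 0 else G s).
Proof.
move=> /andP[t0 tT] xG; exists (fun s => if s <= t then x t else x s).
split; first by rewrite lexx.
split=> [s ts|].
  by have [st|//] := leP s t; congr x; apply/eqP; rewrite eq_le ts st.
apply: (primitive_glue t0 (ltW tT) _ (primitive_cst 0 t S (x t)) xG).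
by [].
Qed.

Lemma state_variation (E : completeNormedModType R) (A : R -> bounded_linear E E) t (v : E) :
  pcont 0 T S0 setT A -> 0 <= t < T -> exists z : R -> E, z t = v /\
    primitive 0 T (t :: S0) z (fun s => if s < t then 0 else A s (z s)).
Proof.
move=> Ac tT; have /andP[t0 /ltW tT'] := tT.
have [M M0 AM] := pcont_bounded (le_trans t0 tT') Ac.
have [||||z [zt zp]] := @ode_exists R E t T S0 (fun s => A s) M v => //.
- move=> s v' w /andP[ts sT] _; rewrite -bl_B; apply: le_trans (bl_le _ _) _.
  by rewrite ler_wpM2r// AM// (ltW sT) andbT ltW// (le_lt_trans t0).
- move=> x cx; apply: pcont_eval; first exact: pcont_sub t0 (lexx T) Ac.
  exact: pcont_continuous.
have [z' [z't [z'E z'p]]] := extend tT zp.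
exists z'; split; first by rewrite z't.
by apply: primitive_ext z'p => // s _ _; case: ltP => // ts; rewrite z'E.
Qed.

Lemma output_variation (E : normedModType R) (F : completeNormedModType R)
    (B : R -> bounded_linear E F) (z : R -> E) t (c : F) :
  pcont 0 T S0 setT B -> {within `[0, T], continuous z} -> 0 <= t < T ->
  exists zeta : R -> F, zeta t = c /\
    primitive 0 T (t :: S0) zeta (fun s => if s < t then 0 else B s (z s)).
Proof.
move=> Bc zc tT; have /andP[t0 /ltW tT'] := tT.
have Bz : pcont t T S0 setT (fun s => B s (z s)).
  apply: pcont_sub t0 (lexx T) _; apply: pcont_eval => //.
  exact: pcont_continuous.
have [x [xt xp]] := pcont_primitive tT' Bz.
have xcp := primitiveD (primitive_cst t T S0 c) xp.
have [x' [x't [_ x'p]]] := extend tT xcp.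
exists x'; split; first by rewrite x't xt addr0.
by apply: primitive_ext x'p => // s _ _; case: ltP => //; rewrite add0r.
Qed.

End Variations.

(* Finitely many families of needles indexed by J are merged into one list on
   which the jth family is recovered by the weights a j. *)
Lemma pool_needles (R : realType) (P : Type) (Q : P -> Prop) (J : finType)
    (N : J -> nat) (pt : forall j, 'I_(N j) -> P) (c : forall j, 'I_(N j) -> R) :
  (forall j k, Q (pt j k)) -> (forall j k, 0 <= c j k) ->
  exists n (pt' : 'I_n -> P) (a : J -> 'I_n -> R),
  [/\ forall k, Q (pt' k), forall j k, 0 <= a j k &
     forall j (V : P -> R), \sum_k a j k * V (pt' k) = \sum_k c j k * V (pt j k)].
Proof.
move=> HQ c0; pose X : finType := {j : J & 'I_(N j)}.
pose p (k : 'I_#|X|) : X := enum_val k.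
exists #|X|, (fun k => pt (tag (p k)) (tagged (p k))),
  (fun j k => if tag (p k) == j then c (tag (p k)) (tagged (p k)) else 0).
split=> [k|j k|j V]; first exact: HQ.
  by case: ifP.
rewrite /p (reindex (enum_rank : X -> 'I_#|X|)); last first.
  by apply: onW_bij; exact: enum_rank_bij.
under eq_bigr do rewrite enum_rankK.
rewrite (eq_bigr (fun x : X => (if tag x == j then c (tag x) (tagged x) else 0) *
  V (pt (tag x) (tagged x))))//.
rewrite -(sig_big_dep xpredT (fun _ => xpredT) (fun i k => (if i == j then c i k else 0) * V (pt i k)))/=.
rewrite (bigD1 j)//= [X in _ + X]big1 ?addr0 => [|i /negPf ij].
  by apply: eq_bigr => k _; rewrite eqxx.
by apply: big1 => k _; rewrite ij mul0r.
Qed.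

Section NeedleAlternative.
Context {R : realType} {P : Type} {I : finType} {q : nat}.
Variables (Q : P -> Prop) (act : pred I) (V : I + 'I_q -> P -> R).

(** The variations reachable by weighted needles, enlarged downwards in the active coordinates and
    left free in the inactive ones. The enlargement forces a separating functional to be nonnegative
    on the former and zero on the latter. *)
Let D : set (I + 'I_q -> R) := [set w | exists n (pt : 'I_n -> P) (c : 'I_n -> R),
  [/\ forall k, Q (pt k), forall k, 0 <= c k,
      forall i, act i -> w (inl i) <= \sum_k c k * V (inl i) (pt k) &
      forall b, w (inr b) = \sum_k c k * V (inr b) (pt k)]].

Let no_needle (w : I + 'I_q -> R) : (forall i, act i -> w (inl i) <= 0) ->
  (forall b, w (inr b) = 0) -> D w.
Proof.
move=> wi wb; exists 0%N, (fun k : 'I_0 => let: Ordinal _ k0 := k in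
  False_rect P (notF k0)), (fun=> 0).
by split=> [[]//|[]//|i ai|b]; rewrite big_ord0 ?wb// wi.
Qed.

Let D_cone d d' (s : R) : D d -> D d' -> 0 <= s -> D (fun i => d i + s * d' i).
Proof.
move=> [n [pt [c [Qp c0 di db]]]] [n' [pt' [c' [Qp' c0' di' db']]]] s0.
have [||m [p [a [Qm a0 aV]]]] := @pool_needles R P Q bool (fun j => if j then n else n')
  (fun j => if j return 'I_(if j then n else n') -> P then pt else pt')
  (fun j => if j return 'I_(if j then n else n') -> R then c else c').
- by case.
- by case.
exists m, p, (fun k => a true k + s * a false k); split=> [//|k|i ai|b].
- by rewrite addr_ge0// mulr_ge0.
- under eq_bigr do rewrite mulrDl -mulrA.
  rewrite big_split/= -mulr_sumr (aV true) (aV false).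
  by rewrite lerD ?di// ler_wpM2l// di'.
- under eq_bigr do rewrite mulrDl -mulrA.
  by rewrite big_split/= -mulr_sumr (aV true) (aV false) db db'.
Qed.

Let target (j : (unit + 'I_q * bool)%type) (i : I + 'I_q) : R :=
  match j, i with
  | inl _, inl _ => 1
  | inr (b, sg), inr b' => if b == b' then if sg then 1 else -1 else 0
  | _, _ => 0
  end.

(* For [eta] in the unit cube, [\sum_j weight eta j * target j] is 1 on [inl]
   and [eta] on [inr]. *)
Let weight (eta : 'rV[R]_q) (j : (unit + 'I_q * bool)%type) : R :=
  match j with
  | inl _ => 1
  | inr (b, sg) => Num.max (if sg then eta 0 b else - eta 0 b) 0
  end.

(** Pooling keeps the list of needles independent of [eta]: only the weights vary, and they do so
    Lipschitz continuously, which makes the endpoint continuous in [eta]. *)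
Lemma needle_alternative :
  (exists L : I + 'I_q -> R, [/\ exists i, L i != 0, forall i, 0 <= L (inl i),
     forall i, ~~ act i -> L (inl i) = 0 &
     forall p, Q p -> \sum_i L i * V i p <= 0]) \/
  exists n (pt : 'I_n -> P) (beta : 'rV[R]_q -> 'I_n -> R), [/\ forall k, Q (pt k),
     forall eta, cube q 1 eta -> box (beta eta),
     exists K, forall eta eta' k, `|beta eta k - beta eta' k| <= K * `|eta - eta'| &
     forall eta, cube q 1 eta ->
       [/\ forall i, act i -> 0 < \sum_k beta eta k * V (inl i) (pt k),
           forall b, eta 0 b = 1 -> 0 < \sum_k beta eta k * V (inr b) (pt k) &
           forall b, eta 0 b = -1 -> \sum_k beta eta k * V (inr b) (pt k) < 0]].
Proof.
have q1 : 0 < q.+1%:R * 2 :> R by rewrite mulr_gt0.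
(* On the cube the weights of the targets add up to at most [q.+1], so errors below [e] per target
   add up to at most 1/2, which cannot spoil a target value of 1 or -1. *)
pose e : R := (q.+1%:R * 2)^-1; have e0 : 0 < e by rewrite invr_gt0.
have [H|/existsNP[j Hj]] := pselect (forall j, exists2 d, D d &
    forall i, `|target j i - d i| < e); last first.
  left; have D0 : D (fun=> 0) by apply: no_needle.
  have [|L [L0 LD]] := cone_separation D0 D_cone (c := target j) e0.
  - move=> d Dd; apply: contrapT => Hd; apply: Hj; exists d => // i.
    by rewrite ltNge; apply/negP => ed; apply: Hd; exists i.
  have Ldelta i (x : R) : \sum_i' L i' * (if i' == inl i then x else 0) = L (inl i) * x.
    rewrite (bigD1 (inl i))//= eqxx big1 ?addr0// => i' /negPf ->.
    by rewrite mulr0.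
  exists L; split=> // [i|i nai|p Qp].
  - have := LD (fun i' => if i' == inl i then -1 else 0).
    rewrite Ldelta mulrN1 oppr_le0; apply; apply: no_needle => // i' _.
    by case: ifP => //; rewrite oppr_le0.
  - have pm (x : R) : L (inl i) * x <= 0.
      rewrite -Ldelta; apply: LD; apply: no_needle => // i' ai'.
      by rewrite ifF//; apply/eqP => -[ii]; move: nai; rewrite -ii ai'.
    have := pm 1; have := pm (-1); lra.
  - apply: (LD (V ^~ p)); exists 1%N, (fun=> p), (fun=> 1).
    by split=> // [i|b]; rewrite big_ord1 mul1r.
right; pose J : finType := (unit + 'I_q * bool)%type.
have /choice[X HX] : forall j : J, exists X : {n : nat & (('I_n -> P) * ('I_n -> R))%type},
    [/\ forall k, Q ((projT2 X).1 k), forall k, 0 <= (projT2 X).2 k,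
      forall i, act i -> target j (inl i) - e < \sum_k (projT2 X).2 k * V (inl i) ((projT2 X).1 k) &
      forall b, `|\sum_k (projT2 X).2 k * V (inr b) ((projT2 X).1 k) - target j (inr b)| < e].
  move=> j; have [d [n [pt [c [Qp c0 di db]]]] dj] := H j.
  exists (existT _ n (pt, c)); split=> // [i ai|b] /=.
    apply: lt_le_trans (di i ai); rewrite ltrBlDr -ltrBlDl.
    exact: le_lt_trans (ler_norm _) (dj (inl i)).
  by rewrite -db distrC; exact: dj.
have [n [pt [a [Qp a0 aV]]]] := @pool_needles R P Q J (fun j => projT1 (X j))
  (fun j => (projT2 (X j)).1) (fun j => (projT2 (X j)).2)
  (fun j => let: And4 h _ _ _ := HX j in h) (fun j => let: And4 _ h _ _ := HX j in h).
have ai j i : act i -> target j (inl i) - e < \sum_k a j k * V (inl i) (pt k).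
  by move=> ai; rewrite aV; case: (HX j) => _ _ H' _; exact: H'.
have ab j b : `|\sum_k a j k * V (inr b) (pt k) - target j (inr b)| < e.
  by rewrite aV; case: (HX j).
have [c0 ac] : 0 < 1 + \sum_j \sum_k a j k /\
    forall k, \sum_j a j k <= 1 + \sum_j \sum_k a j k.
  have s0 : 0 <= \sum_j \sum_k a j k by apply: sumr_ge0 => j _; exact: sumr_ge0.
  split; first by rewrite ltr_pwDl.
  move=> k; apply: (@le_trans _ _ (\sum_j \sum_k a j k)); last by rewrite lerDr.
  apply: ler_sum => j _; rewrite (bigD1 k)//= lerDl.
  exact: sumr_ge0.
(* Dividing by [C] brings the weights of the needles into [[0, 1]] without changing any sign. *)
set C := 1 + _ in c0 ac.
have w0 eta j : 0 <= weight eta j by case: j => [|[]] * /=; rewrite ?le_max ?lexx ?orbT.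
have w1 eta j : cube q 1 eta -> weight eta j <= 1.
  move=> Heta; case: j => [//|[b sg]] /=; rewrite ge_max ler01 andbT.
  have := Heta b; rewrite ler_norml => /andP[? ?]; case: sg => //.
  by rewrite lerNl.
have wL eta eta' j : `|weight eta j - weight eta' j| <= `|eta - eta'|.
  case: j => [_|[b sg]] /=; first by rewrite subrr normr0.
  have maxL (x y : R) : `|Num.max x 0 - Num.max y 0| <= `|x - y|.
    rewrite ler_norml /Num.max; have := ler_norm (x - y); have := ler_norm (y - x).
    rewrite (distrC y x); case: ifP; case: ifP => *; apply/andP; split; lra.
  apply: le_trans (maxL _ _) _; have := mx_coord_le (eta - eta') b; rewrite !mxE.
  by case: sg; rewrite // -opprD normrN.
have pairE (G : 'I_q * bool -> R) : \sum_p G p = \sum_b (G (b, true) + G (b, false)).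
  rewrite (eq_bigr (fun p => G (p.1, p.2))) => [|[]//].
  by rewrite -(pair_bigA _ (fun b sg => G (b, sg)))/=; apply: eq_bigr => b _; rewrite big_bool.
have wS eta : cube q 1 eta -> \sum_j weight eta j <= q.+1%:R.
  move=> Heta; rewrite big_sumType /= big_const card_unit /= addr0.
  rewrite pairE/= -natr1 addrC lerD// -[X in _ <= X%:R]card_ord -sumr_const; apply: ler_sum => b _.
  have := Heta b; rewrite ler_norml /Num.max => /andP[? ?].
  case: ifP; case: ifP => *; lra.
have wT eta i : \sum_j weight eta j * target j (inl i) = 1.
  rewrite big_sumType /= big_const card_unit /= addr0 mul1r big1 ?addr0//.
  by move=> [b sg] _; rewrite mulr0.
have wTb eta b : \sum_j weight eta j * target j (inr b) = eta 0 b.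
  rewrite big_sumType /= big_const card_unit /= addr0 mulr0 add0r.
  rewrite pairE (bigD1 b)//= [X in _ + X]big1 => [|b' /negPf bb']; last first.
    by rewrite bb' !mulr0 addr0.
  rewrite eqxx addr0 mulr1 mulrN1 /Num.max.
  case: ifP; case: ifP => *; lra.
pose beta eta k := C^-1 * \sum_j weight eta j * a j k.
have betaV eta v : \sum_k beta eta k * v (pt k) =
    C^-1 * \sum_j weight eta j * \sum_k a j k * v (pt k).
  rewrite [in RHS](eq_bigr (fun j => \sum_k weight eta j * (a j k * v (pt k)))); last first.
    by move=> j _; rewrite mulr_sumr.
  rewrite exchange_big /= mulr_sumr; apply: eq_bigr => k _.
  by rewrite /beta -mulrA mulr_suml; congr (_ * _); apply: eq_bigr => j _; rewrite mulrA.
have eq1 : e * q.+1%:R = 2^-1.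
  by rewrite /e invfM mulrAC mulVf ?mul1r// pnatr_eq0.
have wE eta : cube q 1 eta -> e * \sum_j weight eta j <= 2^-1.
  by move=> Heta; rewrite -eq1 ler_wpM2l ?wS// ltW.
have CV : 0 < C^-1 by rewrite invr_gt0.
exists n, pt, beta; split=> //.
- move=> eta Heta k; apply/andP; split.
    by rewrite mulr_ge0 ?(ltW CV)// sumr_ge0// => j _; rewrite mulr_ge0.
  rewrite ler_pdivrMl// mulr1; apply: le_trans (ac k); apply: ler_sum => j _.
  by rewrite ler_piMl// w1.
- exists 1 => eta eta' k; rewrite mul1r -mulrBr -sumrB normrM gtr0_norm// ler_pdivrMl//.
  apply: le_trans (ler_norm_sum _ _ _) _.
  apply: (@le_trans _ _ (\sum_j `|eta - eta'| * a j k)).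
    by apply: ler_sum => j _; rewrite -mulrBl normrM (ger0_norm (a0 j k)) ler_wpM2r.
  by rewrite -mulr_sumr mulrC ler_wpM2r.
- move=> eta Heta; have We := wE eta Heta.
  have near_b b : `|\sum_j weight eta j * (\sum_k a j k * V (inr b) (pt k)) - eta 0 b| <= 2^-1.
    rewrite -(wTb eta b) -sumrB; apply: le_trans (ler_norm_sum _ _ _) _.
    apply: le_trans We; rewrite mulr_sumr; apply: ler_sum => j _.
    by rewrite -mulrBr normrM ger0_norm// mulrC ler_wpM2r// ltW.
  split=> [i act_i|b eb|b eb]; rewrite betaV.
  + rewrite mulr_gt0//; apply: (@lt_le_trans _ _ (1 - 2^-1)); first by lra.
    apply: (@le_trans _ _ (1 - e * \sum_j weight eta j)); first by rewrite lerD2l lerN2.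
    rewrite -(wT eta i) mulr_sumr -sumrB; apply: ler_sum => j _.
    by rewrite (mulrC e) -mulrBr ler_wpM2l// ltW// ai.
  + rewrite mulr_gt0//; have := near_b b; rewrite eb ler_norml => /andP[]; lra.
  + rewrite pmulr_rlt0//; have := near_b b; rewrite eb ler_norml => /andP[]; lra.
Qed.
End NeedleAlternative.

(** * Improving a trajectory when no multiplier exists *)

Section Improvement.
Context {R : realType} {E : completeNormedModType R} {Y : topologicalType}.
Context {J : finType} {q : nat}.
Variables (T : R) (Omega : set E) (U : set Y) (f : R -> E -> Y -> E).
Variables (x0 : R -> E) (u0 : R -> Y) (S0 : seq R) (A : R -> bounded_linear E E).
Variables (psi : J -> R -> E -> Y -> R) (B : J -> R -> bounded_linear E R).
Variables (G : J -> E -> R) (dG : J -> bounded_linear E R) (s : J -> R).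
Variables (h : 'I_q -> E -> R) (dh : 'I_q -> bounded_linear E R).
Hypothesis T0 : 0 < T.
Hypothesis x0O : forall t, 0 <= t <= T -> Omega (x0 t).
Hypothesis u0n : npc T S0 U u0.
Hypothesis x0p : primitive 0 T S0 x0 (fun t => f t (x0 t) (u0 t)).
Hypothesis f_smooth : smooth_output T Omega U x0 u0 S0 f A.
Hypothesis psi_smooth : forall i, smooth_output T Omega U x0 u0 S0 (psi i) (B i).
Hypothesis G_hadamard : forall i, is_hadamard (G i) (x0 T) (dG i).
Hypothesis s0 : forall i, 0 <= s i.
Hypothesis h_hadamard : forall b, is_hadamard (h b) (x0 T) (dh b).
Hypothesis h_cont : forall b, exists2 V, nbhs (x0 T) V & {within V, continuous (h b)}.
Hypothesis h0 : forall b, h b (x0 T) = 0.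

(** Objectives and inequality constraints are handled alike. An objective will have slack [s i = 0]
    and must improve strictly; a constraint will have zero running cost and its own value at [x0 T]
    as slack, so that exceeding the old value minus the slack means being positive. *)
Definition payoff i x u : R :=
  G i (x T) + \int[lebesgue_measure]_(t in `[0, T]) psi i t (x t) (u t).

(* The solutions of the linearized equations start at [t]; they are extended to
   [0, t] by constants. *)
Definition is_variation t v (z : R -> E) (zeta : J -> R -> R) :=
  [/\ z t = f t (x0 t) v - f t (x0 t) (u0 t),
      primitive 0 T (t :: S0) z (fun r => if r < t then 0 else A r (z r)),
      forall i, zeta i t = psi i t (x0 t) v - psi i t (x0 t) (u0 t) &
      forall i, primitive 0 T (t :: S0) (zeta i)
        (fun r => if r < t then 0 else B i r (z r))].

Lemma is_variation_exists t v : 0 <= t < T -> exists w, is_variation t v w.1 w.2.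
Proof.
move=> tT; have [_ _ [Ac _ _] _] := f_smooth.
have [z [zt zp]] := state_variation (f t (x0 t) v - f t (x0 t) (u0 t)) Ac tT.
have [zc _] := zp.
have /choice[zeta Hzeta] : forall i, exists zeta : R -> R,
    zeta t = psi i t (x0 t) v - psi i t (x0 t) (u0 t) /\
    primitive 0 T (t :: S0) zeta (fun r => if r < t then 0 else B i r (z r)).
  move=> i; have [_ _ [Bc _ _] _] := psi_smooth i.
  exact: (@output_variation R T S0 E (R^o) (B i) z t _ Bc zc tT).
by exists (z, zeta); split=> // i; have [] := Hzeta i.
Qed.

Section Needles.
Variables (N : nat) (tk : 'I_N -> R) (vk : 'I_N -> Y) (beta : 'rV[R]_q -> 'I_N -> R).
Variables (z : 'I_N -> R -> E) (zeta : 'I_N -> J -> R -> R) (K0 : R).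
Hypothesis tkT : forall k, 0 <= tk k < T.
Hypothesis vkU : forall k, U (vk k).
Hypothesis z_var : forall k, is_variation (tk k) (vk k) (z k) (zeta k).
Hypothesis beta_box : forall eta, cube q 1 eta -> box (beta eta).
Hypothesis beta_lip : forall eta eta' k, `|beta eta k - beta eta' k| <= K0 * `|eta - eta'|.
Hypothesis beta_dir : forall eta, cube q 1 eta ->
  [/\ forall i, s i = 0 -> 0 < \sum_k beta eta k * (dG i (z k T) + zeta k i T),
      forall b, eta 0 b = 1 -> 0 < \sum_k beta eta k * dh b (z k T) &
      forall b, eta 0 b = -1 -> \sum_k beta eta k * dh b (z k T) < 0].

Let x0c : {within `[0, T], continuous x0}. Proof. by case: x0p. Qed.

Let tube : exists2 d, 0 < d & [/\ forall t xi, 0 <= t <= T -> `|xi - x0 t| < d -> Omega xi,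
  tube_lip T x0 u0 vk d d^-1 f & forall i, tube_lip T x0 u0 vk d d^-1 (psi i)].
Proof.
pose P1 d := (forall t xi, 0 <= t <= T -> `|xi - x0 t| < d -> Omega xi) /\
  tube_lip T x0 u0 vk d d^-1 f.
pose P2 i d := (forall t xi, 0 <= t <= T -> `|xi - x0 t| < d -> Omega xi) /\
  tube_lip T x0 u0 vk d d^-1 (psi i).
have n1 : \forall d \near (0 : R)^'+, P1 d by exact: (smooth_near T0 u0n f_smooth vkU).
have n2 : \forall d \near (0 : R)^'+, forall i, P2 i d.
  by apply: filter_forall => i; exact: (smooth_near T0 u0n (psi_smooth i) vkU).
have [r r0 Hr] := near_rightP (filterI n1 n2).
have r2 : 0 < r / 2 < 0 + r.
  by rewrite divr_gt0//= add0r ltr_pdivrMr// ltr_pMr// ltr1n.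
have [[HO Hf] Hpsi] := Hr _ r2; exists (r / 2); first by case/andP: r2.
by split=> // i; case: (Hpsi i).
Qed.

Let C_bound : exists2 C, 0 <= C & forall t k, 0 <= t <= T ->
  `|f t (x0 t) (vk k) - f t (x0 t) (u0 t)| <= C.
Proof.
have [fc _ _ _] := f_smooth.
have /choice[C HC] : forall k, exists C, 0 <= C /\ forall t, 0 <= t <= T ->
    `|f t (x0 t) (vk k) - f t (x0 t) (u0 t)| <= C.
  move=> k; have vn : npc T S0 U (fun=> vk k).
    by apply: npc_continuous => // t; exact: cvg_cst.
  have [p1 _ _] := comp_npc T0 fc x0c x0O vn.
  have [p2 _ _] := comp_npc T0 fc x0c x0O u0n.
  by have [C C0 HC] := pcont_bounded (ltW T0) (pcontB p1 p2); exists C.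
exists (\sum_k C k); first by apply: sumr_ge0 => k _; case: (HC k).
move=> t k tT; apply: (@le_trans _ _ (C k)); first by case: (HC k) => _; exact.
by rewrite (bigD1 k)//= lerDl sumr_ge0// => j _; case: (HC j).
Qed.

Lemma needles_improve : exists S x u, [/\ npc T S U u,
  primitive 0 T S x (fun t => f t (x t) (u t)), x 0 = x0 0,
  forall t, 0 <= t <= T -> Omega (x t) &
  (forall b, h b (x T) = 0) /\ forall i, payoff i x0 u0 - s i < payoff i x u].
Proof.
have [d d0 [HO fL psiL]] := tube.
have dV : 0 <= d^-1 by rewrite invr_ge0 ltW.
have [C C0 HC] := C_bound.
have [fc _ [Ac _ _] fD] := f_smooth.
have [K1 K10 close] := traj_close T0 u0n x0p tkT vkU d0 dV C0 fc HO fL HC.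
have [K2 K20 cont] := traj_cont T0 u0n x0p tkT vkU d0 dV C0 fc HO fL HC.
pose xr r eta := traj T f x0 u0 S0 tk vk d r (beta eta).
pose ur r eta := nctrl u0 tk vk r (beta eta).
have TT : 0 <= T <= T by rewrite lexx ltW.
(* Continuity within a neighborhood becomes continuity at every point of a small ball, which
   contains all the endpoints once [r] is small. *)
have h_near : \forall r \near (0 : R)^'+, forall b y, `|y - x0 T| < r -> {for y, continuous (h b)}.
  apply: filter_forall => b; have [V nV cV] := h_cont b.
  have := continuous_subspaceW (@interior_subset _ V) cV.
  rewrite continuous_open_subspace; last exact: open_interior.
  move=> cV'; have /nbhs_ballP[r /= r0 Hr] : nbhs (x0 T) (V^°)%classic.
    exact: nbhs_interior.
  have rr : (0 : R) <= 0 < r by rewrite lexx.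
  apply: filterS (near_right_oo rr) => e /andP[e0 er] y yx; apply: cV'; rewrite inE; apply: Hr.
  by rewrite -ball_normE /ball_/= distrC; exact: lt_trans er.
have [rV rV0 HV] := near_rightP h_near.
have rV2 : 0 < rV / 2 < 0 + rV.
  by rewrite divr_gt0//= add0r ltr_pdivrMr// ltr_pMr// ltr1n.
set dh' := rV / 2 in rV2; have {}HV := HV _ rV2.
pose nice r := [/\ small T tk r, K1 * r <= d / 2 & K1 * r < dh'].
have nice_near : \forall r \near (0 : R)^'+, nice r.
  have K11 : 0 < K1 + 1 by rewrite ltr_wpDl.
  have n1 := small_near tkT.
  have e1 : (0 : R) <= 0 < d / 2 / (K1 + 1) by rewrite lexx !divr_gt0.
  have e2 : (0 : R) <= 0 < dh' / (K1 + 1) by rewrite lexx !divr_gt0//; case/andP: rV2.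
  apply: filterS (filterI n1 (filterI (near_right_oo e1) (near_right_oo e2))).
  move=> r [sr [/andP[r0 re] /andP[_ re']]]; split=> //.
    move: re; rewrite ltr_pdivlMr// mulrDr mulr1 mulrC; lra.
  move: re'; rewrite ltr_pdivlMr// mulrDr mulr1 mulrC; lra.
have sol r eta : nice r -> cube q 1 eta -> [/\ npc T (nbreaks tk r (beta eta) S0) U (ur r eta),
    primitive 0 T (nbreaks tk r (beta eta) S0) (xr r eta)
      (fun t => f t (xr r eta t) (ur r eta t)), xr r eta 0 = x0 0,
    forall t, 0 <= t <= T -> `|xr r eta t - x0 t| <= K1 * r &
    forall t, 0 <= t <= T -> `|xr r eta t - x0 t| < d].
  move=> [sr rd _] Heta; have bb := beta_box Heta.
  have cl t tT := close r (beta eta) t bb sr tT.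
  have d2 : d / 2 < d by rewrite ltr_pdivrMr// ltr_pMr// ltr1n.
  split=> [||||t tT].
  - exact: nctrl_npc.
  - apply: (traj_sol T0 u0n x0p tkT vkU d0 dV fc HO fL bb sr) => t tT.
    exact: le_trans (cl t tT) rd.
  - by have [] := trajP T0 u0n x0p tkT vkU d0 dV fc HO fL bb sr.
  - exact: cl.
  - exact: le_lt_trans (le_trans (cl t tT) rd) d2.
pose good r eta := [/\ forall i, payoff i x0 u0 - s i < payoff i (xr r eta) (ur r eta),
  forall b, eta 0 b = 1 -> 0 <= h b (xr r eta T) &
  forall b, eta 0 b = -1 -> h b (xr r eta T) <= 0].
(* Bad pairs with [r] tending to 0 are extracted; the expansion along them contradicts [beta_dir] at
   a limit point [eb] of the parameters. *)
have [r nr gr] : exists2 r, nice r & forall eta, cube q 1 eta -> good r eta.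
  apply: contrapT => ng.
  have [rb rb0 Hrb] := near_rightP nice_near.
  (* [n.+2] keeps every [r_ n], the first included, strictly inside the interval where [nice]
     holds. *)
  pose r_ n : R := rb / n.+2%:R.
  have r_0 n : 0 < r_ n by rewrite divr_gt0.
  have r_nice n : nice (r_ n).
    by apply: Hrb; rewrite r_0 add0r ltr_pdivrMr// ltr_pMr// ltr1n.
  have r_c : r_ @ \oo --> (0 : R).
    apply/cvgrPdist_lt => e e0; near=> n; rewrite sub0r normrN gtr0_norm//.
    rewrite /r_ ltr_pdivrMr// -ltr_pdivrMl//; apply: (@lt_trans _ _ n%:R); last by rewrite ltr_nat.
    by near: n; exact: nbhs_infty_gtr.
  have /choice[et Het] : forall n, exists eta, cube q 1 eta /\ ~ good (r_ n) eta.
    move=> n; apply: contrapT => Hn; apply: ng; exists (r_ n) => // eta Heta.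
    by apply: contrapT => gn; apply: Hn; exists eta.
  have [phi [eb [phin Heb phic]]] := compact_subseq (@cube_compact R q 1)
    (fun n => (Het n).1).
  pose r' n := r_ (phi n); pose e' n := et (phi n); pose X n := xr (r' n) (e' n).
  pose u' n := ur (r' n) (e' n).
  have r'0 n : 0 < r' n by exact: r_0.
  have He' n : cube q 1 (e' n) by case: (Het (phi n)).
  have r'c : r' @ \oo --> (0 : R) by exact: cvg_subseq.
  have bc k : (fun n => beta (e' n) k) @ \oo --> beta eb k.
    apply/cvgrPdist_lt => e e0; have KK : 0 < `|K0| + 1 by rewrite ltr_wpDl.
    have eK : 0 < e / (`|K0| + 1) by rewrite divr_gt0.
    have ce : \forall n \near \oo, `|eb - e' n| < e / (`|K0| + 1).
      by have /cvgrPdist_lt := phic; apply.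
    apply: filterS ce => n; rewrite ltr_pdivlMr// => Hn.
    apply: le_lt_trans (beta_lip _ _ _) _; apply: le_lt_trans Hn.
    by rewrite mulrC ler_wpM2l// (le_trans (ler_norm _))// lerDl.
  have soln n := sol (r' n) (e' n) (r_nice (phi n)) (He' n).
  have lim (F : normedModType R) (ph : R -> E -> Y -> F) (BB : R -> bounded_linear E F)
      (w : 'I_N -> R -> F) (y : nat -> R -> F) (y0 : R -> F) :
      smooth_output T Omega U x0 u0 S0 ph BB -> tube_lip T x0 u0 vk d d^-1 ph ->
      (forall k, primitive 0 T (tk k :: S0) (w k) (fun t => if t < tk k then 0 else BB t (z k t))) ->
      (forall k, w k (tk k) = ph (tk k) (x0 (tk k)) (vk k) - ph (tk k) (x0 (tk k)) (u0 (tk k))) ->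
      (forall n, primitive 0 T (nbreaks tk (r' n) (beta (e' n)) S0) (y n)
        (fun t => ph t (X n t) (u' n t))) ->
      primitive 0 T S0 y0 (fun t => ph t (x0 t) (u0 t)) ->
      (forall n, y n 0 = y0 0) ->
      (fun n => (r' n)^-1 *: (y n T - y0 T)) @ \oo --> \sum_k beta eb k *: w k T.
    move=> [phc _ [Bc _ _] phD] phL wp w0 yp y0p y_y0.
    apply: (output_limit T0 x0O x0c u0n tkT vkU (x_ := X) (r_ := r')
      (b_ := fun n => beta (e' n)) (d := d) (K := K1) _ _ r'c d0 K10 _ _ _ _
      (A := A) (f := f) (z := z) dV fc fL Ac fD _ _ _ x0p _ dV phc phL Bc phD wp w0 yp y0p y_y0 bc).
    - by move=> n; case: (r_nice (phi n)).
    - by move=> n; exact: beta_box.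
    - by move=> n; case: (soln n) => _ [].
    - by move=> n t tT; apply: (HO t) => //; case: (soln n) => _ _ _ _; apply.
    - by move=> n t tT; case: (soln n) => _ _ _ + _; apply.
    - by move=> n t tT; case: (soln n) => _ _ _ _; apply.
    - by move=> k; case: (z_var k).
    - by move=> k; case: (z_var k).
    - by move=> n; case: (soln n).
    - by move=> n; case: (soln n).
  have limX : (fun n => (r' n)^-1 *: (X n T - x0 T)) @ \oo --> \sum_k beta eb k *: z k T.
    apply: (lim E f A z) => //.
    - by move=> k; case: (z_var k).
    - by move=> k; case: (z_var k).
    - by move=> n; case: (soln n).
    - by move=> n; case: (soln n).
  have bl_comb (L : bounded_linear E R) :
      L (\sum_k beta eb k *: z k T) = \sum_k beta eb k * L (z k T).
    by rewrite (big_morph L (bl_D _) (bl_0 _)); apply: eq_bigr => k _; rewrite bl_Z scalerRE.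
  have limh b : (fun n => (r' n)^-1 * h b (X n T)) @ \oo --> \sum_k beta eb k * dh b (z k T).
    have := hadamard_seq (h_hadamard b) r'0 r'c limX; rewrite bl_comb.
    by under eq_fun do rewrite h0 subr0 scalerRE.
  have limP i : (fun n => (r' n)^-1 * (payoff i (X n) (u' n) - payoff i x0 u0)) @ \oo -->
      \sum_k beta eb k * (dG i (z k T) + zeta k i T).
    have limG := hadamard_seq (G_hadamard i) r'0 r'c limX.
    have [pc _ _ _] := psi_smooth i.
    have pn n : pcont 0 T (nbreaks tk (r' n) (beta (e' n)) S0) setT
        (fun t => psi i t (X n t) (u' n t)).
      have [un [Xc _] _ _ X_d] := soln n.
      have XO t (tT : 0 <= t <= T) : Omega (X n t) by exact: HO tT (X_d t tT).
      by have [] := comp_npc T0 pc Xc XO un.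
    have /choice[y Hy] : forall n, exists y : R -> R, y 0 = 0 /\
        primitive 0 T (nbreaks tk (r' n) (beta (e' n)) S0) y (fun t => psi i t (X n t) (u' n t)).
      by move=> n; exact: (@pcont_primitive R (R^o) _ _ _ _ (ltW T0) (pn n)).
    have [pn0 _ _] := comp_npc T0 pc x0c x0O u0n.
    have [y0 [y00 y0p]] := @pcont_primitive R (R^o) _ _ _ _ (ltW T0) pn0.
    have limy : (fun n => (r' n)^-1 *: (y n T - y0 T)) @ \oo --> \sum_k beta eb k *: zeta k i T.
      apply: (lim _ (psi i) (B i) (fun k => zeta k i)) => //.
      - by move=> k; case: (z_var k).
      - by move=> k; case: (z_var k).
      - by move=> n; case: (Hy n).
      - by move=> n; rewrite y00; case: (Hy n).
    have -> : \sum_k beta eb k * (dG i (z k T) + zeta k i T) =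
        dG i (\sum_k beta eb k *: z k T) + \sum_k beta eb k *: zeta k i T.
      by rewrite bl_comb -big_split; apply: eq_bigr => k _; rewrite scalerRE mulrDr.
    have -> : (fun n => (r' n)^-1 * (payoff i (X n) (u' n) - payoff i x0 u0)) =
        (fun n => (r' n)^-1 *: (G i (X n T) - G i (x0 T)) + (r' n)^-1 *: (y n T - y0 T)).
      apply/funext => n; have [yn0 ynp] := Hy n.
      rewrite /payoff (primitive_Rintegral T0 (pn n) ynp) (primitive_Rintegral T0 pn0 y0p).
      by rewrite yn0 y00 !scalerRE; ring.
    exact: cvgD limG limy.
  have [dir1 dir2 dir3] := beta_dir Heb.
  have ev_pos (a : nat -> R) (l : R) : (fun n => (r' n)^-1 * a n) @ \oo --> l -> 0 < l ->
      \forall n \near \oo, 0 < a n.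
    move=> al l0; have Hgt : \forall n \near \oo, 0 < (r' n)^-1 * a n by exact: cvgr_gt _ al _ l0.
    by apply: filterS Hgt => n; rewrite pmulr_rgt0// invr_gt0.
  (* With zero slack the limit of the quotients gives the sign; with positive slack it suffices that
     the change of the payoff tends to 0. *)
  have ev1 : \forall n \near \oo, forall i, payoff i x0 u0 - s i < payoff i (X n) (u' n).
    apply: filter_forall => i; have := s0 i; rewrite le_eqVlt => /predU1P[si|si].
      apply: filterS (ev_pos _ _ (limP i) (dir1 i (esym si))) => n.
      by rewrite -si subr0 subr_gt0.
    have lim0 : (fun n => r' n * ((r' n)^-1 * (payoff i (X n) (u' n) - payoff i x0 u0))) @ \oo -->
        (0 : R).
      rewrite -(mul0r (\sum_k beta eb k * (dG i (z k T) + zeta k i T))).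
      exact: cvgM r'c (limP i).
    have ns : - s i < 0 by rewrite oppr_lt0.
    have Hgt : \forall n \near \oo, - s i < r' n * ((r' n)^-1 * (payoff i (X n) (u' n) - payoff i x0 u0)).
      exact: cvgr_gt _ lim0 _ ns.
    apply: filterS Hgt => n; rewrite mulrA divff ?gt_eqF// mul1r; lra.
  (* Either [eb] lies on the face and the first-order term has the required sign, or [e' n] is
     eventually off that face and nothing is to be shown. *)
  have evb b (sg : R) : sg = 1 \/ sg = -1 ->
      \forall n \near \oo, e' n 0 b = sg -> 0 <= sg * h b (X n T).
    move=> Hsg; have [esg|esg] := eqVneq (eb 0 b) sg.
      have lim_sg : (fun n => (r' n)^-1 * (sg * h b (X n T))) @ \oo -->
          sg * \sum_k beta eb k * dh b (z k T).
        under eq_fun do rewrite mulrCA; apply: cvgM; [exact: cvg_cst|exact: limh].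
      have : 0 < sg * \sum_k beta eb k * dh b (z k T).
        case: Hsg esg => -> e1; first by rewrite mul1r; exact: dir2.
        by rewrite mulN1r oppr_gt0; exact: dir3.
      by move=> /(ev_pos _ _ lim_sg); apply: filterS => n /ltW.
    have dist0 : 0 < `|eb 0 b - sg| by rewrite normr_gt0 subr_eq0.
    have ce : \forall n \near \oo, `|eb - e' n| < `|eb 0 b - sg|.
      by have /cvgrPdist_lt := phic; apply.
    apply: filterS ce => n Hn en; exfalso; move: Hn; apply/negP; rewrite -leNgt.
    by rewrite -en; have := mx_coord_le (eb - e' n) b; rewrite !mxE.
  have evb1 : \forall n \near \oo, forall b, e' n 0 b = 1 -> 0 <= 1 * h b (X n T).
    by apply: filter_forall => b; apply: evb; left.
  have evb2 : \forall n \near \oo, forall b, e' n 0 b = -1 -> 0 <= -1 * h b (X n T).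
    by apply: filter_forall => b; apply: evb; right.
  have [n [Hn1 [Hn2 Hn3]]] : exists n, (forall i, payoff i x0 u0 - s i < payoff i (X n) (u' n)) /\
     (forall b, e' n 0 b = 1 -> 0 <= 1 * h b (X n T)) /\
     (forall b, e' n 0 b = -1 -> 0 <= -1 * h b (X n T)).
    exact: (filter_ex (filterI ev1 (filterI evb1 evb2))).
  apply: (Het (phi n)).2; split=> [//|b eb1|b eb1].
    by have := Hn2 b eb1; rewrite mul1r.
  by have := Hn3 b eb1; rewrite mulN1r oppr_ge0.
have [sr _ rdh] := nr; have r0 : 0 < r by case: sr.
(* At fixed [r] the endpoint is Lipschitz in [eta] through the weights, by [traj_cont]. *)
have hc b : {within cube q 1, continuous (fun eta => h b (xr r eta T))}.
  apply/subspace_continuousP => eta Heta.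
  have [_ _ _ cl _] := sol r eta nr Heta.
  have ch : {for xr r eta T, continuous (h b)}.
    by apply: HV; exact: le_lt_trans (cl T TT) rdh.
  apply: (cvg_comp (fun eta => xr r eta T) (h b) _ ch).
  apply/cvgrPdist_lt => e e0.
  have KK : 0 < K2 * (r * (N%:R * `|K0|)) + 1.
    by rewrite ltr_wpDl// !mulr_ge0// ltW.
  near=> eta'; have Heta' : cube q 1 eta' by near: eta'; exact: withinT.
  apply: le_lt_trans (cont r (beta eta) (beta eta') T (beta_box Heta) (beta_box Heta') sr TT) _.
  apply: (@le_lt_trans _ _ ((K2 * (r * (N%:R * `|K0|)) + 1) * `|eta - eta'|)).
    rewrite mulrDl mul1r; apply: ler_wpDr => //.
    rewrite -!mulrA ler_wpM2l// ler_wpM2l ?(ltW r0)//.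
    rewrite mulr_natl -[X in _ *+ X]card_ord -sumr_const; apply: ler_sum => k _.
    by apply: le_trans (beta_lip _ _ _) _; rewrite ler_wpM2r// ler_norm.
  rewrite mulrC -ltr_pdivlMr//; near: eta'.
  apply: cvg_within; apply/nbhs_ballP; exists (e / (K2 * (r * (N%:R * `|K0|)) + 1)).
    by rewrite /= divr_gt0.
  by move=> y; rewrite -ball_normE.
have [eta Heta h_eta] := poincare_miranda (@ltr01 R) hc
  (fun eta b Heta => let: And3 _ p _ := gr eta Heta in p b)
  (fun eta b Heta => let: And3 _ _ p := gr eta Heta in p b).
have [n1 n2 n3 n4 n5] := sol r eta nr Heta; have [g1 _ _] := gr eta Heta.
exists (nbreaks tk r (beta eta) S0), (xr r eta), (ur r eta); split=> // t tT.
exact: (HO t _ tT (n5 t tT)).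
Unshelve. all: by end_near. Qed.
End Needles.
(** Only times [t < T] occur, since a needle needs room to the right of its base point. *)
Definition is_multiplier (L : J + 'I_q -> R) :=
  [/\ exists i, L i != 0, forall i, 0 <= L (inl i), forall i, L (inl i) * s i = 0 &
    forall t v, 0 <= t < T -> U v -> exists z zeta, is_variation t v z zeta /\
      \sum_i L (inl i) * (dG i (z T) + zeta i T) + \sum_b L (inr b) * dh b (z T) <= 0].

Lemma is_multiplierZ (c : R) L : 0 < c -> is_multiplier L -> is_multiplier (fun i => c * L i).
Proof.
move=> c0 [[i Li] L0 Ls LV]; split=> [|k|k|t v tT Uv].
- by exists i; rewrite mulf_neq0// gt_eqF.
- by rewrite mulr_ge0// ltW.
- by rewrite -mulrA Ls mulr0.
- have [z [zeta [zv H]]] := LV t v tT Uv; exists z, zeta; split=> //.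
  under eq_bigr do rewrite -mulrA; under [X in _ + X]eq_bigr do rewrite -mulrA.
  by rewrite -!mulr_sumr -mulrDr pmulr_rle0.
Qed.

Lemma multipliers :
  ~ (exists S x u, [/\ npc T S U u, primitive 0 T S x (fun t => f t (x t) (u t)), x 0 = x0 0,
      forall t, 0 <= t <= T -> Omega (x t) &
      (forall b, h b (x T) = 0) /\ forall i, payoff i x0 u0 - s i < payoff i x u]) ->
  exists L, is_multiplier L.
Proof.
move=> optimal; pose Q (p : R * Y) := 0 <= p.1 < T /\ U p.2.
have /choice[w Hw] : forall p : R * Y, exists w : (R -> E) * (J -> R -> R),
    Q p -> is_variation p.1 p.2 w.1 w.2.
  move=> p; have [[pT pU]|nQ] := pselect (Q p).
    by have [w Hw] := is_variation_exists p.2 pT; exists w.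
  by exists (fun=> 0, fun _ => fun=> 0).
pose V (i : J + 'I_q) p := match i with
  | inl i => dG i ((w p).1 T) + (w p).2 i T
  | inr b => dh b ((w p).1 T)
  end.
have [[L [L0 Lge0 Lact LV]]|[n [pt [beta [Qp bbox [K blip] bdir]]]]] :=
    needle_alternative Q (fun i => s i == 0) V.
  exists L; split=> // [i|t v tT Uv].
    by have [->|/Lact ->] := eqVneq (s i) 0; rewrite ?mulr0 ?mul0r.
  have Qtv : Q (t, v) by split.
  exists (w (t, v)).1, (w (t, v)).2; split; first exact: (Hw (t, v)).
  by have := LV _ Qtv; rewrite big_sumType.
exfalso; apply: optimal.
apply: (needles_improve (tk := fun k => (pt k).1) (vk := fun k => (pt k).2) (beta := beta)
  (z := fun k => (w (pt k)).1) (zeta := fun k => (w (pt k)).2) (K0 := K)) => //.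
- by move=> k; case: (Qp k).
- by move=> k; case: (Qp k).
- by move=> k; exact: (Hw (pt k)).
- by move=> eta Heta; have [H1 H2 H3] := bdir eta Heta; split=> // i /eqP; exact: H1.
Qed.
End Improvement.

(** * Costate and maximum principle *)

Section Reversal.
Context {R : realType}.
Implicit Types (T t : R).

Lemma reverse_at_right T t : (fun s => T - s) @ t^'+ --> (T - t)^'-.
Proof.
move=> P /near_leftP[r r0 Hr]; have tt : t <= t < t + r by rewrite lexx ltrDl.
apply: filterS (near_right_oo tt) => s /andP[ts sr]; apply: Hr; apply/andP; split; lra.
Qed.

Lemma reverse_at_left T t : (fun s => T - s) @ t^'- --> (T - t)^'+.
Proof.
move=> P /near_rightP[r r0 Hr]; have tt : t - r < t <= t by rewrite lexx ltrBlDr ltrDl r0.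
apply: filterS (near_left_oo tt) => s /andP[ts sr]; apply: Hr; apply/andP; split; lra.
Qed.

(** Reversal exchanges left and right limits, so it preserves [pcont] but not the right continuity
    of [npc]; the normalization is recovered in [costate_PC1]. *)
Lemma pcont_reverse (W : topologicalType) T S (U : set W) G :
  pcont 0 T S U G -> pcont 0 T [seq T - s | s <- S] U (fun t => G (T - t)).
Proof.
move=> [GU Gc Gr Gl]; split=> [t tT|t tT tS|t tT|t tT].
- by apply: GU; lra.
- have Tt : {for T - t, continuous G}.
    apply: Gc; first by lra.
    by apply: contra tS => ?; apply/mapP; exists (T - t) => //; rewrite subKr.
  apply: (@continuous_comp _ _ _ (fun t => T - t) G) Tt.
  by apply: cvgB; [exact: cvg_cst|exact: cvg_id].
- have [|y Uy Gy] := Gl (T - t); first by lra.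
  by exists y => //; exact: cvg_comp (@reverse_at_right T t) Gy.
- have [|y Uy Gy] := Gr (T - t); first by lra.
  by exists y => //; exact: cvg_comp (@reverse_at_left T t) Gy.
Qed.

Lemma primitive_reverse (W : normedModType R) T S (x G : R -> W) :
  primitive 0 T [seq T - s | s <- S] x G ->
  primitive 0 T S (fun t => x (T - t)) (fun t => - G (T - t)).
Proof.
move=> [/within_continuous_eps xc xd]; split.
  apply/within_continuous_eps => t tT e e0.
  have [|d d0 Hd] := xc (T - t) _ e e0; first by lra.
  exists d => // s sT st; apply: Hd; first by lra.
  by rewrite (_ : T - s - (T - t) = t - s) ?[`|t - s|]distrC//; ring.
move=> t tT tS; apply/is_derive_eps => e e0.
have tS' : T - t \notin [seq T - s | s <- S].
  by apply: contra tS => /mapP[s sS /eqP]; rewrite (inj_eq (subrI T)) => /eqP ->.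
have [|r r0 Hr] := (is_derive_eps _ _ _).1 (xd (T - t) _ tS') e e0; first by lra.
exists r => // s sr; have := Hr (T - s).
rewrite (_ : T - s - (T - t) = - (s - t)); last by ring.
by rewrite normrN scaleNr scalerN opprK; apply.
Qed.

End Reversal.

Section Costate.
Context {R : realType} {E : completeNormedModType R}.
Variables (T : R) (S0 : seq R) (A : R -> bounded_linear E E) (B : R -> bounded_linear E R).
Hypothesis T0 : 0 < T.
Hypothesis A_npc : npc T S0 setT A.
Hypothesis B_npc : npc T S0 setT B.

(** Reversing time turns the terminal value problem into an initial value problem; the equation is
    affine in the costate, and a bound of [A] is its Lipschitz constant. *)
Lemma costate_exists (pT : bounded_linear E R) : exists p, p T = pT /\
  primitive 0 T S0 p (fun t => - (bl_comp (p t) (A t) + B t)).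
Proof.
have [Ac _ _] := A_npc; have [Bc _ _] := B_npc.
have [M M0 AM] := pcont_bounded (ltW T0) Ac.
pose F t (v : bounded_linear E R) := bl_comp v (A (T - t)) + B (T - t).
have [||||x [x0 xp]] := @ode_exists R (bounded_linear E R) 0 T
    [seq T - s | s <- S0] F M pT => //.
- exact: ltW.
- move=> t v w tT _; rewrite /F (_ : _ - _ = bl_comp (v - w) (A (T - t))); last first.
    by apply: bl_ext => y; rewrite !(blDE, blNE, bl_compE); ring.
  apply: le_trans (bl_comp_norm _ _) _; rewrite mulrC ler_wpM2r// AM//; lra.
- move=> x cx; apply: pcontD; last exact: pcont_reverse.
  apply: (pcont_map2 (@bl_comp_continuous R E E R)); last exact: pcont_reverse.
  exact: pcont_continuous.
exists (fun t => x (T - t)); split; first by rewrite subrr.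
apply: primitive_ext (primitive_reverse xp) => // t tT _.
by rewrite /F subKr.
Qed.

Lemma costate_PC1 p : primitive 0 T S0 p (fun t => - (bl_comp (p t) (A t) + B t)) ->
  PC1 T setT p /\ forall t, 0 <= t <= T -> ext_deriv T p t = - (bl_comp (p t) (A t) + B t).
Proof.
move=> pp; have [cp _] := pp; apply: (primitive_PC1 T0 _ pp) => //.
have pn : npc T S0 setT p by exact: npc_continuous.
have := npc_pair (npc_pair pn A_npc) B_npc.
apply: (npc_comp (Phi := fun w => - (bl_comp w.1.1 w.1.2 + w.2)) T0) => //.
apply: continuous_subspaceT => w; apply: cvgN; apply: cvgD; last exact: cvg_snd.
apply: (@continuous_comp _ _ _ (fun w => w.1) (fun w => bl_comp w.1 w.2)); first exact: cvg_fst.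
exact: bl_comp_continuous.
Qed.

End Costate.

Lemma primitive_eval (R : realType) (X W : normedModType R) (a b : R) S
    (p p' : R -> bounded_linear X W) (z z' : R -> X) :
  primitive a b S p p' -> primitive a b S z z' ->
  primitive a b S (fun t => p t (z t)) (fun t => p' t (z t) + p t (z' t)).
Proof.
move=> [pc pd] [zc zd]; split=> [t|t tab tS].
  apply: (@continuous_comp (subspace _) _ _ (fun t => (p t, z t)) (fun w => w.1 w.2) t).
    exact: cvg_pair (pc t) (zc t).
  exact: bl_eval_continuous.
exact: is_derive_eval (pd t tab tS) (zd t tab tS).
Qed.

Section MaximumPrinciple.
Context {R : realType} {E : completeNormedModType R} {Y : topologicalType} {J : finType}.
Variables (T : R) (Omega : set E) (U : set Y) (f : R -> E -> Y -> E).
Variables (x0 : R -> E) (u0 : R -> Y) (S0 : seq R) (A : R -> bounded_linear E E).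
Variables (psi : J -> R -> E -> Y -> R) (B : J -> R -> bounded_linear E R).
Variables (L : J -> R) (p : R -> bounded_linear E R).
Hypothesis T0 : 0 < T.
Hypothesis x0O : forall t, 0 <= t <= T -> Omega (x0 t).
Hypothesis x0c : {within `[0, T], continuous x0}.
Hypothesis u0n : npc T S0 U u0.
Hypothesis fc : {within `[0, T]%classic `*` Omega `*` U,
  continuous (fun w : R * E * Y => f w.1.1 w.1.2 w.2)}.
Hypothesis psic : forall i, {within `[0, T]%classic `*` Omega `*` U,
  continuous (fun w : R * E * Y => psi i w.1.1 w.1.2 w.2)}.
Hypothesis pp : primitive 0 T S0 p (fun t => - (bl_comp (p t) (A t) + \sum_i L i *: B i t)).

Definition ham t v : R := \sum_i L i * psi i t (x0 t) v + p t (f t (x0 t) v).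

(** The left-hand side, taken at a running time instead of [T], is constant on [[t, T]]: the adjoint
    equation is such that the derivatives cancel. At [t] the jumps of [z] and [zeta] make it the
    difference of the Hamiltonians. *)
Lemma duality t v z zeta : 0 <= t < T ->
  is_variation T f x0 u0 S0 A psi B t v z zeta ->
  p T (z T) + \sum_i L i * zeta i T = ham t v - ham t (u0 t).
Proof.
move=> /andP[t0 tT] [zt zp zetat zetap].
have pp' : primitive 0 T (t :: S0) p (fun t => - (bl_comp (p t) (A t) + \sum_i L i *: B i t)).
  by apply: primitive_subS pp => s sS; rewrite inE sS orbT.
have Dp := primitiveD (primitive_eval pp' zp)
  (primitive_sum (index_enum J) (fun i => primitiveZ (L i) (zetap i))).
have /(mvt_norm_cst (ltW tT)) := primitive_sub t0 (lexx T) Dp.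
move=> /(_ 0); rewrite mul0r normr_le0 subr_eq0 => H.
have /eqP -> : p T (z T) + \sum_i L i *: zeta i T == p t (z t) + \sum_i L i *: zeta i t.
  apply: H => s /andP[ts sT] _; have -> : (s < t) = false by apply/negbTE; rewrite -leNgt ltW.
  rewrite normr_le0 blNE blDE bl_compE bl_sumE.
  under [X in - (_ + X)]eq_bigr do rewrite blZE.
  by apply/eqP; zmod.
rewrite zt bl_B /ham; under eq_bigr do rewrite zetat scalerBr.
by rewrite sumrB; ring.
Qed.

Let ham_cvg (F : set_system R) {FF : Filter F} t (u : R -> Y) y : 0 <= t <= T ->
  F --> t -> (\forall s \near F, 0 <= s <= T) ->
  u @ F --> y -> U y -> (forall s, 0 <= s <= T -> U (u s)) ->
  (fun s => ham s (u s)) @ F --> ham t y.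
Proof.
move=> tT Ft FT uy Uy uU.
have [pc _] := pp.
have xF : x0 @ F --> x0 t by exact: within_continuous_cvg.
have pF : p @ F --> p t by exact: within_continuous_cvg.
have one (W : normedModType R) (phi : R -> E -> Y -> W) :
    {within `[0, T]%classic `*` Omega `*` U,
      continuous (fun w : R * E * Y => phi w.1.1 w.1.2 w.2)} ->
    (fun s => phi s (x0 s) (u s)) @ F --> phi t (x0 t) y.
  move=> phic.
  apply: (cvg_within_comp (G := fun s => (s, x0 s, u s)) (y := (t, x0 t, y)) phic).
  - by split=> //; split; [rewrite /= in_itv|exact: x0O].
  - have idF : (@id R) @ F --> t by exact: Ft.
    exact: cvg_pair (cvg_pair idF xF) uy.
  - apply: filterS FT => s sT; split; last exact: uU.
    by split; [rewrite /= in_itv|exact: x0O].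
apply: cvgD; last first.
  exact: (cvg_comp (fun s => (p s, f s (x0 s) (u s))) (fun w => w.1 w.2)
    (cvg_pair pF (one _ f fc)) (@bl_eval_continuous R E R (p t, f t (x0 t) y))).
apply: cvg_big => [|i _]; first exact: add_continuous.
by apply: cvgM; [exact: cvg_cst|exact: one].
Qed.

Hypothesis ham_max : forall t v, 0 <= t < T -> U v -> ham t v <= ham t (u0 t).

Let uU t : 0 <= t <= T -> U (u0 t).
Proof. by case: u0n => -[H _ _ _] _ _; exact: H. Qed.

Let ham_left (u : R -> Y) t y : 0 < t <= T -> u @ t^'- --> y -> U y ->
  (forall s, 0 <= s <= T -> U (u s)) -> (fun s => ham s (u s)) @ t^'- --> ham t y.
Proof.
move=> tT; apply: ham_cvg.
- by case/andP: tT => /ltW -> ->.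
- by apply: cvg_at_left_filter; exact: cvg_id.
- by apply: filterS (near_left_oo tT) => s /andP[/ltW -> /ltW ->].
Qed.

(** Needles start before [T], so the inequality at [T] is a limit from the left, where [u0] is
    continuous by normalization. *)
Lemma ham_max_closed t v : 0 <= t <= T -> U v -> ham t v <= ham t (u0 t).
Proof.
move=> /andP[t0]; rewrite le_eqVlt => /predU1P[-> Uv|tT]; last by apply: ham_max; rewrite t0.
have TT : 0 < T <= T by rewrite T0 lexx.
have [_ _ uT] := u0n.
have uTT : U (u0 T) by apply: uU; rewrite lexx ltW.
have lim2 := ham_left TT uT uTT uU.
have lim1 : (fun s => ham s v) @ T^'- --> ham T v.
  by apply: (ham_left (u := fun=> v)) => //; exact: cvg_cst.
apply: (ler_cvg_to lim1 lim2); apply: filterS (near_left_oo TT) => s /andP[s0 sT].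
by apply: ham_max; rewrite ?ltW.
Qed.

(** At a jump, the left limit [y] of [u0] and the value [u0 t] give the same Hamiltonian: the value
    is maximal at [t], and the limit of the maximality at earlier times gives the reverse
    inequality. *)
Lemma ham_continuous : {within `[0, T], continuous (fun t => ham t (u0 t))}.
Proof.
have left_ t : 0 < t <= T -> (fun s => ham s (u0 s)) @ t^'- --> ham t (u0 t).
  move=> tT; have [[_ _ _ ul] _ _] := u0n; have [y Uy uy] := ul t tT.
  have tT' : 0 <= t <= T by case/andP: tT => /ltW -> ->.
  have lim1 := ham_left tT uy Uy uU.
  have lim2 : (fun s => ham s (u0 t)) @ t^'- --> ham t (u0 t).
    by apply: (ham_left (u := fun=> u0 t)) => //; [exact: cvg_cst|exact: uU|move=> *; exact: uU].
  suff <- : ham t y = ham t (u0 t) by [].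
  apply/eqP; rewrite eq_le ham_max_closed//=.
  apply: (ler_cvg_to lim2 lim1); apply: filterS (near_left_oo tT) => s /andP[s0 st].
  apply: ham_max_closed; last exact: uU.
  by rewrite ltW// (le_trans (ltW st))//; case/andP: tT.
have right_ t : 0 <= t < T -> (fun s => ham s (u0 s)) @ t^'+ --> ham t (u0 t).
  move=> tT; have [_ ur _] := u0n; have /andP[t0 /ltW tT'] := tT.
  apply: ham_cvg => //; first by rewrite t0.
  - by apply: cvg_at_right_filter; exact: cvg_id.
  - by apply: filterS (near_right_oo tT) => s /andP[s0 /ltW ->]; rewrite (ltW s0).
  - exact: ur.
  - by apply: uU; rewrite t0.
apply/within_continuous_eps => t /andP[t0 tT] e e0; have e2 : 0 < e / 2 by rewrite divr_gt0.
have e2e : e / 2 < e by rewrite ltr_pdivrMr// ltr_pMr// ltr1n.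
have [r1 r10 H1] : exists2 r, 0 < r & forall s, 0 <= s <= T -> t - r < s < t ->
    `|ham s (u0 s) - ham t (u0 t)| <= e / 2.
  move: t0; rewrite le_eqVlt => /predU1P[<-|t0].
    by exists 1 => // s /andP[s0 _] /andP[_]; rewrite ltNge s0.
  have [|r r0 Hr] := cvg_left_eps (left_ t _) e2; first by rewrite t0.
  by exists r => // s _; exact: Hr.
have [r2 r20 H2] : exists2 r, 0 < r & forall s, 0 <= s <= T -> t < s < t + r ->
    `|ham s (u0 s) - ham t (u0 t)| <= e / 2.
  move: tT; rewrite le_eqVlt => /predU1P[->|tT].
    by exists 1 => // s /andP[_ sT] /andP[]; rewrite ltNge sT.
  have [|r r0 Hr] := cvg_right_eps (right_ t _) e2; first by rewrite t0.
  by exists r => // s _; exact: Hr.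
exists (Num.min r1 r2); first by rewrite lt_min r10.
move=> s sT; rewrite lt_min => /andP[/ltr_normlP[a1 a2] /ltr_normlP[b1 b2]].
apply: le_lt_trans e2e; have [st|ts|->] := ltgtP s t.
- by apply: H1 => //; lra.
- by apply: H2 => //; lra.
- by rewrite subrr normr0 ltW.
Qed.

End MaximumPrinciple.

(** * Frechet calculus and the differential of the Hamiltonian *)

Section FrechetAlgebra.
Context {R : realType} {X V W : normedModType R}.
Implicit Types (x : X).

Lemma frechet_unique (f : X -> V) x A B : is_frechet f x A -> is_frechet f x B -> A = B.
Proof. by move=> [_ fA] [_ fB]; apply: bl_ext => y; rewrite -fA fB. Qed.

Lemma is_frechet_cst x (v : V) : is_frechet (fun=> v) x 0.
Proof.
apply/frechet_eps => e e0; exists 1 => // y _.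
by rewrite subrr bl0E subrr normr0 mulr_ge0// ltW.
Qed.

Lemma is_frechetD (f g : X -> V) x A B : is_frechet f x A -> is_frechet g x B ->
  is_frechet (fun y => f y + g y) x (A + B).
Proof.
move=> /frechet_eps fA /frechet_eps gB; apply/frechet_eps => e e0.
have e2 : 0 < e / 2 by rewrite divr_gt0.
have [r r0 Hr] := fA _ e2; have [r' r'0 Hr'] := gB _ e2.
exists (Num.min r r') => [|y]; first by rewrite lt_min r0.
rewrite lt_min => /andP[/Hr H /Hr' H']; rewrite blDE.
have -> : f y + g y - (f x + g x) - (A (y - x) + B (y - x)) =
  (f y - f x - A (y - x)) + (g y - g x - B (y - x)) by zmod.
by apply: le_trans (ler_normD _ _) _; rewrite [e]splitr mulrDl lerD.
Qed.

Lemma is_frechet_comp (L : bounded_linear V W) (f : X -> V) x A : is_frechet f x A ->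
  is_frechet (fun y => L (f y)) x (bl_comp L A).
Proof.
move=> /frechet_eps fA; apply/frechet_eps => e e0.
have L1 : 0 < `|L| + 1 by rewrite ltr_wpDl.
have [r r0 Hr] := fA _ (divr_gt0 e0 L1); exists r => // y /Hr H.
rewrite bl_compE -!bl_B; apply: le_trans (bl_le _ _) _.
apply: (@le_trans _ _ ((`|L| + 1) * (e / (`|L| + 1) * `|y - x|))).
  by rewrite ler_pM// lerDl.
by rewrite mulrA [X in X * _]mulrC divfK// gt_eqF.
Qed.

Lemma is_frechetZ (c : R) (f : X -> V) x A : is_frechet f x A ->
  is_frechet (fun y => c *: f y) x (c *: A).
Proof.
move=> /frechet_eps fA; apply/frechet_eps => e e0.
have c1 : 0 < `|c| + 1 by rewrite ltr_wpDl.
have [r r0 Hr] := fA _ (divr_gt0 e0 c1); exists r => // y /Hr H.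
rewrite blZE -!scalerBr normrZ.
apply: (@le_trans _ _ ((`|c| + 1) * (e / (`|c| + 1) * `|y - x|))).
  by rewrite ler_pM// lerDl.
by rewrite mulrA [X in X * _]mulrC divfK// gt_eqF.
Qed.

Lemma is_frechet_sum (I : Type) (r : seq I) (f : I -> X -> V) x (A : I -> bounded_linear X V) :
  (forall i, is_frechet (f i) x (A i)) ->
  is_frechet (fun y => \sum_(i <- r) f i y) x (\sum_(i <- r) A i).
Proof.
move=> fA; elim: r => [|i r IH].
  by rewrite big_nil (_ : (fun=> _) = fun=> 0) ?funeqE => [|y]; [exact: is_frechet_cst|rewrite big_nil].
rewrite big_cons (_ : (fun=> _) = fun y => f i y + \sum_(i <- r) f i y).
  exact: is_frechetD.
by apply/funext => y; rewrite big_cons.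
Qed.

Lemma DFE (f : X -> V) x A : is_frechet f x A -> DF f x = A.
Proof. by move=> fA; apply: frechet_unique (fA); apply: DFP; exists A. Qed.

End FrechetAlgebra.

Lemma DF_hamiltonian (R : realType) (E : completeNormedModType R) (Y : topologicalType) (l : nat)
    (f : R -> E -> Y -> E) (f0 : 'I_l -> R -> E -> Y -> R) t xi w p theta :
  frechet_differentiable (f t ^~ w) xi ->
  (forall i, frechet_differentiable (f0 i t ^~ w) xi) ->
  DF (fun xi => hamiltonian f f0 t xi w p theta) xi =
    bl_comp p (DF (f t ^~ w) xi) + \sum_i theta 0 i *: DF (f0 i t ^~ w) xi.
Proof.
move=> /DFP df df0; apply: DFE; rewrite addrC; apply: is_frechetD.
  by apply: is_frechet_sum => i; apply: (is_frechetZ (V := R^o)); exact: DFP.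
exact: is_frechet_comp.
Qed.

Lemma npc_sum (R : realType) (V : normedModType R) (T : R) S (I : Type) (r : seq I)
    (c : I -> R) (F : I -> R -> V) : 0 < T -> (forall i, npc T S setT (F i)) ->
  npc T S setT (fun t => \sum_(i <- r) c i *: F i t).
Proof.
move=> T0 FN; elim: r => [|i r IH].
  under eq_fun do rewrite big_nil.
  by apply: npc_continuous => // t; exact: cvg_cst.
under eq_fun do rewrite big_cons.
apply: (npc_comp (Phi := fun w : V * V => c i *: w.1 + w.2) T0 _ _ (npc_pair (FN i) IH)) => //.
apply: continuous_subspaceT => w; apply: cvgD; last exact: cvg_snd.
by apply: cvgZr; exact: cvg_fst.
Qed.

(** * From the Bolza problem to the abstract multiplier rule *)

Section Reduction.
Context {R : realType} {E : completeNormedModType R} {Y : topologicalType} {l m q : nat}.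
Variables (T : R) (Omega : set E) (U : set Y) (xi0 : E).
Variables (f : R -> E -> Y -> E) (f0 : 'I_l -> R -> E -> Y -> R).
Variables (g0 : 'I_l -> E -> R) (g : 'I_m -> E -> R) (h : 'I_q -> E -> R).
Variables (x0 : R -> E) (u0 : R -> Y).
Hypothesis T0 : 0 < T.
Hypothesis l_gt0 : (0 < l)%N.
Hypothesis Omega_open : open Omega.
Hypothesis opt : pareto_optimal T Omega U xi0 f f0 g0 g h x0 u0.
Hypothesis f0_reg : forall i, regular_along T Omega U x0 (f0 i).
Hypothesis f_reg : regular_along T Omega U x0 f.
Hypothesis g0_hadamard : forall i, hadamard_differentiable (g0 i) (x0 T).
Hypothesis g_hadamard : forall a, hadamard_differentiable (g a) (x0 T).
Hypothesis h_reg : forall b, (exists2 V, nbhs (x0 T) V & {within V, continuous (h b)}) /\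
  hadamard_differentiable (h b) (x0 T).

Let J : finType := ('I_l + 'I_m)%type.
Let A t := DF (f t ^~ (u0 t)) (x0 t).
Let psi (i : J) : R -> E -> Y -> R := match i with inl i => f0 i | inr _ => fun _ _ _ => 0 end.
Let B (i : J) t : bounded_linear E R :=
  match i with inl i => DF (f0 i t ^~ (u0 t)) (x0 t) | inr _ => 0 end.
Let G (i : J) := match i with inl i => g0 i | inr a => g a end.
Let dG (i : J) : bounded_linear E R :=
  match i with inl i => DH (g0 i) (x0 T) | inr a => DH (g a) (x0 T) end.
Let s (i : J) := match i with inl _ => 0 | inr a => g a (x0 T) end.
Let dh b := DH (h b) (x0 T).

Let x0O t : 0 <= t <= T -> Omega (x0 t).
Proof. by move=> tT; have [[[xO _ _] _ _ _] _] := opt; apply: xO; rewrite in_itv. Qed.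

Let base : exists S0, npc T S0 U u0 /\ primitive 0 T S0 x0 (fun t => f t (x0 t) (u0 t)).
Proof.
have [[x0_PC1 u0_NPC0 dx _] _] := opt.
have [S1 H1] := PC1_primitive x0_PC1; have [S2 H2] := NPC0_npc u0_NPC0.
exists (S1 ++ S2); split.
  by apply: npc_subS H2 => t tS; rewrite mem_cat tS orbT.
apply: primitive_ext (primitive_subS _ H1) => [//|t tT _|t tS]; last by rewrite mem_cat tS.
by apply: dx; rewrite in_itv /=; case/andP: tT => *; rewrite !ltW.
Qed.

Let smooth S0 : npc T S0 U u0 -> {within `[0, T], continuous x0} ->
  smooth_output T Omega U x0 u0 S0 f A /\
  forall i, smooth_output T Omega U x0 u0 S0 (psi i) (B i).
Proof.
move=> un xc; split=> [|[i|a]]; first exact: (regular_smooth T0 Omega_open xc x0O un f_reg).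
  exact: (regular_smooth T0 Omega_open xc x0O un (f0_reg i)).
(* The zero running cost of a constraint borrows its tube inside [Omega] from the running cost of an
   objective. *)
have [_ /(_ _ _ un)[eta eta0 Heta] _ _] :=
  regular_smooth T0 Omega_open xc x0O un (f0_reg (Ordinal l_gt0)).
have HO t xi : 0 <= t <= T -> `|xi - x0 t| < eta -> Omega xi.
  by move=> tT; case: (Heta t tT) => + _; apply.
exact: (smooth_output0 U u0 S0 T0 R^o eta0 HO).
Qed.

Lemma multiplier_exists : exists S0 L, [/\ npc T S0 U u0,
  primitive 0 T S0 x0 (fun t => f t (x0 t) (u0 t)) &
  is_multiplier T U f x0 u0 S0 A psi B dG s dh L].
Proof.
have [S0 [un xp]] := base; have [xc _] := xp.
have [f_smooth psi_smooth] := smooth un xc.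
have [adm better] := opt; have [_ _ _ [x00 g_ge0 h_eq0]] := adm.
have intP (i : J) (x : R -> E) u : payoff T psi G i x u = match i with
    inl i => objective T f0 g0 i x u | inr a => g a (x T) end.
  case: i => [//|a]; rewrite /payoff /=.
  have := primitive_Rintegral T0 _ (primitive_cst 0 T [::] (0 : R)).
  rewrite subrr => ->; first by rewrite addr0.
  by apply: pcont_continuous => // t; exact: cvg_cst.
have [||||||L HL] := @multipliers R E Y J q T Omega U f x0 u0 S0 A psi B G dG s h dh
   T0 x0O un xp f_smooth psi_smooth => //.
- by case=> [i|a]; apply: DHP; [exact: g0_hadamard|exact: g_hadamard].
- by case=> [i|a] /=.
- by move=> b; apply: DHP; case: (h_reg b).
- by move=> b; case: (h_reg b).
- move=> [S [x [u [nu px x_0 xO [hx Jx]]]]]; apply: better; exists x, u.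
  have Jl i : objective T f0 g0 i x0 u0 < objective T f0 g0 i x u.
    by have := Jx (inl i); rewrite !intP subr0.
  split; last by exists (Ordinal l_gt0).
    have [fc _ _ _ _] := f_reg; have [xc' _] := px.
    have fn := comp_npc T0 fc xc' xO nu.
    have [xPC1 dx] := primitive_PC1 T0 xO px fn.
    split=> //; first exact: npc_NPC0 nu.
    split=> [|a|//]; first by rewrite x_0.
    by have := Jx (inr a); rewrite !intP subrr => /ltW.
  by move=> i; rewrite ltW.
by exists S0, L.
Qed.

Lemma multiplier_pontryagin S0 L : npc T S0 U u0 ->
  primitive 0 T S0 x0 (fun t => f t (x0 t) (u0 t)) ->
  is_multiplier T U f x0 u0 S0 A psi B dG s dh L ->
  exists p, PC1 T setT p /\ pontryagin_conditions T U f f0 g0 g h x0 u0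
    (\row_i L (inl (inl i))) (\row_a L (inl (inr a))) (\row_b L (inr b)) p.
Proof.
move=> un xp [[i0 Li0] L0 Ls LV]; have [xc _] := xp.
have [f_smooth psi_smooth] := smooth un xc.
have [fc _ An _] := f_smooth.
have psic i := let: And4 pc _ _ _ := psi_smooth i in pc.
pose BL t := \sum_i L (inl i) *: B i t.
have BLE t : BL t = \sum_i L (inl (inl i)) *: DF (f0 i t ^~ (u0 t)) (x0 t).
  by rewrite /BL big_sumType /= [X in _ + X]big1 ?addr0// => a _; rewrite scaler0.
have BLn : npc T S0 setT BL.
  by apply: npc_sum => // i; case: (psi_smooth i).
pose pT := \sum_i L (inl i) *: dG i + \sum_b L (inr b) *: dh b.
have [p [pTE pp]] := costate_exists T0 An BLn pT.
have [pPC1 dp] := costate_PC1 T0 An BLn pp.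
have [pc _] := pp.
exists p; split=> //.
have hamE t v : hamiltonian f f0 t (x0 t) v (p t) (\row_i L (inl (inl i))) =
    ham f x0 psi (L \o inl) p t v.
  rewrite /ham /hamiltonian big_sumType /= [X in _ = _ + X + _]big1 ?addr0.
    by congr (_ + _); apply: eq_bigr => i _; rewrite mxE.
  by move=> a _; rewrite mulr0.
have ham_max t v : 0 <= t < T -> U v ->
    ham f x0 psi (L \o inl) p t v <= ham f x0 psi (L \o inl) p t (u0 t).
  move=> tT Uv; have [z [zeta [zv H]]] := LV t v tT Uv.
  rewrite -subr_le0 -(duality pp tT zv) pTE /pT blDE !bl_sumE; apply: le_trans H.
  under [X in _ <= X + _]eq_bigr do rewrite mulrDr.
  by rewrite big_split /= addrAC.
have max := ham_max_closed T0 x0O xc un fc psic pp ham_max.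
split.
- move=> [th0 la0 mu0]; move/eqP: Li0; apply; case: i0 => [[i|a]|b].
  + by have /rowP/(_ i) := th0; rewrite !mxE.
  + by have /rowP/(_ a) := la0; rewrite !mxE.
  + by have /rowP/(_ b) := mu0; rewrite !mxE.
- by split=> i; rewrite mxE.
- by move=> a; rewrite mxE; exact: (Ls (inr a)).
- rewrite pTE /pT big_sumType /=; congr (_ + _ + _); apply: eq_bigr => i _; by rewrite mxE.
- split=> [t tT|t v tT Uv|].
  + have tT' : 0 <= t <= T by rewrite in_itv in tT.
    have Ut : U (u0 t) by case: un => -[H _ _ _] _ _; exact: H.
    rewrite dp// DF_hamiltonian; last first.
    * by move=> i; have [_ _ H _ _] := f0_reg i; exact: H.
    * by have [_ _ H _ _] := f_reg; exact: H.
    by rewrite BLE; congr (- (_ + _)); apply: eq_bigr => i _; rewrite mxE.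
  + by rewrite !hamE; apply: max => //; rewrite in_itv in tT.
  + have -> : (fun t => hamiltonian f f0 t (x0 t) (u0 t) (p t) (\row_i L (inl (inl i)))) =
        (fun t => ham f x0 psi (L \o inl) p t (u0 t)) by apply/funext => t; exact: hamE.
    exact: (ham_continuous T0 x0O xc un fc psic pp ham_max).
Qed.

End Reduction.

(** * Stationarity at the final time and uniqueness *)

(** At an interior maximum the one-sided derivatives are nonpositive in every direction; being
    linear in the direction, they vanish. A zero coefficient may replace differentiability, as for
    [f0 j] when [theta 0 j = 0]. *)
Lemma stationary_max (R : realType) (E Y : normedModType R) (l : nat) (U : set Y) (v0 : Y)
    (F : Y -> E) (F0 : 'I_l -> Y -> R) (c : 'I_l -> R) (p : bounded_linear E R) :
  nbhs v0 U -> gateaux_differentiable F v0 ->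
  (forall i, gateaux_differentiable (F0 i) v0 \/ c i = 0) ->
  (forall v, U v -> \sum_i c i * F0 i v + p (F v) <= \sum_i c i * F0 i v0 + p (F v0)) ->
  \sum_i c i *: DG (F0 i) v0 + bl_comp p (DG F v0) = 0.
Proof.
move=> Uv0 /DGP dF dF0 max; set D := LHS.
have D_le0 y : D y <= 0.
  pose Q (t : R) := \sum_i c i * (t^-1 *: (F0 i (v0 + t *: y) - F0 i v0)) +
    p (t^-1 *: (F (v0 + t *: y) - F v0)).
  have QD : Q @ (0 : R)^'+ --> D y.
    rewrite /D blDE bl_compE bl_sumE; apply: cvgD; last first.
      exact: (cvg_comp _ _ (dF y) (@bl_continuous R E R p (DG F v0 y))).
    apply: cvg_big => [|i _]; first exact: add_continuous.
    rewrite blZE; case: (dF0 i) => [/DGP dFi|->]; last first.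
      (* [DG (F0 i)] may be a default value here, but it is multiplied by 0. *)
      by rewrite scale0r; under eq_fun do rewrite mul0r; exact: cvg_cst.
    by apply: cvgM; [exact: cvg_cst|exact: dFi].
  have Uy : \forall t \near (0 : R)^'+, U (v0 + t *: y).
    have cy : v0 + t *: y @[t --> (0 : R)^'+] --> v0.
      rewrite -[X in _ --> X]addr0; apply: cvgD; first exact: cvg_cst.
      rewrite -(scale0r y); apply: cvgZ; last exact: cvg_cst.
      by apply: cvg_at_right_filter; exact: cvg_id.
    exact: cy.
  apply: (ler_cvg_to QD (cvg_cst (0 : R))).
  have pos : \forall t \near (0 : R)^'+, 0 < t by exact: nbhs_right_gt.
  apply: filterS (filterI Uy pos) => t [Ut t0]; rewrite /Q bl_Z.
  under eq_bigr do rewrite scalerRE mulrCA.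
  rewrite -mulr_sumr scalerRE -mulrDr pmulr_rle0 ?invr_gt0//.
  under eq_bigr do rewrite mulrBr.
  by rewrite sumrB bl_B; have := max _ Ut; lra.
apply: bl_ext => y; rewrite bl0E; apply/eqP; rewrite eq_le D_le0 /=.
by rewrite -oppr_le0 -[- D y](_ : D (- y) = _) ?D_le0// -scaleN1r bl_Z scaleN1r.
Qed.

(** In reversed time the difference of two solutions solves a homogeneous linear equation with
    initial value 0, so Gronwall makes it vanish. *)
Lemma costate_unique (R : realType) (E : completeNormedModType R) (T : R) S
    (A : R -> bounded_linear E E) (B p p' : R -> bounded_linear E R) : 0 < T ->
  pcont 0 T S setT A ->
  primitive 0 T S p (fun t => - (bl_comp (p t) (A t) + B t)) ->
  primitive 0 T S p' (fun t => - (bl_comp (p' t) (A t) + B t)) ->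
  p T = p' T -> forall t, 0 <= t <= T -> p t = p' t.
Proof.
move=> T0 Ac pp pp' pT t /andP[t0 tT].
have [M M0 AM] := pcont_bounded (ltW T0) Ac.
(* [primitive_reverse] expects a reversed list, and reversing [S] twice gives it that form. *)
have SS : {subset S <= [seq T - s | s <- [seq T - s | s <- S]]}.
  by move=> s sS; apply/mapP; exists (T - s); [exact: (map_f (fun s => T - s))|rewrite subKr].
have wp := primitive_reverse (primitive_subS SS (primitiveB pp pp')).
have Tt : 0 <= T - t by rewrite subr_ge0.
have Tt' : T - t <= T by rewrite gerBl.
have wpt := primitive_sub (lexx 0) Tt' wp.
have := gronwall (L := M) Tt M0 wpt (primitive_cst 0 (T - t) _ (0 : R)).
rewrite subKr subr0 subr0 pT subrr normr0 subrr addr0 mulr0 normr_le0 subr_eq0 => H.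
apply/eqP; apply: H => s /andP[s0 sT] _; rewrite lexx addr0; split=> //.
have -> : - (- (bl_comp (p (T - s)) (A (T - s)) + B (T - s)) -
    - (bl_comp (p' (T - s)) (A (T - s)) + B (T - s))) =
    bl_comp (p (T - s) - p' (T - s)) (A (T - s)).
  by apply: bl_ext => y; rewrite !(blDE, blNE, bl_compE); ring.
apply: le_trans (bl_comp_norm _ _) _; rewrite mulrC ler_wpM2r// AM//; lra.
Qed.

Section Terminal.
Context {R : realType} {E : completeNormedModType R} {Y : normedModType R} {l m q : nat}.
Variables (T : R) (U : set Y) (f : R -> E -> Y -> E) (f0 : 'I_l -> R -> E -> Y -> R).
Variables (g0 : 'I_l -> E -> R) (g : 'I_m -> E -> R) (h : 'I_q -> E -> R).
Variables (x0 : R -> E) (u0 : R -> Y).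
Hypothesis T0 : 0 < T.
Hypothesis U_nbhs : nbhs (u0 T) U.
Hypothesis DG3f : gateaux_differentiable (f T (x0 T)) (u0 T).

Let D := DG (f T (x0 T)) (u0 T).

Lemma terminal_relation (theta : 'rV[R]_l) (lambda : 'rV[R]_m) (mu : 'rV[R]_q)
    (p : R -> bounded_linear E R) :
  (forall i, gateaux_differentiable (f0 i T (x0 T)) (u0 T) \/ theta 0 i = 0) ->
  pontryagin_conditions T U f f0 g0 g h x0 u0 theta lambda mu p ->
  \sum_i theta 0 i *: (bl_comp (DH (g0 i) (x0 T)) D + DG (f0 i T (x0 T)) (u0 T)) +
  \sum_a lambda 0 a *: bl_comp (DH (g a) (x0 T)) D +
  \sum_b mu 0 b *: bl_comp (DH (h b) (x0 T)) D = 0.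
Proof.
move=> df0 [_ _ _ TC [_ MP _]]; have TT : T \in `[0, T] by rewrite in_itv /= lexx ltW.
rewrite -[RHS](stationary_max U_nbhs DG3f df0 (MP T ^~ TT)) -TC.
have comb n (V : normedModType R) (c : 'I_n -> R) (L : 'I_n -> bounded_linear V R) v :
    (\sum_i c i *: L i) v = \sum_i c i * L i v by rewrite bl_sumE.
have comb_comp n (c : 'I_n -> R) (L : 'I_n -> bounded_linear E R) y :
    (\sum_i c i *: bl_comp (L i) D) y = \sum_i c i * L i (D y) by rewrite bl_sumE.
apply: bl_ext => y; rewrite !blDE bl_compE !blDE !comb_comp !comb.
under eq_bigr do rewrite blDE bl_compE mulrDr.
by rewrite big_split -/D /=; ring.
Qed.

Variable j : 'I_l.
Hypothesis indep : linearly_independent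
    (fun k : {i : 'I_l | i != j} + 'I_m + 'I_q =>
      match k with
      | inl (inl i) =>
          bl_comp (DH (g0 (val i)) (x0 T)) (DG (f T (x0 T)) (u0 T))
          + DG (f0 (val i) T (x0 T)) (u0 T)
      | inl (inr a) => bl_comp (DH (g a) (x0 T)) (DG (f T (x0 T)) (u0 T))
      | inr b => bl_comp (DH (h b) (x0 T)) (DG (f T (x0 T)) (u0 T))
      end).

(** Being linear in the multipliers, this serves twice: for a tuple with [theta 0 j = 0], and for
    the difference of two normalized tuples. *)
Lemma terminal_independent (theta : 'rV[R]_l) (lambda : 'rV[R]_m) (mu : 'rV[R]_q) :
  theta 0 j = 0 ->
  \sum_i theta 0 i *: (bl_comp (DH (g0 i) (x0 T)) D + DG (f0 i T (x0 T)) (u0 T)) +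
  \sum_a lambda 0 a *: bl_comp (DH (g a) (x0 T)) D +
  \sum_b mu 0 b *: bl_comp (DH (h b) (x0 T)) D = 0 ->
  [/\ theta = 0, lambda = 0 & mu = 0].
Proof.
move=> thj rel.
pose c (k : {i : 'I_l | i != j} + 'I_m + 'I_q) := match k with
  | inl (inl i) => theta 0 (val i) | inl (inr a) => lambda 0 a | inr b => mu 0 b end.
have c0 : forall k, c k = 0.
  apply: (indep (c := c)); rewrite !big_sumType /= -[RHS]rel; congr (_ + _ + _).
  (* The vanishing coefficient removes the functional of index [j], which is not part of the
     independent family; the other indices form the subtype. *)
  rewrite [RHS](bigD1 j)//= thj scale0r add0r.
  rewrite [RHS](reindex_omap (val : {i : 'I_l | i != j} -> 'I_l) insub)/=; last first.
    by move=> i ij; rewrite insubT.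
  by apply: eq_bigl => -[i ij]; rewrite /= insubT ij /= eqxx.
split; apply/rowP => i; rewrite mxE.
- by have [->|ij] := eqVneq i j; [|exact: (c0 (inl (inl (Sub i ij))))].
- exact: (c0 (inl (inr i))).
- exact: (c0 (inr i)).
Qed.

End Terminal.

Unset Implicit Arguments.
Set Strict Implicit.
Set Printing Implicit Defensive.

Theorem corollary4p13
  (R : realType) (E : completeNormedModType R) (Y : normedModType R)
  (l m q : nat) (T : R) (Omega : set E) (U : set Y) (xi0 : E)
  (f : R -> E -> Y -> E) (f0 : 'I_l -> R -> E -> Y -> R)
  (g0 : 'I_l -> E -> R) (g : 'I_m -> E -> R) (h : 'I_q -> E -> R)
  (x0 : R -> E) (u0 : R -> Y) (j : 'I_l)
  (T_gt0 : 0 < T) (l_gt0 : (0 < l)%N) (m_gt0 : (0 < m)%N) (q_gt0 : (0 < q)%N)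
  (Omega_open : open Omega) (Omega_neq0 : Omega !=set0) (xi0_in : Omega xi0)
  (opt : pareto_optimal T Omega U xi0 f f0 g0 g h x0 u0)
  (hyp_a : forall i, regular_along T Omega U x0 (f0 i))
  (hyp_b : regular_along T Omega U x0 f)
  (hyp_c : (forall i, hadamard_differentiable (g0 i) (x0 T)) /\
           (forall a, hadamard_differentiable (g a) (x0 T)))
  (hyp_d : forall b,
    (exists2 V, nbhs (x0 T) V & {within V, continuous (h b)}) /\
    hadamard_differentiable (h b) (x0 T))
  (U_nbhs : nbhs (u0 T) U)
  (DG3f : gateaux_differentiable (f T (x0 T)) (u0 T))
  (DG3f0 : forall i, i != j ->
    gateaux_differentiable (f0 i T (x0 T)) (u0 T))
  (indep : linearly_independent
    (fun k : {i : 'I_l | i != j} + 'I_m + 'I_q =>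
      match k with
      | inl (inl i) =>
          bl_comp (DH (g0 (val i)) (x0 T)) (DG (f T (x0 T)) (u0 T))
          + DG (f0 (val i) T (x0 T)) (u0 T)
      | inl (inr a) => bl_comp (DH (g a) (x0 T)) (DG (f T (x0 T)) (u0 T))
      | inr b => bl_comp (DH (h b) (x0 T)) (DG (f T (x0 T)) (u0 T))
      end)) :
  [/\ forall (theta : 'rV[R]_l) (lambda : 'rV[R]_m) (mu : 'rV[R]_q)
        (p : R -> bounded_linear E R),
        PC1 T setT p ->
        pontryagin_conditions T U f f0 g0 g h x0 u0 theta lambda mu p ->
        theta 0 j <> 0,
      exists (theta : 'rV[R]_l) (lambda : 'rV[R]_m) (mu : 'rV[R]_q)
        (p : R -> bounded_linear E R),
        [/\ PC1 T setT p,
            pontryagin_conditions T U f f0 g0 g h x0 u0 theta lambda mu p &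
            theta 0 j = 1] &
      gateaux_differentiable (f0 j T (x0 T)) (u0 T) ->
      forall (theta theta' : 'rV[R]_l) (lambda lambda' : 'rV[R]_m)
        (mu mu' : 'rV[R]_q) (p p' : R -> bounded_linear E R),
        PC1 T setT p -> PC1 T setT p' ->
        pontryagin_conditions T U f f0 g0 g h x0 u0 theta lambda mu p ->
        pontryagin_conditions T U f f0 g0 g h x0 u0 theta' lambda' mu' p' ->
        theta 0 j = 1 -> theta' 0 j = 1 ->
        [/\ theta = theta', lambda = lambda', mu = mu' &
            forall t : R, t \in `[0, T] -> p t = p' t]].
Proof.
have [g0_hadamard g_hadamard] := hyp_c.
have nonzero (theta : 'rV[R]_l) lambda mu p :
    pontryagin_conditions T U f f0 g0 g h x0 u0 theta lambda mu p -> theta 0 j <> 0.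
  (* Nothing is known about the differential of [f0 j] at this point, but its coefficient is the
     vanishing [theta 0 j]. *)
  move=> H thj; have df0 i : gateaux_differentiable (f0 i T (x0 T)) (u0 T) \/ theta 0 i = 0.
    by have [->|ij] := eqVneq i j; [right|left; exact: DG3f0].
  have [th la m0] := terminal_independent indep thj (terminal_relation T_gt0 U_nbhs DG3f df0 H).
  by case: H => NN _ _ _ _; apply: NN; rewrite th la m0.
split.
- by move=> theta lambda mu p _; exact: nonzero.
- have [S0 [L [un xp HL]]] := multiplier_exists T_gt0 l_gt0 Omega_open opt hyp_a hyp_b
    g0_hadamard g_hadamard hyp_d.
  have pont L' := @multiplier_pontryagin _ _ _ _ _ _ _ _ _ _ _ _ _ _ _ _ _ T_gt0 l_gt0
    Omega_open opt hyp_a hyp_b S0 L' un xp.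
  have Lj : 0 < L (inl (inl j)).
    have [p [_ /nonzero]] := pont L HL; rewrite mxE => /eqP Lj.
    by case: HL => _ L0 _ _; rewrite lt_neqAle eq_sym Lj L0.
  have [|p [pPC1 Hp]] := pont (fun i => (L (inl (inl j)))^-1 * L i).
    by apply: is_multiplierZ HL; rewrite invr_gt0.
  exists (\row_i ((L (inl (inl j)))^-1 * L (inl (inl i)))),
    (\row_a ((L (inl (inl j)))^-1 * L (inl (inr a)))),
    (\row_b ((L (inl (inl j)))^-1 * L (inr b))), p; split=> //.
  by rewrite mxE mulVf// gt_eqF.
- move=> df0j theta theta' lambda lambda' mu mu' p p' pPC1 pPC1' H H' thj thj'.
  have df0 i : gateaux_differentiable (f0 i T (x0 T)) (u0 T).
    by have [->//|] := eqVneq i j; exact: DG3f0.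
  have rel := terminal_relation T_gt0 U_nbhs DG3f (fun i => or_introl (df0 i)) H.
  have rel' := terminal_relation T_gt0 U_nbhs DG3f (fun i => or_introl (df0 i)) H'.
  (* The relation is linear, and in the difference of the two tuples the coefficient of index [j] is
     [1 - 1]. *)
  have [||eth ela emu] := terminal_independent (theta := theta - theta')
      (lambda := lambda - lambda') (mu := mu - mu') indep.
  + by rewrite !mxE thj thj' subrr.
  + rewrite -[RHS](subrr 0) -[X in _ = X - _]rel -[X in _ = _ - X]rel'.
    have comb n (V : lmodType R) (c c' : 'rV[R]_n) (v : 'I_n -> V) :
        \sum_i (c - c') 0 i *: v i = \sum_i c 0 i *: v i - \sum_i c' 0 i *: v i.
      by rewrite -sumrB; apply: eq_bigr => i _; rewrite !mxE scalerBl.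
    by rewrite !comb; zmod.
  move: eth ela emu H'; move=> /eqP; rewrite subr_eq0 => /eqP <- /eqP; rewrite subr_eq0.
  move=> /eqP <- /eqP; rewrite subr_eq0 => /eqP <- H'; split=> // t tT.
  have [[[xO x0c _] u0_NPC0 _ _] _] := opt.
  have x0O s : 0 <= s <= T -> Omega (x0 s) by move=> sT; apply: xO; rewrite in_itv.
  have [S0 un] := NPC0_npc u0_NPC0.
  have [_ _ [Ac _ _] _] := regular_smooth T_gt0 Omega_open x0c x0O un hyp_b.
  have [S1 pp] := PC1_primitive pPC1; have [S2 pp'] := PC1_primitive pPC1'.
  (* One list carries the exceptional points of the control and of both costates, so that the two
     adjoint equations can be compared. *)
  pose S := S0 ++ S1 ++ S2.
  have costate p1 S' : {subset S' <= S} -> primitive 0 T S' p1 (ext_deriv T p1) ->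
      pontryagin_conditions T U f f0 g0 g h x0 u0 theta lambda mu p1 ->
      primitive 0 T S p1 (fun s => - (bl_comp (p1 s) (DF (f s ^~ (u0 s)) (x0 s)) +
        \sum_i theta 0 i *: DF (f0 i s ^~ (u0 s)) (x0 s))).
    move=> SS pp1 [_ _ _ _ [AE _ _]].
    apply: primitive_ext (primitive_subS SS pp1) => // s /andP[s0 sT] _.
    have sT' : s \in `[0, T] by rewrite in_itv /= !ltW.
    have Us : U (u0 s) by case: un => -[uU _ _ _] _ _; apply: uU; rewrite !ltW.
    rewrite AE// DF_hamiltonian// => [|i].
      by have [_ _ dF _ _] := hyp_b; exact: dF.
    by have [_ _ dF _ _] := hyp_a i; exact: dF.
  have S1S : {subset S1 <= S} by move=> s sS; rewrite !mem_cat sS orbT.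
  have S2S : {subset S2 <= S} by move=> s sS; rewrite !mem_cat sS !orbT.
  have S0S : {subset S0 <= S} by move=> s sS; rewrite mem_cat sS.
  apply: (costate_unique T_gt0 (pcont_subS S0S Ac) (costate p S1 S1S pp H)
    (costate p' S2 S2S pp' H')); last by rewrite in_itv in tT.
  by case: H => _ _ _ <- _; case: H' => _ _ _ <- _.
Qed.
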